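(* There is an algorithm that, given only a string $w[1..n]$ over a totally ordered alphabet (without any pre-processing such as suffix or LCP arrays), correctly computes the $\mathcal{MRC}$ array of $w$ in $\mathcal{O}(n\log n)$ time and $\Theta(n)$ auxiliary space.
   Context: Strings are indexed from 1; $w[i..j]$ denotes the substring (occurrence) from position $i$ to $j$. A border of a string $x$ is a nonempty string that is both a proper prefix and a proper suffix of $x$. A string $x$ is closed if $|x|=1$, or $|x|\ge2$ and $x$ has a border occurring in $x$ only as a prefix and as a suffix and nowhere else. An occurrence $w[i..j]$ is maximal right-closed if it is closed and either $j=n$ or $w[i..j+1]$ is not closed. For a position $i$, let $r_1,\ldots,r_{K_i}$ be the maximal right-closed occurrences starting at $i$ with $|r_1|<\cdots<|r_{K_i}|$, and let $b_j$ be the longest border of $r_j$ ($|b_j|=0$ if $|r_j|=1$). The $\mathcal{MRC}$ array of $w$ is the array of length $n$ whose entry $\mathcal{MRC}[i]$ is the list of pairs $(|r_j|,|b_j|)$ for $j=K_i$ down to $1$. *)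

(* Defs.v *)
From mathcomp Require Import all_boot all_order.

Set Implicit Arguments.
Unset Strict Implicit.
Unset Printing Implicit Defensive.

Local Open Scope nat_scope.

(* Strings are sequences; positions in strings start at 1. *)

Section ClosedStrings.
Variable T : eqType.
Implicit Types (w x b : seq T) (i j p : nat).

Definition substr w i j := drop i.-1 (take j w).

Definition is_border b x :=
  [&& b != [::], size b < size x, prefix b x & suffix b x].

Definition borders x :=
  [seq b <- [seq take l x | l <- iota 1 (size x)] | is_border b x].

Definition occurrences b x :=
  [seq p <- iota 1 (size x) | substr x p (p + size b).-1 == b].

Definition occurs_only_at_ends b x :=
  all (fun p => (p == 1) || (p + size b == (size x).+1)) (occurrences b x).

Definition closed x :=
  (size x == 1) ||
  (1 < size x) && has (fun b => occurs_only_at_ends b x) (borders x).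

Definition longest_border x := \max_(b <- borders x) size b.

Definition max_right_closed w i j :=
  closed (substr w i j) && ((j == size w) || ~~ closed (substr w i j.+1)).

(* The end position j runs downwards from size w to i, so that the pairs come
   in decreasing order of length. *)
Definition MRC_entry w i :=
  [seq (size (substr w i j), longest_border (substr w i j))
     | j <- rev (iota i ((size w).+1 - i)) & max_right_closed w i j].

Definition MRC w := [seq MRC_entry w i | i <- iota 1 (size w)].

Lemma mem_borders b x : (b \in borders x) = is_border b x.
Proof.
rewrite mem_filter; case Hb: (is_border b x) => //=.
case/and4P: Hb => b0 lt_bx pre_bx _; apply/mapP; exists (size b).
  by rewrite mem_iota add1n ltnS (ltnW lt_bx) lt0n size_eq0 b0.
by apply/eqP; rewrite eq_sym -prefixE.
Qed.

Lemma closedP x :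
  reflect (size x = 1 \/
           (2 <= size x /\ exists b, is_border b x /\
              forall p, 1 <= p <= size x -> substr x p (p + size b).-1 = b ->
                p = 1 \/ p = (size x).+1 - size b))
          (closed x).
Proof.
apply: (iffP orP) => [[/eqP|/andP[x2 /hasP[b]]]|].
- by left.
- rewrite mem_borders => bx /allP Hb; right; split=> //; exists b; split=> //.
  move=> p px Ep; have /Hb : p \in occurrences b x.
    by rewrite mem_filter Ep eqxx mem_iota add1n ltnS.
  by case/orP=> /eqP; [left | move=> <-; right; rewrite addnK].
case=> [->|[x2 [b [bx Hb]]]]; [by left | right; rewrite x2 /=].
apply/hasP; exists b; first by rewrite mem_borders.
apply/allP=> p; rewrite mem_filter mem_iota add1n ltnS => /andP[/eqP Ep px].
case: (Hb p px Ep) => ->; first by rewrite eqxx.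
case/and4P: bx => _ lt_bx _ _.
by rewrite subnK ?eqxx ?orbT // leqW // ltnW.
Qed.

End ClosedStrings.

(* Model of computation: a structured language for the unit-cost word RAM in
   the comparison model.  A program does not depend on the alphabet; it reads
   its input w only through the length of w and through comparisons
   w[i] <= w[j] of two letters given by their positions.  Scalar variables and
   arrays are named by numbers fixed in the program text, so that a program has
   a constant number of each. *)

Inductive binop := Add | Sub | Mul | Div.

Definition binop_eval o :=
  match o with Add => addn | Sub => subn | Mul => muln | Div => divn end.

Inductive expr :=
| Const of nat
| Var of nat
| Len
| Get of nat & expr
| Bin of binop & expr & expr.

Inductive cond :=
| Le of expr & expr
| LetterLe of expr & expr
| Not of cond
| And of cond & cond.

Inductive com :=
| Skip
| Assign of nat & expr
| Alloc of nat & expr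
| Store of nat & expr & expr
| Push of expr & expr & expr
| Seq of com & com
| If of cond & com & com
| While of cond & com.

(* [space] is the number of array words allocated so far; the O(1) scalars of
   the program are not counted.  [out] is the write-only output: the array of
   lists produced so far, which no expression or test can read. *)
Record state := State {
  var : nat -> nat;
  arr : nat -> seq nat;
  space : nat;
  out : seq (seq (nat * nat)) }.

Definition init_state n :=
  State (fun=> 0) (fun=> [::]) 0 (nseq n [::]).

Definition set_var s x v :=
  State [eta var s with x |-> v] (arr s) (space s) (out s).

Definition alloc s a m :=
  State (var s) [eta arr s with a |-> nseq m 0] (space s + m) (out s).

Definition store s a i v :=
  State (var s) [eta arr s with a |-> set_nth 0 (arr s a) i v]
        (space s) (out s).

Definition push s i q :=
  State (var s) (arr s) (space s)
        (set_nth [::] (out s) i.-1 (q :: nth [::] (out s) i.-1)).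

Section Semantics.
(* Words have k * (1 + floor(log2 n)) bits, where n is the input length.
   Evaluation is undefined when a value does not fit in a word, on an array
   access out of bounds, and on a position outside w. *)
Variable k : nat.
Variables (d : Order.disp_t) (T : orderType d) (w : seq T).

Definition word (v : nat) : option nat :=
  if v < 2 ^ (k * (trunc_log 2 (size w)).+1) then Some v else None.

Definition letter (i : nat) : option T :=
  if i is i'.+1 then onth w i' else None.

Fixpoint eval (s : state) (e : expr) : option nat :=
  match e with
  | Const v => word v
  | Var x => Some (var s x)
  | Len => word (size w)
  | Get a e1 => if eval s e1 is Some i then onth (arr s a) i else None
  | Bin o e1 e2 =>
      if (eval s e1, eval s e2) is (Some v1, Some v2)
      then word (binop_eval o v1 v2) else None
  end.

Fixpoint test (s : state) (c : cond) : option bool :=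
  match c with
  | Le e1 e2 =>
      if (eval s e1, eval s e2) is (Some v1, Some v2)
      then Some (v1 <= v2) else None
  | LetterLe e1 e2 =>
      if (obind letter (eval s e1), obind letter (eval s e2))
         is (Some a1, Some a2)
      then Some (a1 <= a2)%O else None
  | Not c1 => omap negb (test s c1)
  | And c1 c2 =>
      match test s c1 with
      | Some true => test s c2
      | r => r
      end
  end.

(* [exec c s s' t]: started in s, the command c terminates in s' after t steps.
   Every elementary command and every test takes one step (the expressions
   occurring in a program have bounded size), except that the allocation of m
   words, which are set to 0, takes m + 1 steps.  An array is allocated at most
   once with nonzero size and never freed, so that [space s'] is also the peak
   number of words in use.  [Push] adds a pair at the head of an output list. *)
Inductive exec : com -> state -> state -> nat -> Prop :=
| ExecSkip s : exec Skip s s 1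
| ExecAssign s x e v :
    eval s e = Some v -> exec (Assign x e) s (set_var s x v) 1
| ExecAlloc s a e m :
    eval s e = Some m -> arr s a = [::] ->
    exec (Alloc a e) s (alloc s a m) m.+1
| ExecStore s a e1 e2 i v :
    eval s e1 = Some i -> eval s e2 = Some v -> i < size (arr s a) ->
    exec (Store a e1 e2) s (store s a i v) 1
| ExecPush s e1 e2 e3 i l b :
    eval s e1 = Some i -> eval s e2 = Some l -> eval s e3 = Some b ->
    1 <= i <= size (out s) ->
    exec (Push e1 e2 e3) s (push s i (l, b)) 1
| ExecSeq c1 c2 s s1 s2 t1 t2 :
    exec c1 s s1 t1 -> exec c2 s1 s2 t2 -> exec (Seq c1 c2) s s2 (t1 + t2)
| ExecIf c c1 c2 s s1 t1 r :
    test s c = Some r -> exec (if r then c1 else c2) s s1 t1 ->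
    exec (If c c1 c2) s s1 t1.+1
| ExecWhileFalse c c1 s :
    test s c = Some false -> exec (While c c1) s s 1
| ExecWhileTrue c c1 s s1 s2 t1 t2 :
    test s c = Some true -> exec c1 s s1 t1 -> exec (While c c1) s1 s2 t2 ->
    exec (While c c1) s s2 (t1 + t2).+1.

Lemma exec_det c s s1 t1 s2 t2 :
  exec c s s1 t1 -> exec c s s2 t2 -> s1 = s2 /\ t1 = t2.
Proof.
move=> H; elim: H s2 t2 => {c s s1 t1}.
- by move=> s s2 t2 H; inversion H; subst.
- by move=> s x e v E s2 t2 H; inversion H; subst; split=> //; congruence.
- by move=> s a e m E Ea s2 t2 H; inversion H; subst; split; congruence.
- by move=> s a e1 e2 i v E1 E2 lt_i s2 t2 H; inversion H; subst; split;
    congruence.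
- by move=> s e1 e2 e3 i l b E1 E2 E3 lt_i s2 t2 H; inversion H; subst; split;
    congruence.
- move=> c1 c2 s s1 s1' t1 t1' _ IH1 _ IH2 s2 t2 H; inversion H; subst.
  have [? ?] := IH1 _ _ H2; subst.
  by have [-> ->] := IH2 _ _ H6.
- move=> c c1 c2 s s1 t1 r E _ IH s2 t2 H; inversion H; subst.
  have Er : r0 = r by congruence.
  by subst r0; have [-> ->] := IH _ _ H7.
- by move=> c c1 s E s2 t2 H; inversion H; subst; split=> //; congruence.
- move=> c c1 s s1 s1' t1 t1' E _ IH1 _ IH2 s2 t2 H; inversion H; subst.
    by congruence.
  have [? ?] := IH1 _ _ H3; subst.
  by have [-> ->] := IH2 _ _ H7.
Qed.

End Semantics.

(* Main.v *)
Require Import Defs.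
From mathcomp Require Import all_boot all_order zify.

(* Write E_l for the equivalence of positions whose factors of length l agree.
   The closed factors that start at i are given by a border length l and the next
   occurrence p > i of the factor of length l at i, and such a factor is maximal
   right-closed exactly when p is no longer the next occurrence for l + 1.  So
   MRC lists the changes of the next element in the class of i, as l grows.

   The program refines E_l into E_(l+1) as Crochemore's partitioning algorithm
   does, with classes kept as lists sorted by position.  Within a class of E_l,
   x is separated according to the class of x + 1 in E_l.  It suffices to move the
   x for which the class of x + 1 has at most half the size of its parent in
   E_(l-1), because each parent has at most one other child.  A position lies in
   such a small class at most log n times: the sum of the logarithms of the class
   sizes drops at least by the number of positions that are moved next.
   The partition E_1 is obtained by merge sort from the comparisons of letters. *)

Set Implicit Arguments.
Unset Strict Implicit.
Unset Printing Implicit Defensive.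

(** * Next occurrences and closed factors *)

(** Handling a queued position in constant time rests on three facts. A next link changes only at a
    moved position, at its predecessor at the time of the move, and at the tail it is appended to,
    which is a sentinel or was moved before. The changed links are thus found without a scan. A link
    may change several times in a round, so it is compared with its saved value only after all
    moves. Appending keeps the lists sorted because the queue is increasing inside each group of
    equal stamps. Reading off the sorted list of a small class yields such a group for the next
    round. No array is cleared between rounds: stamps and round numbers only grow, so a stale entry
    is recognised by being too small. The price is that stamps reach the order of n^2, which the
    words must hold. Names of classes are recycled, but a name emptied by the moves is withheld
    until the moves are over; during a round a name therefore tells old classes from new ones. The
    cost of a round is linear in the length of its queue, so the drop of the potential in one round
    pays for the queue of the next. *)

Section Factors.
Variables (T : eqType) (w : seq T).
Implicit Types (l i j x y z p : nat).
Notation n := (size w).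

(* Positions start at 0 here, and [n] is the position of the empty suffix.
   The truncation at the end of [w] separates any two suffixes of which one is
   shorter than [l]. *)
Definition eqv l x y := take l (drop x w) == take l (drop y w).

Lemma eqv_refl l x : eqv l x x. Proof. exact: eqxx. Qed.

Lemma eqv_sym l x y : eqv l x y = eqv l y x. Proof. exact: eq_sym. Qed.

Lemma eqv_trans l x y z : eqv l x y -> eqv l y z -> eqv l x z.
Proof. by move=> /eqP exy /eqP eyz; apply/eqP; rewrite exy. Qed.

Lemma eqv_leq l l' x y : l <= l' -> eqv l' x y -> eqv l x y.
Proof.
move=> ll' /eqP e; apply/eqP.
by rewrite -(take_takel _ ll') e (take_takel _ ll').
Qed.

Lemma eqv0 x y : eqv 0 x y. Proof. by rewrite /eqv !take0. Qed.

Lemma eqv_size l x y : eqv l x y -> minn l (n - x) = minn l (n - y).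
Proof. by move=> /eqP /(congr1 size); rewrite !size_take_min !size_drop. Qed.

Lemma eqv_lt l x y : x < y <= n -> eqv l x y -> y + l <= n.
Proof. by move=> xy /eqv_size; lia. Qed.

Lemma eqv_end l y : y <= n -> eqv l.+1 n y -> y = n.
Proof. by move=> yn /eqv_size; lia. Qed.

Lemma dropS x : drop x.+1 w = behead (drop x w).
Proof. by rewrite -drop1 drop_drop. Qed.

Lemma eqv_behead l x y : eqv l.+1 x y -> eqv l x.+1 y.+1.
Proof.
rewrite /eqv !dropS => /eqP /(congr1 behead).
by case: (drop x w) => [|a u]; case: (drop y w) => [|b v] //= ->.
Qed.

Lemma eqvS l x y : eqv l.+1 x y -> eqv l.+1 x.+1 y.+1 -> eqv l.+2 x y.
Proof.
rewrite /eqv !dropS => /eqP e1 /eqP; move: e1.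
case: (drop x w) => [|a u]; case: (drop y w) => [|b v] //=.
by move=> [-> _] ->.
Qed.

Lemma eqv1 x y a : x < n -> y < n -> eqv 1 x y = (nth a w x == nth a w y).
Proof.
move=> xn yn; rewrite /eqv (drop_nth a xn) (drop_nth a yn) /= !take0.
by rewrite eqseq_cons eqxx andbT.
Qed.

(* Equals [n.+1] when the factor of length [l] at [i] does not occur later. *)
Definition nxt_occ l i := i.+1 + find (eqv l i) (iota i.+1 (n - i)).

Lemma nxt_occ_gt l i : i < nxt_occ l i.
Proof. by rewrite /nxt_occ; lia. Qed.

Lemma nxt_occ_eqv l i : nxt_occ l i <= n -> eqv l i (nxt_occ l i).
Proof.
rewrite /nxt_occ => le_n.
have lt_f : find (eqv l i) (iota i.+1 (n - i)) < n - i by lia.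
have := lt_f; rewrite -{2}(size_iota i.+1 (n - i)) -has_find => /(nth_find 0).
by rewrite nth_iota.
Qed.

Lemma nxt_occ_leq l i p : i < p <= n -> eqv l i p -> nxt_occ l i <= p.
Proof.
move=> ip e; rewrite /nxt_occ.
case: (leqP (find (eqv l i) (iota i.+1 (n - i))) (p - i.+1)) => [|lt_f].
  by lia.
have := before_find 0 lt_f; rewrite nth_iota; last by lia.
by rewrite subnKC ?e //; lia.
Qed.

Lemma nxt_occ_none l i :
  i <= n -> (forall z, i < z <= n -> ~~ eqv l i z) -> nxt_occ l i = n.+1.
Proof.
move=> i_n H; case: (leqP (nxt_occ l i) n) => [le_n|].
  by have /negP[] := H _ (introT andP (conj (nxt_occ_gt l i) le_n));
    apply: nxt_occ_eqv.
have := find_size (eqv l i) (iota i.+1 (n - i)); rewrite size_iota /nxt_occ.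
by lia.
Qed.

Lemma nxt_occ_unique l i p : i < p <= n -> eqv l i p ->
  (forall z, i < z < p -> ~~ eqv l i z) -> nxt_occ l i = p.
Proof.
move=> ip e H; have le_p := nxt_occ_leq ip e.
apply/eqP; rewrite eqn_leq le_p leqNgt; apply/negP=> lt_p.
have /negP[] := H _ (introT andP (conj (nxt_occ_gt l i) lt_p)).
by apply: nxt_occ_eqv; lia.
Qed.

Lemma nxt_occ_max l i : i <= n -> nxt_occ l i <= n.+1.
Proof.
move=> i_n; have := find_size (eqv l i) (iota i.+1 (n - i)).
by rewrite size_iota /nxt_occ; lia.
Qed.

Lemma nxt_occ_homo l l' i : i <= n -> l <= l' -> nxt_occ l i <= nxt_occ l' i.
Proof.
move=> i_n ll'; case: (leqP (nxt_occ l' i) n) => [le_n|lt_n]; last first.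
  by apply: leq_trans lt_n; apply: nxt_occ_max.
apply: nxt_occ_leq; first by rewrite nxt_occ_gt.
exact: eqv_leq ll' (nxt_occ_eqv le_n).
Qed.

Lemma nxt_occ_end l i : i < n -> nxt_occ l i <= n -> nxt_occ l i + l <= n.
Proof.
by move=> i_n le_n; apply: (@eqv_lt l i); rewrite ?nxt_occ_gt ?nxt_occ_eqv.
Qed.

Lemma substr0 i j : substr w i.+1 j = take (j - i) (drop i w).
Proof.
rewrite /substr /=; case: (leqP i j) => [ij|ji].
  by rewrite take_drop subnK.
rewrite drop_oversize ?size_take_min; last by lia.
by rewrite (_ : j - i = 0) ?take0 //; lia.
Qed.

(** * Closed factors with a fixed start and end *)

Section ClosedFactors.
Variables (i j : nat).
Hypothesis (ij : i < j <= n).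
Let s := substr w i.+1 j.

Let size_s : size s = j - i.
Proof. by rewrite /s substr0 size_take_min size_drop; lia. Qed.

Let take_drop_s l p : p + l <= j - i -> take l (drop p s) = take l (drop (i + p) w).
Proof.
move=> pl; rewrite /s substr0 take_drop take_takel; last by lia.
by rewrite -take_drop drop_drop addnC.
Qed.

(** For [0 < l] the witness is the prefix of length [l]: an occurrence past the first one is an
    occurrence in [w] at or after [nxt_occ l i], where the last copy starts. For [l = 0] the next
    occurrence is [i.+1] and the factor is a single letter. *)
Lemma closed_nxt_occ l : nxt_occ l i <= n -> nxt_occ l i + l = j -> Defs.closed s.
Proof.
move=> le_n e; have gt_i := nxt_occ_gt l i.
apply/closedP; rewrite size_s.
case: (ltnP 0 l) => [l0|]; last first.
  rewrite leqn0 => /eqP l0; left; subst l.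
  by have := @nxt_occ_leq 0 i i.+1; rewrite eqv0; lia.
right; split; first by lia.
have size_b : size (take l s) = l by rewrite size_takel // size_s; lia.
exists (take l s); split; last first.
  move=> p ps; rewrite size_b => Ep.
  have size_p : (p + l).-1 <= j - i.
    move: (congr1 size Ep); rewrite size_b /substr size_drop size_take_min size_s.
    by lia.
  have {}Ep : take l (drop p.-1 s) = take l (drop 0 s).
    rewrite drop0 -Ep /substr take_drop; congr (drop _ (take _ _)); lia.
  move: Ep; rewrite !take_drop_s; [|lia|lia]; rewrite addn0 => /esym /eqP Ep.
  case: (ltnP 1 p) => [p1|]; last by left; lia.
  right.
  have : nxt_occ l i <= i + p.-1 by apply: nxt_occ_leq => //; lia.
  by lia.
apply/and4P; split.
- by rewrite -size_eq0 size_b -lt0n.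
- by rewrite size_b size_s; lia.
- exact: prefix_take.
have Ed : drop (j - i - l) s = take l s.
  have sd : size (drop (j - i - l) s) <= l by rewrite size_drop size_s; lia.
  rewrite -[LHS](take_oversize sd).
  rewrite -[s in RHS]drop0 !take_drop_s; [|lia|lia]; rewrite addn0.
  have /eqP -> := nxt_occ_eqv le_n; congr (take _ (drop _ _)); lia.
by apply/suffixP; exists (take (j - i - l) s); rewrite -Ed cat_take_drop.
Qed.

Lemma is_borderE b : is_border b s ->
  [/\ 0 < size b, size b < j - i & eqv (size b) i (j - size b)].
Proof.
case/and4P=> b0 lt_b /prefixP[s2 pre] /suffixP[s' suf]; rewrite size_s in lt_b.
split=> //; first by rewrite lt0n size_eq0.
have E0 := @take_drop_s (size b) 0; have E1 := @take_drop_s (size b) (j - i - size b).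
rewrite drop0 addn0 in E0; apply/eqP; rewrite -E0; last by lia.
have -> : j - size b = i + (j - i - size b) by lia.
rewrite -E1; last by lia.
have size_s' : size s' = j - i - size b.
  by have := congr1 size suf; rewrite size_cat size_s; lia.
by rewrite {2}suf drop_size_cat // take_size pre take_size_cat.
Qed.

(** A border [b] that occurs only at the two ends is the longest: a longer border [b'] would put a
    copy of [b] at [j - size b'], strictly between them. A single letter corresponds to [l = 0]. *)
Lemma closed_longest_border : Defs.closed s ->
  exists l, [/\ nxt_occ l i <= n, nxt_occ l i + l = j & longest_border s = l].
Proof.
move=> /closedP; rewrite size_s; case=> [e1|[lt1 [b [bs occ]]]].
  exists 0; have -> : nxt_occ 0 i = i.+1.
    by apply: nxt_occ_unique => [||z]; rewrite ?eqv0 //; lia.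
  split; [lia|lia|].
  rewrite /longest_border big_seq big1 // => b; rewrite mem_borders => /is_borderE.
  by case; lia.
have [b0 lt_b e] := is_borderE bs.
have eN : nxt_occ (size b) i = j - size b.
  apply: nxt_occ_unique => //; first by lia.
  move=> z iz; apply/negP=> ez.
  have H := occ (z - i).+1.
  case: H => [||H|H]; try lia.
  rewrite /substr addSn /= addnC -take_drop take_drop_s; last by lia.
  rewrite subnKC; last by lia.
  move: ez => /eqP <-; rewrite -[i in drop i]addn0 -take_drop_s ?drop0; last by lia.
  case/and4P: bs => _ _ /prefixP[s2 ->] _.
  by rewrite take_size_cat.
exists (size b); split; [lia|lia|].
apply/eqP; rewrite eqn_leq; apply/andP; split; last first.
  by apply: (@leq_bigmax_seq _ _ xpredT); rewrite ?mem_borders.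
apply/bigmax_leqP_seq => b'; rewrite mem_borders => /is_borderE[b'0 lt_b' e'] _.
rewrite leqNgt; apply/negP=> lt_bb'.
have := @nxt_occ_leq (size b) i (j - size b').
by rewrite (eqv_leq (ltnW lt_bb') e'); lia.
Qed.

End ClosedFactors.

(* The border length [l] at [i] gives a closed factor that ends at
   [nxt_occ l i + l]; it extends by one letter exactly when [l.+1] has the same
   next occurrence. *)
Definition is_jump l i := (nxt_occ l i <= n) && (nxt_occ l.+1 i != nxt_occ l i).

(** As [nxt_occ] is monotone in [l], the sum [nxt_occ l i + l] is strictly increasing, so a closed
    extension by one letter must have border length [l.+1] and the same next occurrence. At the end
    of [w] the longer copy would not fit. *)
Lemma max_right_closedP i j : i < j <= n ->
  reflect (exists2 l, is_jump l i & nxt_occ l i + l = j)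
          (max_right_closed w i.+1 j).
Proof.
move=> ij; have le_i : i <= n by lia.
apply: (iffP andP) => [[cl nx]|[l /andP[le_n neq] e]].
  have [l [le_n e _]] := closed_longest_border ij cl.
  exists l => //; rewrite /is_jump le_n /=; apply/eqP=> en.
  case/orP: nx => [/eqP ejn|/negP[]].
    have := @nxt_occ_end l.+1 i; rewrite en; lia.
  have := @nxt_occ_end l.+1 i; rewrite en => H.
  by apply: (@closed_nxt_occ _ _ _ l.+1); lia.
split; first by apply: closed_nxt_occ e => //; lia.
rewrite orbC -implybE; apply/implyP=> cl.
case: eqP => // jn; have ij1 : i < j.+1 <= n by lia.
have [l' [le_n' e' _]] := closed_longest_border ij1 cl.
case: (ltngtP l' l.+1) => [lt|gt|E].
- by have := @nxt_occ_homo l' l i le_i; lia.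
- by have := @nxt_occ_homo l l' i le_i; lia.
- by rewrite E in e'; case/eqP: neq; lia.
Qed.

(** Both lists of end positions are strictly increasing, the second because [nxt_occ l i + l] grows
    with [l]; hence it suffices that they have the same elements. *)
Lemma MRC_entryE i : i < n ->
  MRC_entry w i.+1 =
  rev [seq (nxt_occ l i - i + l, l) | l <- iota 0 n & is_jump l i].
Proof.
move=> i_n; rewrite /MRC_entry subSS filter_rev map_rev; congr rev.
have -> : [seq j <- iota i.+1 (n - i) | max_right_closed w i.+1 j] =
          [seq nxt_occ l i + l | l <- iota 0 n & is_jump l i].
  apply: (@irr_sorted_eq _ ltn ltn_trans ltnn).
  - exact: (sorted_filter ltn_trans _ (iota_ltn_sorted _ _)).
  - rewrite sorted_map; apply: sub_sorted (sorted_filter ltn_trans _ (iota_ltn_sorted _ _)).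
    move=> l l' /= ll'; have := @nxt_occ_homo l l' i (ltnW i_n) (ltnW ll').
    by lia.
  - move=> j; rewrite mem_filter mem_iota; apply/andP/mapP => [[mrc jn]|].
      have ij : i < j <= n by lia.
      have [l jl e] := max_right_closedP ij mrc.
      exists l => //; rewrite mem_filter jl mem_iota /=.
      by have := nxt_occ_gt l i; lia.
    case=> l; rewrite mem_filter mem_iota => /andP[jl ln] e.
    have le_n : nxt_occ l i <= n by case/andP: jl.
    have := nxt_occ_end i_n le_n; have := nxt_occ_gt l i => gt_i e_n.
    split; last by lia.
    by apply/max_right_closedP; [lia|exists l].
rewrite -map_comp; apply/eq_in_map => l; rewrite mem_filter => /andP[/andP[le_n _] _] /=.
have gt_i := nxt_occ_gt l i; have := nxt_occ_end i_n le_n => e_n.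
have ij : i < nxt_occ l i + l <= n by lia.
have [l' [le_n' e' ->]] := closed_longest_border ij (closed_nxt_occ ij le_n erefl).
have -> : l' = l.
  case: (ltngtP l' l) => // ll'.
  - by have := nxt_occ_homo (ltnW i_n) (ltnW ll'); lia.
  - by have := nxt_occ_homo (ltnW i_n) (ltnW ll'); lia.
by rewrite substr0 size_take_min size_drop; congr pair; lia.
Qed.

(** * Class sizes and the potential *)

Definition class_size l y := count (eqv l y) (iota 0 n.+1).

Definition small l y := 2 * class_size l.+1 y <= class_size l y.

Definition potential l := \sum_(y <- iota 0 n.+1) trunc_log 2 (class_size l y).

Lemma class_size_leq l y : class_size l.+1 y <= class_size l y.
Proof. by apply: sub_count => z; apply: eqv_leq. Qed.

Lemma class_size_gt0 l y : y <= n -> 0 < class_size l y.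
Proof.
by move=> yn; rewrite -has_count; apply/hasP; exists y; rewrite ?eqv_refl ?mem_iota.
Qed.

Lemma eq_class_size l y z : eqv l y z -> class_size l y = class_size l z.
Proof.
move=> e; apply: eq_count => x; apply/idP/idP; last exact: eqv_trans.
by apply: eqv_trans; rewrite eqv_sym.
Qed.

(** No class grows, and a class of at most half the size of its parent loses at least one from its
    truncated logarithm. *)
Lemma potential_drop l :
  count (small l) (iota 0 n.+1) + potential l.+1 <= potential l.
Proof.
rewrite /potential -sum1_count big_mkcond -big_split big_seq [leqRHS]big_seq.
apply: leq_sum => y; rewrite mem_iota => yr; have yn : y <= n by lia.
have gt0 := class_size_gt0 l.+1 yn.
case: ifP => [sm|_]; last exact: leq_trunc_log (class_size_leq l y).
by move: sm; rewrite /small mul2n => /(leq_trunc_log 2); rewrite trunc_log2_double.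
Qed.

Lemma potential_leq l : potential l <= n.+1 * trunc_log 2 n.+1.
Proof.
apply: (@leq_trans (\sum_(y <- iota 0 n.+1) trunc_log 2 n.+1)); last first.
  by rewrite big_const_seq count_predT size_iota iter_addn_0 mulnC.
apply: leq_sum => y _; apply: leq_trunc_log.
by rewrite /class_size (leq_trans (count_size _ _)) ?size_iota.
Qed.

(* At most one child of a class of length [l.-1] is not small, so the positions
   whose successors are not small stay together. *)
Lemma small_split l x y : 0 < l -> x < n -> y < n -> eqv l x y ->
  small l.-1 x.+1 = false -> small l.-1 y.+1 = false -> eqv l.+1 x y.
Proof.
case: l => // l _ xn yn e /= sx sy; apply: eqvS => //.
apply/negPn/negP=> neq; have e1 := eqv_behead e.
move: sx sy; rewrite /small -(eq_class_size e1) => /negbT sx /negbT sy.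
have : class_size l.+1 x.+1 + class_size l.+1 y.+1 <= class_size l x.+1.
  rewrite /class_size -count_predUI addnC (eq_count (a2 := pred0)) ?count_pred0.
    by apply: sub_count => z /orP[/(eqv_leq (leqnSn l))|/(eqv_leq (leqnSn l)) /(eqv_trans e1)].
  move=> z /=; apply/negbTE/negP => /andP[ex ey]; case/negP: neq.
  by apply: eqv_trans ex _; rewrite eqv_sym.
by lia.
Qed.

End Factors.

(** * A program logic with running times *)

Definition upd (X : Type) (f : nat -> X) i v := fun j => if j == i then v else f j.

(* Variables and arrays are named by literals; [Nat.eqb] lets updates of
   different names be told apart by computation. *)
Definition upn (X : Type) (f : nat -> X) i v :=
  fun j => if Nat.eqb j i then v else f j.

(** Total functions in place of bounded sequences make all updates unconditional; bounds and word
    sizes are checked separately by [safe]. [OUT] is indexed from 0, whereas [Push] counts from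
    1. *)
Record memory := Memory {
  V : nat -> nat;
  A : nat -> nat -> nat;
  OUT : nat -> seq (nat * nat) }.

Definition setv m x v := Memory (upn (V m) x v) (A m) (OUT m).
Definition seta m a i v := Memory (V m) (upn (A m) a (upd (A m a) i v)) (OUT m).
Definition pushm m i q := Memory (V m) (A m) (upd (OUT m) i.-1 (q :: OUT m i.-1)).

Fixpoint modv c : seq nat :=
  match c with
  | Assign x _ => [:: x]
  | Seq c1 c2 | If _ c1 c2 => modv c1 ++ modv c2
  | While _ c1 => modv c1
  | _ => [::]
  end.

Fixpoint moda c : seq nat :=
  match c with
  | Store a _ _ => [:: a]
  | Seq c1 c2 | If _ c1 c2 => moda c1 ++ moda c2
  | While _ c1 => moda c1
  | _ => [::]
  end.

Fixpoint pushes c : bool :=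
  match c with
  | Push _ _ _ => true
  | Seq c1 c2 | If _ c1 c2 => pushes c1 || pushes c2
  | While _ c1 => pushes c1
  | _ => false
  end.

Definition number_of_arrays := 16.

(** Room for [n.+1] positions and [3 * n.+1] class names. During a round at most [n.+1] old and
    [n.+1] current names are in use, so a free one always remains. *)
Definition array_size n := 4 * n.+1.

Section Logic.
Variable k : nat.
Variables (d : Order.disp_t) (T : orderType d) (w : seq (Equality.sort T)).
Notation n := (@size (Equality.sort T) w).

Definition wlimit := 2 ^ (k * (trunc_log 2 n).+1).

Definition letter_le i j :=
  if (letter w i, letter w j) is (Some a, Some b) then (a <= b)%O else false.

Fixpoint value m e :=
  match e with
  | Const v => v
  | Var x => V m x
  | Len => n
  | Get a e1 => A m a (value m e1)
  | Bin o e1 e2 => binop_eval o (value m e1) (value m e2)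
  end.

Fixpoint safe m e : Prop :=
  match e with
  | Const v => v < wlimit
  | Var _ => True
  | Len => n < wlimit
  | Get a e1 => [/\ safe m e1, a < number_of_arrays & value m e1 < array_size n]
  | Bin o e1 e2 => [/\ safe m e1, safe m e2 & value m e < wlimit]
  end.

Fixpoint holds m c :=
  match c with
  | Le e1 e2 => value m e1 <= value m e2
  | LetterLe e1 e2 => letter_le (value m e1) (value m e2)
  | Not c1 => ~~ holds m c1
  | And c1 c2 => holds m c1 && holds m c2
  end.

(** [test] evaluates [And] lazily, so the second part has to be safe only when the first holds; the
    range checks in the program rely on this. *)
Fixpoint csafe m c : Prop :=
  match c with
  | Le e1 e2 => safe m e1 /\ safe m e2
  | LetterLe e1 e2 =>
      [/\ safe m e1, safe m e2, 0 < value m e1 <= n & 0 < value m e2 <= n]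
  | Not c1 => csafe m c1
  | And c1 c2 => csafe m c1 /\ (holds m c1 -> csafe m c2)
  end.

(** [Alloc] has no rule: all arrays are allocated beforehand, so that the space keeps one value [sp]
    from then on. *)
Inductive aexec : com -> memory -> memory -> nat -> Prop :=
| ASkip m : aexec Skip m m 1
| AAssign m x e : safe m e -> aexec (Assign x e) m (setv m x (value m e)) 1
| AStore m a e1 e2 :
    a < number_of_arrays -> safe m e1 -> safe m e2 ->
    value m e1 < array_size n ->
    aexec (Store a e1 e2) m (seta m a (value m e1) (value m e2)) 1
| APush m e1 e2 e3 :
    safe m e1 -> safe m e2 -> safe m e3 -> 0 < value m e1 <= n ->
    aexec (Push e1 e2 e3) m (pushm m (value m e1) (value m e2, value m e3)) 1
| ASeq c1 c2 m m1 m2 t1 t2 :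
    aexec c1 m m1 t1 -> aexec c2 m1 m2 t2 -> aexec (Seq c1 c2) m m2 (t1 + t2)
| AIf c c1 c2 m m1 t1 :
    csafe m c -> aexec (if holds m c then c1 else c2) m m1 t1 ->
    aexec (If c c1 c2) m m1 t1.+1
| AWhileFalse c c1 m :
    csafe m c -> holds m c = false -> aexec (While c c1) m m 1
| AWhileTrue c c1 m m1 m2 t1 t2 :
    csafe m c -> holds m c -> aexec c1 m m1 t1 -> aexec (While c c1) m1 m2 t2 ->
    aexec (While c c1) m m2 (t1 + t2).+1.

Variable sp : nat.

Definition represents (s : state) m :=
  [/\ forall x, var s x = V m x,
      forall a, a < number_of_arrays -> size (arr s a) = array_size n,
      forall a i, a < number_of_arrays -> i < array_size n ->
        nth 0 (arr s a) i = A m a i,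
      size (out s) = n /\ forall i, i < n -> nth [::] (out s) i = OUT m i &
      space s = sp].

Lemma onth_lt (X : Type) (x0 : X) s i : i < size s -> onth s i = Some (nth x0 s i).
Proof. by elim: s i => [|x s IH] [|i] //= /IH. Qed.

Lemma eval_val s m e : represents s m -> safe m e -> eval k w s e = Some (value m e).
Proof.
move=> [Rv Rs Ra _ _]; elim: e => [v|x||a e IH|o e1 IH1 e2 IH2] /=.
- by rewrite /word => ->.
- by rewrite Rv.
- by rewrite /word => ->.
- by case=> /IH -> lt_a lt_e; rewrite (onth_lt 0) ?Rs ?Ra.
- by case=> /IH1 -> /IH2 -> lt; rewrite /word lt.
Qed.

Lemma letter_def i : 0 < i <= n -> letter w i.
Proof. by case: i => // i; rewrite /=; elim: (w) i => [|a u IH] [|i] //=; rewrite ltnS; exact: IH. Qed.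

Lemma test_cval s m c : represents s m -> csafe m c -> test k w s c = Some (holds m c).
Proof.
move=> R; elim: c => [e1 e2|e1 e2|c IH|c1 IH1 c2 IH2] /=.
- by case=> s1 s2; rewrite (eval_val R s1) (eval_val R s2).
- case=> s1 s2 /letter_def l1 /letter_def l2.
  rewrite (eval_val R s1) (eval_val R s2) /= /letter_le.
  by move: l1 l2; case: letter => //; case: letter.
- by move=> /IH ->.
- by case=> /IH1 ->; case: (holds m c1) => //= /(_ isT) /IH2 ->.
Qed.

Lemma upnE (X : Type) (f : nat -> X) i v j : upn f i v j = if j == i then v else f j.
Proof.
rewrite /upn; case: eqP => [->|/PeanoNat.Nat.eqb_neq -> //].
by rewrite PeanoNat.Nat.eqb_refl.
Qed.

Lemma represents_setv s m x v :
  represents s m -> represents (set_var s x v) (setv m x v).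
Proof.
by move=> [Rv Rs Ra Ro Rsp]; split=> //= y; rewrite upnE; case: eqP.
Qed.

Lemma represents_store s m a i v : a < number_of_arrays -> i < array_size n ->
  represents s m -> represents (store s a i v) (seta m a i v).
Proof.
move=> lt_a lt_i [Rv Rs Ra Ro Rsp]; split=> //= b.
  move=> lt_b; case: eqP => [eab|_]; last exact: Rs.
  by rewrite size_set_nth Rs //; apply/maxn_idPr.
move=> j lt_b lt_j; rewrite upnE; case: eqP => [_|_]; last exact: Ra.
by rewrite nth_set_nth /= /upd Ra.
Qed.

Lemma represents_push s m i q : 0 < i <= n ->
  represents s m -> represents (push s i q) (pushm m i q).
Proof.
case: i => // i /= lt_i [Rv Rs Ra [Rso Ro] Rsp]; split=> //=.
split=> [|j lt_j]; first by rewrite size_set_nth Rso; apply/maxn_idPr.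
by rewrite nth_set_nth /= /upd !Ro.
Qed.

Lemma aexec_exec c m m' t s : aexec c m m' t -> represents s m ->
  exists2 s', exec k w c s s' t & represents s' m'.
Proof.
move=> H; elim: H s => {c m m' t}.
- by move=> m s R; exists s; first exact: ExecSkip.
- move=> m x e se s R; exists (set_var s x (value m e)); last exact: represents_setv.
  by apply/ExecAssign/eval_val.
- move=> m a e1 e2 lt_a s1 s2 lt_1 s R.
  exists (store s a (value m e1) (value m e2)); last exact: represents_store.
  apply: ExecStore; [exact: eval_val|exact: eval_val|].
  by case: R => _ ->.
- move=> m e1 e2 e3 s1 s2 s3 lt_1 s R.
  exists (push s (value m e1) (value m e2, value m e3)); last exact: represents_push.
  apply: ExecPush; [exact: eval_val|exact: eval_val|exact: eval_val|].
  by case: R => _ _ _ [-> _].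
- move=> c1 c2 m m1 m2 t1 t2 _ IH1 _ IH2 s /IH1[s1 E1 /IH2[s2 E2 R2]].
  by exists s2 => //; apply: ExecSeq E1 E2.
- move=> c c1 c2 m m1 t1 sc _ IH s R; have [s1 E1 R1] := IH _ R.
  by exists s1 => //; apply: ExecIf E1; apply: test_cval.
- move=> c c1 m sc ec s R; exists s => //; apply: ExecWhileFalse.
  by rewrite (test_cval R sc) ec.
- move=> c c1 m m1 m2 t1 t2 sc ec _ IH1 _ IH2 s R.
  have [s1 E1 /IH2[s2 E2 R2]] := IH1 _ R.
  exists s2 => //; apply: ExecWhileTrue E1 E2.
  by rewrite (test_cval R sc) ec.
Qed.

(** The sets are computed from the program text, so membership is settled by evaluation, and a loop
    invariant has to mention only what the body changes. *)
Definition framed c m m' :=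
  [/\ forall x, x \notin modv c -> V m' x = V m x,
      forall a, a \notin moda c -> A m' a = A m a &
      ~~ pushes c -> OUT m' = OUT m].

Lemma aexec_framed c m m' t : aexec c m m' t -> framed c m m'.
Proof.
elim=> {c m m' t}.
- by [].
- by move=> m x e _; split=> //= y; rewrite inE upnE; case: eqP.
- by move=> m a e1 e2 _ _ _ _; split=> //= b; rewrite inE upnE; case: eqP.
- by [].
- move=> c1 c2 m m1 m2 t1 t2 _ [V1 A1 O1] _ [V2 A2 O2]; split=> /=.
  + by move=> x; rewrite mem_cat negb_or => /andP[x1 x2]; rewrite V2 ?V1.
  + by move=> x; rewrite mem_cat negb_or => /andP[x1 x2]; rewrite A2 ?A1.
  + by rewrite negb_or => /andP[p1 p2]; rewrite O2 ?O1.
- move=> c c1 c2 m m1 t1 _ _; case: ifP => _ [V1 A1 O1]; split=> /=.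
  + by move=> x; rewrite mem_cat negb_or => /andP[x1 x2]; rewrite V1.
  + by move=> x; rewrite mem_cat negb_or => /andP[x1 x2]; rewrite A1.
  + by rewrite negb_or => /andP[p1 p2]; rewrite O1.
  + by move=> x; rewrite mem_cat negb_or => /andP[x1 x2]; rewrite V1.
  + by move=> x; rewrite mem_cat negb_or => /andP[x1 x2]; rewrite A1.
  + by rewrite negb_or => /andP[p1 p2]; rewrite O1.
- by [].
- move=> c c1 m m1 m2 t1 t2 _ _ _ [V1 A1 O1] _ [V2 A2 O2]; split=> /=.
  + by move=> x xn; rewrite V2 ?V1.
  + by move=> x xn; rewrite A2 ?A1.
  + by move=> pn; rewrite O2 ?O1.
Qed.

Implicit Types (Q : memory -> nat -> Prop).

(** Total correctness, with the running time passed to the postcondition. One terminating run is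
    enough, since [exec_det] makes it the only one. *)
Definition wp c Q m := exists m' t, aexec c m m' t /\ Q m' t.

Lemma wp_mono c Q Q' m :
  (forall m' t, framed c m m' -> Q m' t -> Q' m' t) -> wp c Q m -> wp c Q' m.
Proof.
move=> H [m' [t [E HQ]]]; exists m', t; split=> //.
by apply: H HQ; apply: aexec_framed E.
Qed.

Lemma wp_seq c1 c2 Q m :
  wp c1 (fun m1 t1 => wp c2 (fun m2 t2 => Q m2 (t1 + t2)) m1) m ->
  wp (Seq c1 c2) Q m.
Proof.
move=> [m1 [t1 [E1 [m2 [t2 [E2 HQ]]]]]]; exists m2, (t1 + t2).
by split=> //; apply: ASeq E1 E2.
Qed.

Fixpoint vc c Q m : Prop :=
  match c with
  | Skip => Q m 1
  | Assign x e => safe m e /\ Q (setv m x (value m e)) 1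
  | Store a e1 e2 =>
      [/\ safe m e1, safe m e2, a < number_of_arrays, value m e1 < array_size n &
          Q (seta m a (value m e1) (value m e2)) 1]
  | Push e1 e2 e3 =>
      [/\ safe m e1, safe m e2, safe m e3, 0 < value m e1 <= n &
          Q (pushm m (value m e1) (value m e2, value m e3)) 1]
  | Seq c1 c2 => vc c1 (fun m1 t1 => vc c2 (fun m2 t2 => Q m2 (t1 + t2)) m1) m
  | If c c1 c2 =>
      [/\ csafe m c, holds m c -> vc c1 (fun m1 t1 => Q m1 t1.+1) m &
          ~~ holds m c -> vc c2 (fun m1 t1 => Q m1 t1.+1) m]
  | _ => wp c Q m
  end.

Lemma vc_wp c Q m : vc c Q m -> wp c Q m.
Proof.
elim: c Q m => //=.
- by move=> Q m HQ; exists m, 1; split=> //; apply: ASkip.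
- move=> x e Q m [se HQ]; exists (setv m x (value m e)), 1.
  by split=> //; apply: AAssign.
- move=> a e1 e2 Q m [s1 s2 lt_a lt_1 HQ]; exists (seta m a (value m e1) (value m e2)), 1.
  by split=> //; apply: AStore.
- move=> e1 e2 e3 Q m [s1 s2 s3 lt_1 HQ].
  exists (pushm m (value m e1) (value m e2, value m e3)), 1.
  by split=> //; apply: APush.
- move=> c1 IH1 c2 IH2 Q m /IH1 H; apply: wp_seq.
  by apply: wp_mono H => m1 t1 _; apply: IH2.
- move=> c c1 IH1 c2 IH2 Q m [sc H1 H2].
  have [m1 [t1 [E HQ]]] : wp (if holds m c then c1 else c2) (fun m1 t1 => Q m1 t1.+1) m.
    case: ifP => [e|/negbT e]; [apply/IH1/H1|apply/IH2/H2] => //.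
  by exists m1, t1.+1; split=> //; apply: AIf.
Qed.

Lemma framed_sub c c' m1 m2 : {subset modv c <= modv c'} ->
  {subset moda c <= moda c'} -> (pushes c -> pushes c') ->
  framed c m1 m2 -> framed c' m1 m2.
Proof.
move=> sv sa sp' [V1 A1 O1]; split=> [x xn|a an|pn].
- by apply: V1; apply: contra xn; apply: sv.
- by apply: A1; apply: contra an; apply: sa.
by apply: O1; apply: contra pn.
Qed.

Lemma framed_setv c m1 m2 x v : x \in modv c -> framed c m1 m2 ->
  framed c m1 (setv m2 x v).
Proof.
move=> xc [V1 A1 O1]; split=> //= y yn; rewrite upnE V1 //.
by case: eqP => // ey; rewrite ey xc in yn.
Qed.

Lemma wp_skip Q m : Q m 1 -> wp Skip Q m.
Proof. exact: (@vc_wp Skip). Qed.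

Lemma wp_assign x e Q m :
  safe m e -> (forall v, v = value m e -> Q (setv m x v) 1) -> wp (Assign x e) Q m.
Proof. by move=> se H; apply: vc_wp; split=> //; apply: H. Qed.

Lemma wp_store a e1 e2 Q m :
  safe m e1 -> safe m e2 -> a < number_of_arrays -> value m e1 < array_size n ->
  (forall i v, i = value m e1 -> v = value m e2 -> Q (seta m a i v) 1) ->
  wp (Store a e1 e2) Q m.
Proof. by move=> s1 s2 la l1 H; apply: vc_wp; split=> //; apply: H. Qed.

Lemma wp_push e1 e2 e3 Q m :
  safe m e1 -> safe m e2 -> safe m e3 -> 0 < value m e1 <= n ->
  (forall i p, i = value m e1 -> p = (value m e2, value m e3) -> Q (pushm m i p) 1) ->
  wp (Push e1 e2 e3) Q m.
Proof. by move=> *; apply: vc_wp; split; auto. Qed.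

Lemma wp_if c c1 c2 Q m :
  csafe m c -> (holds m c -> wp c1 (fun m1 t1 => Q m1 t1.+1) m) ->
  (~~ holds m c -> wp c2 (fun m1 t1 => Q m1 t1.+1) m) -> wp (If c c1 c2) Q m.
Proof.
move=> sc H1 H2.
have [m1 [t1 [E HQ]]] : wp (if holds m c then c1 else c2) (fun m1 t1 => Q m1 t1.+1) m.
  by case: ifP => [e|/negbT e]; [apply: H1|apply: H2].
by exists m1, t1.+1; split=> //; apply: AIf.
Qed.

Lemma framed_refl c m : framed c m m.
Proof. by split. Qed.

Lemma framed_trans c m1 m2 m3 : framed c m1 m2 -> framed c m2 m3 -> framed c m1 m3.
Proof.
move=> [V1 A1 O1] [V2 A2 O2].
by split=> [x xc|a ac|pc]; rewrite ?V2 ?A2 ?O2 // ?V1 ?A1 ?O1.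
Qed.

(* [r] bounds the number of remaining iterations and [t] is the time already
   spent in the loop. *)
Lemma wp_while c b (I : nat -> memory -> nat -> Prop) r0 Q m0 :
  I r0 m0 0 ->
  (forall r m t, framed b m0 m -> I r m t -> csafe m c) ->
  (forall r m t, framed b m0 m -> I r m t -> holds m c ->
     wp b (fun m' t' => exists2 r', r' < r & I r' m' (t + t').+1) m) ->
  (forall r m t, framed b m0 m -> I r m t -> ~~ holds m c -> Q m t.+1) ->
  wp (While c b) Q m0.
Proof.
move=> I0 Isafe Istep Iend.
suff H : forall N r m t, r < N -> framed b m0 m -> I r m t ->
    wp (While c b) (fun m' t' => Q m' (t + t')) m.
  exact: H (ltnSn _) (framed_refl _ _) I0.
elim=> // N IH r m1 t rN F1 I1; have sc := Isafe _ _ _ F1 I1.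
case ec: (holds m1 c); last first.
  exists m1, 1; split; first exact: AWhileFalse.
  by rewrite addn1; apply: Iend F1 (I1) _; rewrite ec.
have [m2 [t2 [E2 [r' r'r I2]]]] := Istep _ _ _ F1 I1 ec.
have F2 := framed_trans F1 (aexec_framed E2).
have [m3 [t3 [E3 Q3]]] := IH r' m2 _ (leq_trans r'r rN) F2 I2.
exists m3, (t2 + t3).+1; split; first exact: AWhileTrue E2 E3.
by move: Q3; rewrite addSn addnS addnA.
Qed.

Definition Lt e1 e2 := Not (Le e2 e1).

Definition For x e b :=
  Seq (Assign x (Const 0))
      (While (Lt (Var x) e) (Seq b (Assign x (Bin Add (Var x) (Const 1))))).

(** The bound [e] is evaluated again at every test, hence the requirement that it keep the value
    [N]. The [2] in an iteration pays for the test and the increment, the final [2] for the initial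
    assignment and the failing test. *)
Lemma wp_for x e b (J : nat -> nat -> memory -> Prop) N Q m0 :
  x \notin modv b -> N < wlimit -> 1 < wlimit ->
  J 0 0 (setv m0 x 0) ->
  (forall m, framed (For x e b) m0 m -> safe m e /\ value m e = N) ->
  (forall j t m, framed (For x e b) m0 m -> j < N -> V m x = j -> J j t m ->
     wp b (fun m' t' => J j.+1 (t + t' + 2) (setv m' x j.+1)) m) ->
  (forall t m, framed (For x e b) m0 m -> V m x = N -> J N t m -> Q m (t + 2)) ->
  wp (For x e b) Q m0.
Proof.
move=> xb ltN lt1 J0 Je Jstep Jend; apply: vc_wp; split=> /=; first by lia.
set b' := Seq b _; set I := fun r m t => exists2 j, j <= N & [/\ r = N - j, V m x = j & J j t m].
have F0 m : framed b' (setv m0 x 0) m -> framed (For x e b) m0 m.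
  move=> [V1 A1 O1]; split=> //= y; rewrite inE negb_or => /andP[yx yb].
  by rewrite V1 //= upnE (negbTE yx).
apply: (@wp_while _ _ I N).
- by exists 0 => //; split=> //=; rewrite ?subn0 // upnE eqxx.
- by move=> r m1 t /F0 /Je[se _].
- move=> r m1 t /F0 F [j _ [er ej Jj]] /=; have [se ee] := Je _ F.
  rewrite ee ej -ltnNge => ltj; apply: wp_seq.
  apply: wp_mono (Jstep j t m1 F ltj ej Jj) => m2 t2 [Fb _ _] J2.
  have ej2 : V m2 x = j by rewrite Fb.
  apply: vc_wp => /=; rewrite ej2 addn1; split; first by split; lia.
  exists (N - j.+1); first by rewrite er; lia.
  exists j.+1 => //; rewrite /= upnE eqxx; split=> //.
  by rewrite (_ : (_ + _).+1 = t + t2 + 2) //; lia.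
- move=> r m1 t /F0 F [j lej [_ ej Jj]] /=; have [se ee] := Je _ F.
  rewrite ee ej -ltnNge ltnNge negbK => ltj.
  have E : j = N by apply/eqP; rewrite eqn_leq lej.
  by rewrite (_ : 1 + t.+1 = t + 2); [apply: Jend F _ _; rewrite -E | lia].
Qed.

Lemma wp_for_const C x e b (J : nat -> memory -> Prop) N Q m0 :
  x \notin modv b -> N < wlimit -> 1 < wlimit ->
  J 0 (setv m0 x 0) ->
  (forall m, framed (For x e b) m0 m -> safe m e /\ value m e = N) ->
  (forall j m, framed (For x e b) m0 m -> j < N -> V m x = j -> J j m ->
     wp b (fun m' t' => t' <= C /\ J j.+1 (setv m' x j.+1)) m) ->
  (forall t m, framed (For x e b) m0 m -> J N m -> t <= (C + 2) * N + 2 -> Q m t) ->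
  wp (For x e b) Q m0.
Proof.
move=> xb ltN lt1 J0 Je Jstep Jend.
apply: (@wp_for _ _ _ (fun j t m => J j m /\ t <= (C + 2) * j) N) => //.
- move=> j t m1 F ltj ej [Jj tj]; apply: wp_mono (Jstep _ _ F ltj ej Jj) => m2 t2 _ [t2C J2].
  by split=> //; rewrite mulnS; lia.
- by move=> t m1 F em [Jm tm]; apply: Jend F Jm _; lia.
Qed.

End Logic.

(** * Circular lists of classes *)

Definition linked (nx pv : nat -> nat) u v := (nx u == v) && (pv v == u).

Lemma upd_same (X : Type) (f : nat -> X) i v : upd f i v i = v.
Proof. by rewrite /upd eqxx. Qed.

Lemma upd_diff (X : Type) (f : nat -> X) i v j : j != i -> upd f i v j = f j.
Proof. by rewrite /upd => /negbTE ->. Qed.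

(** A path uses neither the next link of its last node nor the previous link of its first node,
    which are the links that deleting or inserting a neighbour overwrites. *)
Lemma path_linked_ends nx pv nx' pv' a c :
  uniq (a :: c) -> path (linked nx pv) a c ->
  {in a :: c, forall u, u != last a c -> nx' u = nx u} ->
  {in c, pv' =1 pv} -> path (linked nx' pv') a c.
Proof.
elim: c a => //= b c IH a /andP[ab ub] /andP[Rab pb] Hn Hp.
have ab' : a != last b c.
  by apply: contra ab => /eqP ->; apply: mem_last.
apply/andP; split; first by rewrite /linked Hn ?inE ?eqxx // Hp ?inE ?eqxx.
apply: IH => // [u uc ul|u uc]; first by apply: Hn; rewrite // inE uc orbT.
by apply: Hp; rewrite inE uc orbT.
Qed.

Lemma cycle_linked_eq nx pv nx' pv' c :
  {in c, nx' =1 nx} -> {in c, pv' =1 pv} ->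
  cycle (linked nx pv) c -> cycle (linked nx' pv') c.
Proof.
move=> Hn Hp; apply: (@sub_in_cycle _ [in c]); last by apply/allP.
by move=> u v uc vc; rewrite /linked Hn ?Hp.
Qed.

Lemma cycle_linked_del nx pv x c :
  uniq (x :: c) -> 0 < size c -> cycle (linked nx pv) (x :: c) ->
  cycle (linked (upd nx (pv x) (nx x)) (upd pv (nx x) (pv x))) c.
Proof.
case: c => // a c /andP[xc /[dup] uac /andP[ac _]] _ /=.
rewrite rcons_path => /and3P[/andP[/eqP nxx _] pc /andP[_ /eqP pvx]].
rewrite rcons_path; apply/andP; split; last by rewrite /linked nxx pvx !upd_same !eqxx.
apply: path_linked_ends pc _ _ => // [u uac' ul|u uc]; rewrite upd_diff ?pvx //.
by rewrite nxx; apply: contraNneq ac => <-.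
Qed.

(** With a sentinel as [a], inserting before [a] means appending at the tail of its list. *)
Lemma cycle_linked_ins nx pv x a c :
  uniq [:: x, a & c] -> cycle (linked nx pv) (a :: c) ->
  cycle (linked (upd (upd nx (pv a) x) x a) (upd (upd pv x (pv a)) a x)) [:: x, a & c].
Proof.
move=> /andP[xc uac] /=; rewrite !rcons_path => /andP[pc /andP[_ /eqP pva]].
have [ax lx] : a != x /\ last a c != x.
  by split; apply: contraNneq xc => <-; rewrite ?mem_head ?mem_last.
apply/and3P; split; first by rewrite /linked !upd_same !eqxx.
  apply: path_linked_ends pc _ _ => // [u uac' ul|u uc].
    rewrite upd_diff; last by apply: contraNneq xc => <-.
    by rewrite upd_diff // pva.
  have ux : u != x by apply: contraNneq xc => <-; rewrite inE uc orbT.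
  have ua : u != a by case/andP: uac => ac _; apply: contraNneq ac => <-.
  by rewrite !upd_diff.
rewrite /linked pva upd_diff // upd_same eqxx /= upd_diff; last by rewrite eq_sym.
by rewrite upd_same.
Qed.

Section ClassLists.
Variable n : nat.
Implicit Types (cls nx pv : nat -> nat) (x y D N : nat).

Definition is_id D := n < D < array_size n.

Definition members cls D := [seq y <- iota 0 n.+1 | cls y == D].

Lemma mem_members cls D y : (y \in members cls D) = (cls y == D) && (y <= n).
Proof. by rewrite mem_filter mem_iota ltnS. Qed.

Lemma members_uniq cls D : uniq (members cls D).
Proof. exact/filter_uniq/iota_uniq. Qed.

Lemma members_sorted cls D : sorted ltn (members cls D).
Proof. exact/(sorted_filter ltn_trans)/iota_ltn_sorted. Qed.

Lemma node_uniq cls D : is_id D -> uniq (D :: members cls D).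
Proof. by move=> idD; rewrite /= members_uniq mem_members; move: idD; rewrite /is_id; lia. Qed.

Lemma iota_split x : x <= n -> iota 0 n.+1 = iota 0 x ++ x :: iota x.+1 (n - x).
Proof.
move=> xn; rewrite -[x :: _]/(iota x (n - x).+1) -[x in iota x _]add0n -iotaD.
by congr iota; lia.
Qed.

Lemma members_split cls x : x <= n ->
  let L1 := [seq y <- iota 0 x | cls y == cls x] in
  let L2 := [seq y <- iota x.+1 (n - x) | cls y == cls x] in
  members cls (cls x) = L1 ++ x :: L2 /\
  forall N, N != cls x -> members (upd cls x N) (cls x) = L1 ++ L2.
Proof.
move=> xn L1 L2; rewrite /members (iota_split xn); split=> [|N Nx].
  by rewrite filter_cat /= eqxx.
rewrite filter_cat /= upd_same (negbTE Nx); congr (_ ++ _);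
  apply: eq_in_filter => y; rewrite mem_iota => yr; rewrite upd_diff //; lia.
Qed.

Lemma members_add cls x N : x <= n -> cls x != N ->
  (forall y, y <= n -> cls y = N -> y < x) ->
  members (upd cls x N) N = rcons (members cls N) x.
Proof.
move=> xn xN lt_x; rewrite /members (iota_split xn) !filter_cat /= upd_same eqxx (negbTE xN).
have E : forall cls', (forall y, x < y <= n -> cls' y != N) ->
    [seq y <- iota x.+1 (n - x) | cls' y == N] = [::].
  move=> cls' H; apply/eqP; rewrite -[_ == _]negbK -has_filter; apply/hasPn=> y.
  by rewrite mem_iota => yr; apply: H; lia.
rewrite (E cls) ?(E (upd cls x N)) ?cats0 ?cats1; first last.
- by move=> y yr; apply/eqP=> /lt_x; lia.
- move=> y yr; rewrite upd_diff; last by lia.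
  by apply/eqP=> /lt_x; lia.
congr rcons; apply: eq_in_filter => y; rewrite mem_iota => yr.
by rewrite upd_diff //; lia.
Qed.

Lemma members_other cls x N D : D != cls x -> D != N ->
  members (upd cls x N) D = members cls D.
Proof.
move=> Dx DN; apply: eq_filter => y; rewrite /upd; case: (eqVneq y x) => // ->.
by rewrite eq_sym (negbTE DN) eq_sym (negbTE Dx).
Qed.

(** [members] filters [iota], so this fixes the order of each list and not only its contents. A name
    without members is a cycle of length one. *)
Definition lists nx pv cls :=
  forall D, is_id D -> cycle (linked nx pv) (D :: members cls D).

Lemma lists_nodes nx pv cls D u : lists nx pv cls -> is_id D ->
  u \in D :: members cls D ->
  nx u \in D :: members cls D /\ pv u \in D :: members cls D.
Proof.
move=> /[apply] cyc uD.
have /andP[/eqP -> _] := next_cycle cyc uD.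
have /andP[_ /eqP ->] := prev_cycle cyc uD.
by rewrite mem_next mem_prev.
Qed.

Lemma node_lt cls D u : is_id D -> u \in D :: members cls D -> u < array_size n.
Proof.
by rewrite inE mem_members /is_id /array_size => idD /orP[/eqP ->|/andP[_]]; lia.
Qed.

(** * Moving a position to the end of another list *)

Section Move.
Variables (nx pv cls : nat -> nat) (x N : nat).
Hypothesis (Hl : lists nx pv cls) (idc : forall y, y <= n -> is_id (cls y)).
Hypothesis (xn : x <= n) (idN : is_id N) (Nx : N != cls x).
Hypothesis (lt_x : forall y, y <= n -> cls y = N -> y < x).

Definition nx_del := upd nx (pv x) (nx x).
Definition pv_del := upd pv (nx x) (pv x).
Definition nx_move := upd (upd nx_del (pv_del N) x) x N.
Definition pv_move := upd (upd pv_del x (pv_del N)) N x.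

Let x_in : x \in cls x :: members cls (cls x).
Proof. by rewrite inE mem_members eqxx xn orbT. Qed.

Lemma nodes_disjoint D E u : is_id D -> is_id E -> D != E ->
  u \in D :: members cls D -> u \in E :: members cls E -> False.
Proof.
move=> idD idE DE; rewrite !inE !mem_members.
move=> /orP[/eqP uD|/andP[/eqP uD un]] /orP[/eqP uE|/andP[/eqP uE uN]].
- by rewrite -uD -uE eqxx in DE.
- by move: idD; rewrite -uD /is_id; lia.
- by move: idE; rewrite -uE /is_id; lia.
- by rewrite -uD -uE eqxx in DE.
Qed.

(** Unlinking [x] writes only into the list of its own class, which is disjoint from that of [N]. *)
Let pv_del_N : pv_del N = pv N.
Proof.
rewrite /pv_del upd_diff //; apply/eqP=> eN.
have [nxx _] := lists_nodes Hl (idc xn) x_in.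
apply: (nodes_disjoint idN (idc xn) Nx _ nxx).
by rewrite -eN mem_head.
Qed.

Lemma move_tail : pv_del N \in N :: members cls N.
Proof.
by rewrite pv_del_N; case: (@lists_nodes nx pv cls N N Hl idN (mem_head _ _)).
Qed.

Lemma move_nodes : nx x \in cls x :: members cls (cls x) /\ pv x \in cls x :: members cls (cls x).
Proof. exact: lists_nodes Hl (idc xn) x_in. Qed.

Lemma lists_move : lists nx_move pv_move (upd cls x N).
Proof.
have [nxx pvx] := move_nodes; have tl := move_tail.
have xN : x \notin N :: members cls N.
  by apply/negP => /(nodes_disjoint (idc xn) idN _ x_in) []; rewrite eq_sym.
have x_del D : D != cls x -> x \notin D :: members cls D -> is_id D ->
    cycle (linked nx_del pv_del) (D :: members cls D).
  move=> Dx xD idD; apply: cycle_linked_eq (Hl idD) => u uD; apply: upd_diff;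
    by apply/eqP=> eu; apply: (nodes_disjoint idD (idc xn) Dx uD); rewrite eu.
move=> D idD; case: (eqVneq D N) => [->|DN].
  rewrite members_add //; last by rewrite eq_sym.
  rewrite -cats1 -cat_cons cycle_catC cat1s.
  apply: cycle_linked_ins; last exact: x_del.
  by rewrite cons_uniq xN node_uniq.
(* The insertion writes only at [x], at [N] and at the tail of [N], so any other list is settled
   once it is a cycle after the deletion and avoids [x]. *)
suff [sub xD cyc] : [/\ {subset members (upd cls x N) D <= members cls D},
    x \notin D :: members (upd cls x N) D &
    cycle (linked nx_del pv_del) (D :: members (upd cls x N) D)].
  have H u : u \in D :: members (upd cls x N) D -> u != N /\ u != pv_del N.
    move=> uD; have uD' : u \in D :: members cls D.
      by move: uD; rewrite !inE => /orP[->//|/sub ->]; rewrite orbT.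
    split; apply/eqP=> eu; apply: (nodes_disjoint idD idN DN uD'); rewrite eu //.
    exact: mem_head.
  have ux u : u \in D :: members (upd cls x N) D -> u != x.
    by move=> uD; apply: contra xD => /eqP eu; rewrite -[X in X \in _]eu.
  apply: cycle_linked_eq cyc => u uD; have [uN uT] := H u uD; have := ux u uD => uxd.
    by rewrite /nx_move !upd_diff.
  by rewrite /pv_move !upd_diff.
case: (eqVneq D (cls x)) => [->|Dx].
  have [eL eL'] := members_split cls xn; have := node_uniq cls (idc xn).
  move: x_in (Hl (idc xn)); rewrite eL eL' //.
  set L1 := filter _ _; set L2 := filter _ _ => _.
  rewrite -!cat_cons cycle_catC => cyc uq.
  have uq' : uniq (x :: L2 ++ cls x :: L1) by rewrite -cat_cons uniq_catC.
  split.
  - by move=> y; rewrite !mem_cat inE => /orP[->|->]; rewrite ?orbT.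
  - move: uq'; rewrite cons_uniq => /andP[]; rewrite !(mem_cat, inE) !negb_or.
    by move=> /and3P[-> -> ->].
  - by rewrite cycle_catC; apply: cycle_linked_del => //; rewrite size_cat /= addnS.
have xD : x \notin D :: members cls D.
  by apply/negP=> xD; apply: (nodes_disjoint idD (idc xn) Dx xD).
by rewrite members_other //; split=> //; apply: x_del.
Qed.

End Move.

(** Rotated to start at [x], the cycle continues with the later members and then the sentinel; a
    link above [n] thus says that [x] is the last member. *)
Lemma lists_nxt nx pv cls x : lists nx pv cls -> x <= n -> is_id (cls x) ->
  if nx x <= n then [/\ x < nx x, cls (nx x) = cls x &
                       forall z, x < z < nx x -> cls z != cls x]
  else forall z, x < z <= n -> cls z != cls x.
Proof.
move=> Hl xn idx; have := Hl _ idx; have [-> _] := members_split cls xn.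
rewrite -cat_cons cycle_catC /=.
set L2 := filter _ _ => cyc.
have : nx x = head (cls x) L2 by move: cyc; case: L2 => [|y L2] /= /andP[/andP[/eqP]].
case E: L2 => [|y L2'] /= ->.
  rewrite leqNgt; case/andP: (idx) => -> _ /= z xz; apply/negP=> ez.
  have : z \in L2 by rewrite mem_filter ez mem_iota; lia.
  by rewrite E.
have := mem_head y L2'; rewrite -E mem_filter mem_iota => /andP[/eqP ey yr].
have -> : y <= n by lia.
split=> //; first by lia.
move=> z zr; apply/negP=> ez.
have : z \in L2 by rewrite mem_filter ez mem_iota; lia.
have srt : sorted ltn L2 by apply/(sorted_filter ltn_trans)/iota_ltn_sorted.
move: srt; rewrite E /= (path_sortedE ltn_trans) => /andP[/allP H _].
by rewrite inE => /orP[/eqP zy|/H /=]; lia.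
Qed.

End ClassLists.

(** * The program *)

(* [cl] maps a position to the name of its class; names are the numbers from
   [n.+1] to [4 * n + 3], and serve as sentinels of circular lists with links
   [nx] and [pv], sorted by position.  [sz] is the size of a class, [os] its size
   before the round, and the unused names are on the stack [fs].  The queue [q]
   holds the positions to be moved, grouped by the stamps [gs]; [sg] and [sp]
   hold the last stamp met in a class and the new class made for it.  [oc] and
   [nc] are the old and new classes of the queued positions, [pq] their
   predecessors when they were moved, [ox] the next links of the previous round,
   and [dn] the last round in which a class was visited. *)
Notation v_l := 0 (only parsing).
Notation v_m := 1 (only parsing).
Notation v_k := 2 (only parsing).
Notation v_x := 3 (only parsing).
Notation v_D := 4 (only parsing).
Notation v_N := 5 (only parsing).
Notation v_p := 6 (only parsing).
Notation v_s := 7 (only parsing).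
Notation v_top := 8 (only parsing).
Notation v_st := 9 (only parsing).
Notation v_y := 10 (only parsing).
Notation v_m' := 11 (only parsing).
Notation v_h := 12 (only parsing).
Notation v_a := 13 (only parsing).
Notation v_b := 14 (only parsing).
Notation v_mid := 15 (only parsing).
Notation v_hi := 16 (only parsing).

Notation a_nx := 0 (only parsing).
Notation a_pv := 1 (only parsing).
Notation a_cl := 2 (only parsing).
Notation a_sz := 3 (only parsing).
Notation a_os := 4 (only parsing).
Notation a_ox := 5 (only parsing).
Notation a_sg := 6 (only parsing).
Notation a_sp := 7 (only parsing).
Notation a_dn := 8 (only parsing).
Notation a_fs := 9 (only parsing).
Notation a_q := 10 (only parsing).
Notation a_gs := 11 (only parsing).
Notation a_oc := 12 (only parsing).
Notation a_nc := 13 (only parsing).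
Notation a_pq := 14 (only parsing).
Notation a_tmp := 15 (only parsing).

Infix ";;" := Seq (at level 70, right associativity).
Notation "x <~ e" := (Assign x e) (at level 65).
Notation "a @[ i ] <~ e" := (Store a i e) (at level 65).
Notation "a ![ i ]" := (Get a i) (at level 2).
Notation Eq e1 e2 := (And (Le e1 e2) (Le e2 e1)).
Infix "+'" := (Bin Defs.Add) (at level 50, left associativity).
Infix "-'" := (Bin Defs.Sub) (at level 50, left associativity).
Infix "*'" := (Bin Defs.Mul) (at level 40, left associativity).
Coercion Var : nat >-> expr.

(** Recorded for the whole queue in advance, because moving overwrites both the class of a queued
    position and the size of its old class. *)
Definition save_step :=
  v_D <~ a_cl![a_q![v_k]] ;; a_oc@[v_k] <~ v_D ;; a_os@[v_D] <~ a_sz![v_D].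

(** One remembered stamp per class is enough: stamps do not decrease along the queue, so an earlier
    one never returns. *)
Definition new_class :=
  v_top <~ v_top -' Const 1 ;; v_N <~ a_fs![v_top] ;;
  a_sg@[v_D] <~ a_gs![v_k] ;; a_sp@[v_D] <~ v_N.

(** [a_pq] keeps the predecessor in the old list, whose next link changes too; it may be a
    sentinel. *)
Definition move_one :=
  v_N <~ a_sp![v_D] ;; v_p <~ a_pv![v_x] ;; v_s <~ a_nx![v_x] ;;
  a_nx@[v_p] <~ v_s ;; a_pv@[v_s] <~ v_p ;; a_pq@[v_k] <~ v_p ;;
  v_p <~ a_pv![v_N] ;;
  a_nx@[v_p] <~ v_x ;; a_pv@[v_x] <~ v_p ;; a_nx@[v_x] <~ v_N ;; a_pv@[v_N] <~ v_x ;;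
  a_sz@[v_D] <~ a_sz![v_D] -' Const 1 ;; a_sz@[v_N] <~ a_sz![v_N] +' Const 1 ;;
  a_cl@[v_x] <~ v_N ;; a_nc@[v_k] <~ v_N.

Definition move_step :=
  v_x <~ a_q![v_k] ;; v_D <~ a_cl![v_x] ;;
  If (Eq a_sg![v_D] a_gs![v_k]) Skip new_class ;; move_one.

(** Updating [a_ox] makes a second call on the same position silent. The outer test skips sentinels,
    which [a_pq] may contain. *)
Definition emit e :=
  v_x <~ e ;;
  If (Le v_x Len)
    (If (And (Le a_ox![v_x] Len) (Not (Eq a_ox![v_x] a_nx![v_x])))
        (Push (v_x +' Const 1) (a_ox![v_x] -' v_x +' v_l) v_l) Skip ;;
     a_ox@[v_x] <~ a_nx![v_x])
    Skip.

Definition emit_step := emit a_q![v_k] ;; emit a_pq![v_k].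

(** The sentinel exceeds [n] and ends the traversal. Position 0 has no predecessor to be queued. *)
Definition enqueue_loop :=
  While (Le v_y Len)
    (If (Le (Const 1) v_y)
        (a_q@[v_m'] <~ v_y -' Const 1 ;; a_gs@[v_m'] <~ v_st ;; v_m' <~ v_m' +' Const 1)
        Skip ;;
     v_y <~ a_nx![v_y]).

(** An empty class passes the size test, and its name is then released. The mark in [a_dn] keeps a
    class from being queued or released twice in a round. *)
Definition visit :=
  If (Le a_dn![v_N] v_l)
    (a_dn@[v_N] <~ v_l +' Const 1 ;;
     If (Le (Const 2 *' a_sz![v_N]) a_os![v_D])
       (If (Le a_sz![v_N] (Const 0))
           (a_fs@[v_top] <~ v_N ;; v_top <~ v_top +' Const 1)
           (v_st <~ v_st +' Const 1 ;; v_y <~ a_nx![v_N] ;; enqueue_loop))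
       Skip)
    Skip.

Definition visit_step :=
  v_D <~ a_oc![v_k] ;; v_N <~ v_D ;; visit ;; v_N <~ a_nc![v_k] ;; visit.

Definition round :=
  For v_k v_m save_step ;; For v_k v_m move_step ;; For v_k v_m emit_step ;;
  v_m' <~ Const 0 ;; For v_k v_m visit_step ;; v_m <~ v_m'.


(** Ties go to the left block. The comparison with [Len] accounts for a right block cut off by the
    end of the input. *)
Definition take_right :=
  And (Lt v_b v_hi) (And (Lt v_b Len)
    (Not (And (Lt v_a v_mid)
              (LetterLe (a_q![v_a] +' Const 1) (a_q![v_b] +' Const 1))))).

(** All merges of a pass share one loop over the output index: reaching [v_hi] opens the next pair
    of blocks, so every iteration takes constant time. *)
Definition merge_step :=
  If (Eq v_k v_hi)
     (v_a <~ v_k ;; v_mid <~ v_k +' v_h ;; v_b <~ v_mid ;; v_hi <~ v_mid +' v_h) Skip ;;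
  If take_right
     (a_tmp@[v_k] <~ a_q![v_b] ;; v_b <~ v_b +' Const 1)
     (a_tmp@[v_k] <~ a_q![v_a] ;; v_a <~ v_a +' Const 1).

Definition merge_pass :=
  v_hi <~ Const 0 ;; For v_k Len merge_step ;;
  For v_k Len (a_q@[v_k] <~ a_tmp![v_k]).

Definition merge_sort :=
  For v_k Len (a_q@[v_k] <~ v_k) ;; v_h <~ Const 1 ;;
  While (Lt v_h Len) (merge_pass ;; v_h <~ v_h +' v_h).

(** The chain of all positions is closed into a cycle through the sentinel [n.+1], the name of the
    only class of [E_0]; all other names start as empty lists. *)
Definition init_lists :=
  For v_k (Const 4 *' (Len +' Const 1)) (a_nx@[v_k] <~ v_k ;; a_pv@[v_k] <~ v_k) ;;
  For v_k (Const 3 *' Len +' Const 2) (a_fs@[v_k] <~ v_k +' Len +' Const 2) ;;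
  For v_k (Len +' Const 1)
    (a_nx@[v_k] <~ v_k +' Const 1 ;; a_pv@[v_k +' Const 1] <~ v_k ;;
     a_cl@[v_k] <~ Len +' Const 1 ;; a_ox@[v_k] <~ v_k +' Const 1) ;;
  a_nx@[Len +' Const 1] <~ Const 0 ;; a_pv@[Const 0] <~ Len +' Const 1 ;;
  a_sz@[Len +' Const 1] <~ Len +' Const 1 ;;
  v_top <~ Const 3 *' Len +' Const 2.

(** The letters are already sorted, so a failing reverse comparison with the previous one means a
    strictly larger letter. *)
Definition group_step :=
  If (And (Le (Const 1) v_k)
          (Not (LetterLe (a_q![v_k] +' Const 1) (a_q![v_k -' Const 1] +' Const 1))))
     (v_st <~ v_st +' Const 1) Skip ;;
  a_gs@[v_k] <~ v_st.

Definition init_groups :=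
  v_st <~ Const 1 ;; For v_k Len group_step ;; v_m <~ Len.

Definition mrc_main :=
  merge_sort ;; init_lists ;; init_groups ;; For v_l Len round.

Fixpoint alloc_arrays a :=
  if a is a'.+1 then alloc_arrays a' ;; Alloc a' (Const 4 *' (Len +' Const 1))
  else Skip.

Definition mrc_program := alloc_arrays number_of_arrays ;; mrc_main.

(** * Symbolic execution of loop-free code *)

Ltac compute_mem :=
  cbn [Lt safe csafe value holds setv seta pushm V A OUT upn Nat.eqb binop_eval].

Ltac side := unfold array_size, number_of_arrays in *; lia.

Ltac sides := try solve [
  repeat match goal with
  | |- _ /\ _ => split
  | |- and3 _ _ _ => split
  | |- and4 _ _ _ _ => split
  | |- True => exact I
  | |- _ -> _ => let H := fresh "H" in intro H
  end; solve [by [] | side]].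

Ltac step :=
  lazymatch goal with
  | |- wp _ _ (Seq _ _) _ _ => apply: wp_seq; step
  | |- wp _ _ (Assign _ _) _ _ =>
      apply: wp_assign;
      [compute_mem; sides | let v := fresh "v" in let Ev := fresh "E" in
                     move=> v; compute_mem; move=> Ev]
  | |- wp _ _ (Store _ _ _) _ _ =>
      apply: wp_store;
      [compute_mem; sides|compute_mem; sides|by []|compute_mem; sides|
       let i := fresh "i" in let v := fresh "v" in
       let Ei := fresh "Ei" in let Ev := fresh "E" in
       move=> i v; compute_mem; move=> Ei Ev; subst i v]
  | |- wp _ _ Skip _ _ => apply: wp_skip
  | |- wp _ _ (If _ _ _) _ _ => apply: wp_if; [compute_mem; sides|compute_mem|compute_mem]
  | |- wp _ _ (Push _ _ _) _ _ =>
      apply: wp_push; [compute_mem; sides|compute_mem; sides|compute_mem; sides|compute_mem; sides|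
       let i := fresh "i" in let p := fresh "p" in
       let Ei := fresh "Ei" in let Ep := fresh "E" in
       move=> i p; compute_mem; move=> Ei Ep; subst i p]
  end.

(** * Moving the queued positions *)

Section Round.
Variable k : nat.
Variables (d : Order.disp_t) (T : orderType d) (w : seq (Equality.sort T)).
Notation n := (@size (Equality.sort T) w).
Notation wp := (wp k w).

(** The output of the rounds before [l], with the most recent pair first as [Push] leaves it. *)
Definition jumps l i :=
  rev [seq (nxt_occ w l' i - i + l', l') | l' <- iota 0 l & is_jump w l' i].

(** What moving the queue needs in order to refine [E_l] into [E_(l+1)]. Stamps separate the queued
    members of a class, and the order inside a group keeps lists sorted. By the last clause the
    unqueued members of a class stay together, apart from the queued ones, and may keep the old
    name. *)
Definition queue_ok l M (q gs : nat -> nat) base st :=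
  [/\ forall j, j < M -> q j < n,
      forall i j, i < j < M ->
        [/\ q i != q j, gs i <= gs j & eqv w l.+1 (q i) (q j) -> q i < q j],
      forall j, j < M -> base < gs j <= st,
      forall i j, i < M -> j < M -> eqv w l (q i) (q j) ->
        (gs i == gs j) = eqv w l.+1 (q i) (q j) &
      forall x y, x <= n -> y <= n -> eqv w l x y -> x \notin mkseq q M ->
        eqv w l.+1 x y = (y \notin mkseq q M)].

Definition free_list (P : pred nat) (fs : nat -> nat) top :=
  uniq (mkseq fs top) /\
  forall D, (D \in mkseq fs top) = is_id n D && P D.

Record refines l (m : memory) : Prop := Refines {
  cls_id : forall x, x <= n -> is_id n (A m a_cl x);
  clsE : forall x y, x <= n -> y <= n ->
    (A m a_cl x == A m a_cl y) = eqv w l x y;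
  lists_ok : lists n (A m a_nx) (A m a_pv) (A m a_cl);
  size_ok : forall D, is_id n D -> A m a_sz D = size (members n (A m a_cl) D) }.

(** Stamps of the current queue exceed [base] and marks of the current round exceed [l], so old
    entries of [a_sg] and [a_dn] cannot be mistaken for new ones. [rs_st] keeps the stamps within a
    word. *)
Record round_start l base (m : memory) : Prop := RoundStart {
  rs_refines : refines l m;
  rs_free : free_list (fun D => members n (A m a_cl) D == [::]) (A m a_fs) (V m v_top);
  rs_ox : forall x, x <= n -> A m a_ox x = A m a_nx x;
  rs_sg : forall D, is_id n D -> A m a_sg D <= base;
  rs_queue : queue_ok l (V m v_m) (A m a_q) (A m a_gs) base (V m v_st);
  rs_dn : forall D, is_id n D -> A m a_dn D <= l;
  rs_out : forall i, i < n -> OUT m i = jumps l i;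
  rs_base : base <= V m v_st;
  rs_st : V m v_st <= 2 * l.+1 * n.+1 }.

Lemma queue_uniq l M q gs base st : queue_ok l M q gs base st -> uniq (mkseq q M).
Proof.
move=> [_ H _ _ _]; rewrite /mkseq map_inj_in_uniq ?iota_uniq // => i j.
rewrite !mem_iota => iM jM eij; apply/eqP; case: ltngtP => // lt.
- by case: (H i j) => //; [lia|rewrite eij eqxx].
- by case: (H j i) => //; [lia|rewrite eij eqxx].
Qed.

Lemma queue_leq l M q gs base st : queue_ok l M q gs base st -> M <= n.
Proof.
move=> H; rewrite -(size_mkseq q M) -[n](size_iota 0).
apply: uniq_leq_size; first exact: queue_uniq H.
move=> x /mapP[j]; rewrite !mem_iota => jM ->; case: H => H _ _ _ _.
by apply: H; lia.
Qed.

(** Pigeonhole: each of the [3 * n.+1] names is on the stack or in [L]. *)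
Lemma free_top (L : seq nat) P fs top : free_list P fs top ->
  (forall D, is_id n D -> ~~ P D -> D \in L) -> 3 * n.+1 <= top + size L.
Proof.
move=> [_ H] HP; rewrite -(size_mkseq fs top) -size_cat.
rewrite -(size_iota n.+1 (3 * n.+1)).
apply: uniq_leq_size; first exact: iota_uniq.
move=> D; rewrite mem_iota mem_cat H => Dr.
have idD : is_id n D by rewrite /is_id /array_size; lia.
by rewrite idD /=; case: (boolP (P D)) => //= /(HP _ idD).
Qed.

Lemma members_neq0 cls D : members n cls D != [::] ->
  D \in [seq cls y | y <- iota 0 n.+1].
Proof.
case E: (members n cls D) => [//|y s] _.
have := mem_head y s; rewrite -E mem_members => /andP[/eqP <- yn].
by apply: map_f; rewrite mem_iota.
Qed.

Lemma mem_mkseqP (f : nat -> nat) j x : reflect (exists2 i, i < j & x = f i) (x \in mkseq f j).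
Proof.
by apply: (iffP mapP) => [] [i]; rewrite ?mem_iota => lti ->; exists i; rewrite ?mem_iota.
Qed.

Lemma mkseq_rcons (f : nat -> nat) j : mkseq f j.+1 = rcons (mkseq f j) (f j).
Proof. by rewrite /mkseq -addn1 iotaD map_cat cats1. Qed.

Hypothesis big : 64 * n.+1 * n.+1 <= wlimit k w.

Section MoveLoop.
Variables (l base : nat) (m0 : memory).
Hypothesis (R0 : refines l m0).
Hypothesis (free0 : free_list (fun D => members n (A m0 a_cl) D == [::]) (A m0 a_fs) (V m0 v_top)).
Hypothesis (sg0 : forall D, is_id n D -> A m0 a_sg D <= base).
Hypothesis (Q0 : queue_ok l (V m0 v_m) (A m0 a_q) (A m0 a_gs) base (V m0 v_st)).
Hypothesis (ox0 : forall x, x <= n -> A m0 a_ox x = A m0 a_nx x).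
Let M := V m0 v_m.
Let q := A m0 a_q.
Let gs := A m0 a_gs.
Let c0 := A m0 a_cl.

(** [mi_free] withholds names that are empty now but were in use when the round began, which is what
    preserves [mi_new]. [mi_nx] confines the changed links to positions that the emission loop will
    inspect. *)
Record move_inv j (m : memory) : Prop := MoveInv {
  mi_id : forall x, x <= n -> is_id n (A m a_cl x);
  mi_old : forall x, x <= n -> x \notin mkseq q j -> A m a_cl x = c0 x;
  mi_new : forall i y, i < j -> y <= n -> A m a_cl (q i) != c0 y;
  mi_eq : forall i i', i < j -> i' < j -> (A m a_cl (q i) == A m a_cl (q i')) =
             (c0 (q i) == c0 (q i')) && (gs i == gs i');
  mi_sg : forall i, i < j -> gs i <= A m a_sg (c0 (q i)) /\
     (gs i = A m a_sg (c0 (q i)) -> A m a_cl (q i) = A m a_sp (c0 (q i)));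
  mi_base : forall D, is_id n D -> A m a_sg D <= base \/
     exists2 i, i < j & c0 (q i) = D /\ A m a_sg D = gs i;
  mi_lists : lists n (A m a_nx) (A m a_pv) (A m a_cl);
  mi_size : forall D, is_id n D -> A m a_sz D = size (members n (A m a_cl) D);
  mi_free : free_list (fun D => (members n (A m a_cl) D == [::]) && (members n c0 D == [::]))
     (A m a_fs) (V m v_top);
  mi_nx : forall i, i <= n -> A m a_nx i = A m0 a_ox i \/
     exists2 j', j' < j & i = q j' \/ i = A m a_pq j';
  mi_pq : forall i, i < j -> A m a_pq i < array_size n;
  mi_nc : forall i, i < j -> A m a_nc i = A m a_cl (q i) }.

(** The state between the choice of the target [N] and the move. A fresh [N] is still empty but
    already off the stack, hence [E != N] in [tc_free]. *)
Record target_class j m D N (m1 : memory) : Prop := TargetClass {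
  tc_N : A m1 a_sp D = N;
  tc_id : is_id n N;
  tc_sg : A m1 a_sg D = gs j;
  tc_eq : forall i, i < j ->
    (A m a_cl (q i) == N) = (c0 (q i) == D) && (gs i == gs j);
  tc_new : forall y, y <= n -> c0 y != N;
  tc_free : free_list (fun E => [&& members n (A m a_cl) E == [::],
              members n c0 E == [::] & E != N]) (A m1 a_fs) (V m1 v_top);
  tc_other : forall E, E != D -> A m1 a_sg E = A m a_sg E /\ A m1 a_sp E = A m a_sp E }.

Let qn j : j < M -> q j < n. Proof. by case: Q0 => H _ _ _ _; apply: H. Qed.
Let Mn : M <= n. Proof. exact: queue_leq Q0. Qed.

Let q_notin j : j < M -> q j \notin mkseq q j.
Proof.
move=> jM; apply/mem_mkseqP=> [[i ij e]]; case: Q0 => _ /(_ i j) H _ _ _.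
by case: H; [lia|rewrite -/q e eqxx].
Qed.

Let members0 cls D y : y <= n -> cls y = D -> members n cls D != [::].
Proof.
move=> yn e; have : y \in members n cls D by rewrite mem_members e eqxx yn.
by case: members.
Qed.

(** A stamp above [base] in [a_sg] stems from an earlier queued position of the same old class, and
    [a_sp] holds the class made for it. If the stamps differ, no earlier position has the same old
    class and stamp, since stamps do not decrease along the queue. *)
Lemma target_class_ok j m : j < M -> move_inv j m -> V m v_k = j -> V m v_x = q j ->
  V m v_D = c0 (q j) -> A m a_gs = gs ->
  wp (If (Eq (a_sg![v_D]) (a_gs![v_k])) Skip new_class)
     (fun m1 t => t <= 8 /\ exists N, target_class j m (c0 (q j)) N m1) m.
Proof.
move=> jM I ek ex eD egs; set D := c0 (q j) in eD *.
have := qn jM; have := Mn => Mn' qjn.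
have idD : is_id n D by apply: (cls_id R0); apply: ltnW.
have [_ Qlt Qb Qe _] := Q0.
have D_lt : D < array_size n by case/andP: idD.
step.
- rewrite egs eD ek => /andP[le1 le2]; step; split=> //.
  have e : A m a_sg D = gs j by apply/eqP; rewrite eqn_leq le1.
  have [|[i ij [ei esg]]] := mi_base I idD.
    by have := Qb j jM; rewrite -/gs; lia.
  have [_ /(_ _) eN] := mi_sg I ij; rewrite ei esg in eN.
  have {}eN := eN erefl.
  have qi : q i <= n by have := @qn i; lia.
  exists (A m a_cl (q i)); split=> //.
  - exact: (mi_id I).
  - by move=> i' i'j; rewrite (mi_eq I) // ei -esg e.
  - by move=> y yn; rewrite eq_sym; apply: (mi_new I).
  - have [uq H] := mi_free I; split=> // E; rewrite H; congr andb.
    rewrite andbA; case: (eqVneq E (A m a_cl (q i))) => [->|]; rewrite ?andbT //.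
    by rewrite (negbTE (members0 qi erefl)) andbF.
rewrite egs eD ek => neq; have neq' : A m a_sg D != gs j by rewrite eqn_leq.
(* A name off the stack is the class of some position now or at the start of the round: at most
   [2 * n.+1] of the [3 * n.+1] names. *)
have top0 : 0 < V m v_top.
  have := free_top (mi_free I) (L := [seq A m a_cl y | y <- iota 0 n.+1] ++ [seq c0 y | y <- iota 0 n.+1]).
  rewrite size_cat !size_map size_iota.
  suff : forall E, is_id n E -> ~~ ((members n (A m a_cl) E == [::]) && (members n c0 E == [::])) ->
    E \in [seq A m a_cl y | y <- iota 0 n.+1] ++ [seq c0 y | y <- iota 0 n.+1].
    by move=> H /(_ H); lia.
  by move=> E _; rewrite negb_and mem_cat => /orP[] /members_neq0 ->; rewrite ?orbT.
have [uq Hfs] := mi_free I.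
have top_lt : V m v_top <= array_size n.
  have : size (mkseq (A m a_fs) (V m v_top)) <= size (iota 0 (array_size n)).
    apply: uniq_leq_size => // E; rewrite Hfs mem_iota => /andP[/andP[_ El] _].
    by rewrite add0n El.
  by rewrite size_mkseq size_iota.
rewrite /new_class.
step. step. step. step.
split; first by [].
have eN : v0 = A m a_fs (V m v_top).-1 by rewrite E0 E subn1.
have N_in : v0 \in mkseq (A m a_fs) (V m v_top).
  by apply/mem_mkseqP; exists (V m v_top).-1 => //; lia.
have := N_in; rewrite Hfs => /and3P[idN /eqP memN /eqP memN0].
have E_top : mkseq (A m a_fs) (V m v_top) = rcons (mkseq (A m a_fs) (V m v_top).-1) v0.
  by rewrite -{1}(prednK top0) mkseq_rcons eN.
exists v0; split; compute_mem.
- by rewrite eD upd_same.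
- by [].
- by rewrite eD upd_same egs ek.
- move=> i ij; have qi : q i <= n by have := @qn i; lia.
  have -> : A m a_cl (q i) == v0 = false.
    apply/negbTE/eqP => /(members0 qi); by rewrite memN.
  apply/esym/negbTE/negP => /andP[/eqP ei /eqP eg].
  have [le_sg _] := mi_sg I ij; rewrite ei eg in le_sg.
  have [|[i' i'j [ei' es']]] := mi_base I idD.
    by have := Qb j jM; rewrite -/gs; lia.
  have [_ le_gs _] := Qlt i' j (introT andP (conj i'j jM)).
  by rewrite -/gs -es' in le_gs; case/eqP: neq'; apply/eqP; rewrite eqn_leq le_gs.
- by move=> y yn; apply/eqP => /(members0 yn); rewrite memN0.
- split; first by move: uq; rewrite E_top rcons_uniq E subn1 => /andP[].
  move=> F; have := Hfs F; rewrite E_top mem_rcons inE E subn1.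
  case: (eqVneq F v0) => [->|_] /=; last by rewrite andbT.
  rewrite !andbF => _; apply/negbTE.
  by move: uq; rewrite E_top rcons_uniq => /andP[].
by move=> F FD; rewrite !upd_diff // eD.
Qed.

Lemma move_one_ok j m0' m N : j < M -> move_inv j m0' -> 
  target_class j m0' (c0 (q j)) N m ->
  (forall a, a \notin [:: a_sg; a_sp] -> A m a = A m0' a) ->
  V m v_k = j -> V m v_x = q j -> V m v_D = c0 (q j) -> 
  wp move_one (fun m1 t => t <= 15 /\ move_inv j.+1 m1) m.
Proof.
move=> jM I TC FA ek ex eD; set D := c0 (q j) in TC eD *.
set x := q j in ex *.
have := qn jM; rewrite -/x => xn; have [_ Qlt Qb Qe _] := Q0.
have xn' := ltnW xn.
have := Mn => Mn'.
have idD : is_id n D by apply: (cls_id R0).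
have D_lt : D < array_size n by case/andP: idD.
have cx : A m0' a_cl x = D by apply: (mi_old I) => //; apply: q_notin.
have idN := tc_id TC; have N_lt : N < array_size n by case/andP: idN.
have Nx : N != A m0' a_cl x by rewrite cx eq_sym (tc_new TC).
have e_nx := FA a_nx isT; have e_pv := FA a_pv isT; have e_cl := FA a_cl isT.
have e_sz := FA a_sz isT; have e_pq := FA a_pq isT; have e_nc := FA a_nc isT.
have [nx_in pv_in] := move_nodes (mi_lists I) (mi_id I) xn'.
have idc := mi_id I.
(* Members of [N] were queued earlier with the same old class and stamp, so they agree with [x] up
   to length [l.+1], and the queue lists such positions in increasing order. *)
have lt_x y : y <= n -> A m0' a_cl y = N -> y < x.
  move=> yn ey; case: (boolP (y \in mkseq q j)) => [|y_old]; last first.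
    by have := tc_new TC yn; rewrite -(mi_old I) // ey eqxx.
  move=> /mem_mkseqP[i ij ei]; have := tc_eq TC ij; rewrite -ei ey eqxx.
  move=> /esym /andP[/eqP eD' eg]; rewrite ei.
  have [_ _ H] := Qlt i j (introT andP (conj ij jM)); apply: H.
  rewrite -Qe //; last 2 first.
  - exact: ltn_trans ij jM.
  - by rewrite -(clsE R0) ?(ltnW (qn _)) //; [apply/eqP; rewrite -/q -/c0 -ei|exact: ltn_trans ij jM].
have tl := move_tail (mi_lists I) (mi_id I) xn' idN Nx.
have x_lt := leq_trans xn (leq_trans (leqnSn n) (leq_pmull n.+1 (isT : 0 < 4))).
rewrite -[4 * _]/(array_size n) in x_lt.
have := node_lt (idc _ xn') nx_in; have := node_lt (idc _ xn') pv_in; have := node_lt idN tl.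
rewrite /move_one => tl_lt pv_lt nx_lt.
step. 
have ev : v = N by rewrite E eD (tc_N TC).
clear E; subst v.
step; have {}E : v = A m0' a_pv x by rewrite E e_pv ex.
subst v.
step; have {}E : v = A m0' a_nx x by rewrite E e_nx ex.
subst v.
step. step. step. step.
have {}E : v = pv_del (A m0' a_nx) (A m0' a_pv) x N.
  by rewrite E e_pv.
subst v.
step. step. step. step.
have ND : N != D by rewrite -cx.
have sz_le E : is_id n E -> A m a_sz E <= n.+1.
  move=> idE; rewrite e_sz (mi_size I) // /members size_filter.
  by rewrite (leq_trans (count_size _ _)) ?size_iota.
have szD := sz_le _ idD; have szN := sz_le _ idN.
step.
  by rewrite eD; sides.
step.
  by rewrite eD upd_diff //; sides.
step. step.
split; first by [].
have inj_q i : i < j -> q i != x.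
  by move=> ij; case: (Qlt i j (introT andP (conj ij jM))).
have cl' i : i < j -> upd (A m0' a_cl) x N (q i) = A m0' a_cl (q i).
  by move=> ij; rewrite upd_diff // inj_q.
have [mem_x mem_D] := members_split (A m0' a_cl) xn'; rewrite cx in mem_x mem_D.
have mem_N := members_add xn' _ lt_x.
split; compute_mem; rewrite ?ek ?ex ?eD ?e_nx ?e_pv ?e_cl ?e_sz ?e_pq ?e_nc.
- move=> y yn; rewrite /upd; case: eqP => // _; exact: idc.
- move=> y yn; rewrite mkseq_rcons mem_rcons inE negb_or => /andP[yx y_old].
  by rewrite upd_diff // (mi_old I).
- move=> i y; rewrite ltnS leq_eqVlt => /orP[/eqP ->|ij] yn.
    by rewrite upd_same eq_sym (tc_new TC).
  by rewrite cl' // (mi_new I).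
- move=> i i'; rewrite ltnS leq_eqVlt => /orP[/eqP ->|ij]; rewrite ltnS leq_eqVlt => /orP[/eqP ->|i'j].
  + by rewrite !eqxx.
  + by rewrite upd_same cl' // eq_sym (tc_eq TC) // eq_sym [gs j == _]eq_sym.
  + by rewrite upd_same cl' // (tc_eq TC).
  + by rewrite !cl' // (mi_eq I).
- move=> i; rewrite ltnS leq_eqVlt => /orP[/eqP ->|ij].
    by rewrite -/D -/x (tc_sg TC) (tc_N TC) upd_same.
  rewrite cl' //; case: (eqVneq (c0 (q i)) D) => [ei|neq].
    rewrite ei (tc_sg TC) (tc_N TC); have [_ le_gs _] := Qlt i j (introT andP (conj ij jM)).
    split=> // eg; apply/eqP; by rewrite (tc_eq TC) // ei eg !eqxx.
  by have [-> ->] := tc_other TC neq; apply: (mi_sg I).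
- move=> E idE; case: (eqVneq E D) => [->|neq].
    by right; exists j => //; rewrite (tc_sg TC).
  have [-> _] := tc_other TC neq; case: (mi_base I idE) => [|[i ij H]]; [by left|right].
  by exists i => //; apply: ltnW.
- exact: (lists_move (mi_lists I) idc xn' idN Nx lt_x).
- move=> E idE; case: (eqVneq E N) => [->|EN].
    rewrite mem_N; last by rewrite eq_sym.
    rewrite upd_same size_rcons upd_diff // (mi_size I) //; lia.
  rewrite upd_diff //; case: (eqVneq E D) => [->|ED].
    by rewrite upd_same mem_D // (mi_size I) // mem_x !size_cat /=; lia.
  by rewrite upd_diff // members_other ?cx // (mi_size I).
- have [uq H] := tc_free TC; split=> // E; rewrite H; congr andb.
  case: (eqVneq E N) => [->|EN].
    rewrite mem_N; last by rewrite eq_sym.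
    by rewrite -cats1 andbF andbF; case: (members _ _ _).
  rewrite andbT; case: (eqVneq E D) => [->|ED].
    have /negbTE -> : members n c0 D != [::] by apply: (members0 xn').
    by rewrite !andbF.
  by rewrite members_other ?cx.
(* Next links change only at [x], at its old predecessor and at the tail of [N]; a tail that is not
   a sentinel is a position moved earlier. *)
- move=> i i_n; rewrite /nx_move; case: (eqVneq i x) => [->|ix].
    by right; exists j => //; left.
  have iN : i != N by case/andP: idN; lia.
  rewrite upd_diff //; case: (eqVneq i (pv_del (A m0' a_nx) (A m0' a_pv) x N)) => [ei|it].
    have : i \in N :: members n (A m0' a_cl) N by rewrite ei.
    rewrite inE (negbTE iN) mem_members /= => /andP[/eqP ci _].
    case: (boolP (i \in mkseq q j)) => [/mem_mkseqP[i' ij' ->]|i_old].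
      by right; exists i'; [apply: ltnW|left].
    by have := tc_new TC i_n; rewrite -(mi_old I) // ci eqxx.
  rewrite upd_diff // /nx_del; case: (eqVneq i (A m0' a_pv x)) => [ei|ip].
    by right; exists j => //; right; rewrite upd_same.
  rewrite upd_diff //; case: (mi_nx I i_n) => [|[i' ij' H]]; [by left|right].
  exists i'; first exact: ltnW.
  by case: H => [|->]; [by left|right; rewrite upd_diff // neq_ltn ij'].
- move=> i; rewrite ltnS leq_eqVlt => /orP[/eqP ->|ij]; first by rewrite upd_same.
  by rewrite upd_diff ?(mi_pq I) // neq_ltn ij.
move=> i; rewrite ltnS leq_eqVlt => /orP[/eqP ->|ij].
  by rewrite !upd_same.
by rewrite cl' // upd_diff ?(mi_nc I) // neq_ltn ij.
Qed.

Lemma move_inv_ext j m m' : A m = A m' -> V m v_top = V m' v_top ->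
  move_inv j m -> move_inv j m'.
Proof. by move=> eA eV; case; rewrite eA eV => *; split. Qed.

Lemma move_step_ok j m : j < M -> framed (For v_k v_m move_step) m0 m ->
  V m v_k = j -> move_inv j m ->
  wp move_step (fun m1 t => t <= 25 /\ move_inv j.+1 (setv m1 v_k j.+1)) m.
Proof.
move=> jM [FV FA _] ek I; have eq : A m a_q = q := FA a_q isT.
have egs : A m a_gs = gs := FA a_gs isT.
have := qn jM; have := Mn => Mn' qjn.
have cx : A m a_cl (q j) = c0 (q j) by apply: (mi_old I (ltnW qjn)); apply: q_notin.
rewrite /move_step; step.
step.
  by rewrite E eq ek; sides.
have {}E : v = q j by rewrite E eq ek.
have {}E0 : v0 = c0 (q j) by rewrite E0 E cx.
subst v v0; apply: wp_seq.
set m1 := setv _ _ _.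
have I1 : move_inv j m1 by apply: move_inv_ext I.
have F1 := @target_class_ok j m1 jM I1 ek erefl erefl egs.
apply: wp_mono F1 => m2 t2 [FV2 FA2 _] [t2_le [N TC]].
have F2 := @move_one_ok j m1 m2 N jM I1 TC.
apply: wp_mono (F2 _ _ _ _) => [m3 t3 _ [t3_le I3]|a a_notin|||].
- split; first by lia.
  by apply: move_inv_ext I3.
- apply: FA2; move: a_notin; rewrite /= !inE !negb_or => /andP[-> ->] //.
- by rewrite FV2.
- by rewrite FV2.
- by rewrite FV2.
Qed.

Lemma move_inv0 m : A m = A m0 -> V m v_top = V m0 v_top -> move_inv 0 m.
Proof.
move=> eA eV; split; rewrite ?eA ?eV //; try by case: R0.
- by move=> D /sg0; left.
- have [uq H] := free0; split=> // D; rewrite H -/c0.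
  by case: (members _ _ _ == _).
- by move=> i i_n; left; rewrite ox0.
Qed.

Lemma move_loop_ok : wp (For v_k v_m move_step)
  (fun m t => t <= 27 * M + 2 /\ move_inv M m) m0.
Proof.
have := Mn => Mn'; apply: (@wp_for_const _ _ _ _ 25 _ _ _ (fun j m => move_inv j m) M).
- by [].
- by lia.
- by lia.
- exact: move_inv0.
- by move=> m [FV _ _]; rewrite /= FV.
- by move=> j m F jM ek I; apply: move_step_ok.
- by move=> t m _ I.
Qed.

End MoveLoop.

Lemma save_loop_ok m0 (M := V m0 v_m) (q := A m0 a_q) (c0 := A m0 a_cl) :
  M <= n -> (forall j, j < M -> q j < n) -> (forall x, x <= n -> is_id n (c0 x)) ->
  wp (For v_k v_m save_step)
     (fun m t => t <= 5 * M + 2 /\ forall j, j < M -> A m a_oc j = c0 (q j) /\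
        A m a_os (c0 (q j)) = A m0 a_sz (c0 (q j))) m0.
Proof.
move=> Mn qn idc; pose J j m := forall i, i < j -> A m a_oc i = c0 (q i) /\
        A m a_os (c0 (q i)) = A m0 a_sz (c0 (q i)).
apply: (@wp_for_const _ _ _ _ 3 _ _ _ J M) => //.
- by lia.
- by lia.
- by move=> m [FV _ _]; rewrite /= FV.
move=> j m [FV FA _] jM ek Jj; have qj := qn _ jM.
have eq : A m a_q = q := FA a_q isT.
have ec : A m a_cl = c0 := FA a_cl isT.
have es : A m a_sz = A m0 a_sz := FA a_sz isT.
have D_lt : c0 (q j) < array_size n by case/andP: (idc _ (ltnW qj)).
rewrite /save_step; step.
  by rewrite eq ek; sides.
have {}E : v = c0 (q j) by rewrite E eq ec ek.
subst v; step; step; split=> // i; compute_mem.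
rewrite ek es ltnS leq_eqVlt => /orP[/eqP ->|ij].
  by rewrite !upd_same.
rewrite (upd_diff (A m a_oc)) ?neq_ltn ?ij //; have [-> e] := Jj _ ij; split=> //.
by rewrite /upd; case: eqP => [->|].
Qed.

End Round.

(** * Output of the changed links *)

Section Emit.
Variable k : nat.
Variables (d : Order.disp_t) (T : orderType d) (w : seq (Equality.sort T)).
Notation n := (@size (Equality.sort T) w).
Notation wp := (wp k w).

(** A link above [n] is the sentinel of the class; [minn] reduces it to [n.+1], the value of
    [nxt_occ] when there is no further occurrence. *)
Lemma refines_nxt l m x : refines w l m -> x <= n ->
  minn (A m a_nx x) n.+1 = nxt_occ w l x.
Proof.
move=> R xn; have := lists_nxt (lists_ok R) xn (cls_id R xn).
case: (leqP (A m a_nx x) n) => [nx_n [x_nx cnx H]|nx_n H].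
  have -> : minn (A m a_nx x) n.+1 = A m a_nx x by lia.
  apply/esym/nxt_occ_unique; first by rewrite x_nx.
    by rewrite -(clsE R) // cnx.
  move=> z xz; rewrite -(clsE R) //; last by lia.
  by rewrite eq_sym H.
have -> : minn (A m a_nx x) n.+1 = n.+1 by lia.
rewrite (nxt_occ_none xn) // => z xz.
rewrite -(clsE R) //; last by case/andP: xz.
by rewrite eq_sym H.
Qed.

(** Two moved positions compare by old class and stamp, two unmoved ones by old class alone, and a
    mixed pair is apart because new names are never old ones. [queue_ok] yields the same three
    answers for [E_(l+1)]. *)
Lemma refines_next l base m0 m : refines w l m0 ->
  queue_ok w l (V m0 v_m) (A m0 a_q) (A m0 a_gs) base (V m0 v_st) ->
  move_inv w base m0 (V m0 v_m) m -> refines w l.+1 m.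
Proof.
move=> R0 Q0 I; have [qn _ _ Qe Qo] := Q0.
split; [exact: mi_id I| |exact: mi_lists I|exact: mi_size I].
move=> x y xn yn.
have mono a b : eqv w l.+1 a b -> eqv w l a b by apply: eqv_leq.
have mixed a b : a <= n -> b <= n -> a \in mkseq (A m0 a_q) (V m0 v_m) ->
    b \notin mkseq (A m0 a_q) (V m0 v_m) ->
    (A m a_cl a == A m a_cl b) = eqv w l.+1 a b.
  move=> an bn /[dup] a_in /mem_mkseqP[i iM ->] b_out.
  rewrite [A m a_cl b](mi_old I) // (negbTE (mi_new I iM bn)); apply/esym/negbTE/negP => e.
  have := Qo b (A m0 a_q i) bn (ltnW (qn _ iM)); rewrite eqv_sym => /(_ (mono _ _ e) b_out).
  by rewrite eqv_sym e map_f // mem_iota.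
case: (boolP (x \in mkseq (A m0 a_q) (V m0 v_m))) => [xq|xq];
  case: (boolP (y \in mkseq (A m0 a_q) (V m0 v_m))) => [yq|yq].
- case/mem_mkseqP: xq xn => i iM -> xn; case/mem_mkseqP: yq yn => j jM -> yn.
  rewrite (mi_eq I) // (clsE R0) //.
  case: (boolP (eqv w l _ _)) => [e|ne] /=; first exact: Qe.
  by apply/esym/negbTE; apply: contra ne; apply: mono.
- exact: mixed.
- by rewrite eq_sym eqv_sym; apply: mixed.
rewrite !(mi_old I) // (clsE R0) //.
case: (boolP (eqv w l _ _)) => [e|ne] /=; first by rewrite Qo.
by apply/esym/negbTE; apply: contra ne; apply: mono.
Qed.

Lemma jumpsS l i : jumps w l.+1 i =
  if is_jump w l i then (nxt_occ w l i - i + l, l) :: jumps w l i else jumps w l i.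
Proof.
rewrite /jumps -[l.+1]addn1 iotaD filter_cat map_cat rev_cat /=.
by case: ifP.
Qed.

Hypothesis big : 64 * n.+1 * n.+1 <= wlimit k w.

Section EmitLoop.
Variables (l : nat) (m0 : memory).
Hypothesis (R1 : refines w l.+1 m0) (ln : l < n) (el : V m0 v_l = l).
Let M := V m0 v_m.
Let q := A m0 a_q.
Let pq := A m0 a_pq.
Hypothesis (ox0 : forall i, i <= n -> minn (A m0 a_ox i) n.+1 = nxt_occ w l i).
Hypothesis (out0 : forall i, i < n -> OUT m0 i = jumps w l i).
Hypothesis (Mn : M <= n) (qn : forall j, j < M -> q j < n).
Hypothesis (pqn : forall j, j < M -> pq j < array_size n).
Hypothesis (touched : forall i, i <= n -> A m0 a_nx i = A m0 a_ox i \/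
     exists2 j, j < M & i = q j \/ i = pq j).

(** A position can come up repeatedly, as a queued one and as a predecessor; the loop keeps each
    position in one of the states [pending] and [emitted]. *)
Definition emitted (m : memory) i :=
  A m a_ox i = A m0 a_nx i /\ (i < n -> OUT m i = jumps w l.+1 i).

Definition pending (m : memory) i :=
  A m a_ox i = A m0 a_ox i /\ (i < n -> OUT m i = jumps w l i).

(** Comparing raw links is sound although sentinels differ: the first test makes the old link a
    position, and [minn] hides no change from a position. *)
Lemma is_jumpE i : i <= n ->
  is_jump w l i = (A m0 a_ox i <= n) && (A m0 a_ox i != A m0 a_nx i).
Proof. by move=> i_n; rewrite /is_jump -ox0 // -(refines_nxt R1 i_n); lia. Qed.

Lemma emit_ok e m : A m a_nx = A m0 a_nx -> V m v_l = l ->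
  safe k w m e -> value w m e < array_size n ->
  (forall i, i <= n -> pending m i \/ emitted m i) ->
  wp (emit e) (fun m1 t => [/\ t <= 6,
     forall i, i <= n -> pending m1 i \/ emitted m1 i,
     forall i, i <= n -> emitted m i -> emitted m1 i &
     value w m e <= n -> emitted m1 (value w m e)]) m.
Proof.
move=> enx evl se; set x := value w m e => x_lt H; rewrite /emit.
step.
rewrite -/x in E; subst v; step.
  move=> xn; have ox_x := ox0 xn; have ln' := ln.
  have x_lt_nxt := nxt_occ_gt w l x.
  have nx_x := refines_nxt R1 xn; have nxt_max := nxt_occ_max l xn.
  have x_lt_nxt' := nxt_occ_gt w l.+1 x.
  have ox_cases : A m a_ox x = A m0 a_ox x \/ A m a_ox x = A m0 a_nx x.
    by case: (H x xn) => [[->]|[->]]; [left|right].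
  have fin m1 : (forall i, i != x -> A m1 a_ox i = A m a_ox i /\ OUT m1 i = OUT m i) ->
      emitted m1 x -> [/\ forall i, i <= n -> pending m1 i \/ emitted m1 i,
     forall i, i <= n -> emitted m i -> emitted m1 i & x <= n -> emitted m1 x].
    move=> same ex; split=> // i i_n; case: (eqVneq i x) => [->|ix]; rewrite /pending /emitted.
    - by right.
    - by have [-> ->] := same _ ix; apply: H.
    - by [].
    - by have [-> ->] := same _ ix.
  step.
  - rewrite enx => /andP[ox_n neq].
    have jmp : is_jump w l x.
      rewrite is_jumpE //; have [[<- _]|[ox_nx _]] := H x xn; lia.
    have [ox_e out_x] : pending m x by case: (H x xn) => // [[ox_e]]; lia.
    have xn1 : x < n by lia.
    step; rewrite evl.
    step.
    case: (fin (seta (pushm (setv m 3 x) (x + 1) (A m a_ox x - x + l, l)) a_ox x (A m a_nx x))).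
    + by move=> i ix; compute_mem; rewrite addn1 /= !upd_diff.
    + split=> [|_]; compute_mem; first by rewrite upd_same enx.
      rewrite addn1 upd_same out_x // jumpsS jmp; congr ((_, _) :: _).
      by rewrite ox_e -ox0 //; lia.
    by split.
  - rewrite enx => nopush; step; step.
    case: (fin (seta (setv m 3 x) a_ox x (A m a_nx x))).
    + by move=> i ix; compute_mem; rewrite !upd_diff.
    + split=> [|xn1]; compute_mem; first by rewrite upd_same enx.
      case: (H x xn) => [[ox_e out_x]|[_ ->]] //.
      rewrite out_x // jumpsS; case: ifP => //; rewrite is_jumpE // -ox_e; lia.
    by split.
by move=> x_gt; step; split=> // xn; rewrite xn in x_gt.
Qed.

Lemma emit_loop_ok : wp (For v_k v_m emit_step)
  (fun m t => t <= 14 * M + 2 /\ forall i, i <= n -> emitted m i) m0.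
Proof.
pose J j m := (forall i, i <= n -> pending m i \/ emitted m i) /\
   (forall i j', i <= n -> j' < j -> i = q j' \/ i = pq j' -> emitted m i).
apply: (@wp_for_const _ _ _ _ 12 _ _ _ J M) => //.
- by have := big; lia.
- by have := big; lia.
- split=> //; first by move=> i i_n; left; split=> // /out0.
- by move=> m [FV _ _]; rewrite /= FV.
- move=> j m [FV FA _] jM ek [J1 J2].
  have eq : A m a_q = q := FA a_q isT.
  have epq : A m a_pq = pq := FA a_pq isT.
  have enx : A m a_nx = A m0 a_nx := FA a_nx isT.
  have evl : V m v_l = l by rewrite FV.
  have qj := qn jM; have pqj := pqn jM; have := Mn => Mn'.
  rewrite /emit_step; apply: wp_seq.
  apply: wp_mono (emit_ok enx evl _ _ J1) => [m1 t1 F1 [t1_le P1 K1 D1]||]; last 2 first.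
  - by compute_mem; rewrite ek; sides.
  - by compute_mem; rewrite eq ek; side.
  have [FV1 FA1 _] := F1.
  have ek1 : V m1 v_k = j by rewrite FV1.
  have epq1 : A m1 a_pq = pq by rewrite (FA1 a_pq isT).
  have enx1 : A m1 a_nx = A m0 a_nx by rewrite (FA1 a_nx isT).
  have evl1 : V m1 v_l = l by rewrite FV1.
  apply: wp_mono (emit_ok enx1 evl1 _ _ P1) => [m2 t2 F2 [t2_le P2 K2 D2]||]; last 2 first.
  - by compute_mem; rewrite ek1; sides.
  - by rewrite /= epq1 ek1.
  split; first by lia.
  split=> // i j' i_n; rewrite ltnS leq_eqVlt => /orP[/eqP ->|j'j] ij.
    case: ij => ei; [apply: K2 => //; move: D1|move: D2]; compute_mem.
      by rewrite eq ek -ei => /(_ i_n).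
    by rewrite epq1 ek1 -ei => /(_ i_n).
  by apply: K2 => //; apply: K1 => //; apply: J2 j'j ij.
move=> t m F [J1 J2] t_le; split=> // i i_n.
(* An untouched position keeps its link, so it has no jump at [l] and its pending output is already
   the one required. *)
have [e|[j jM ij]] := touched i_n; last exact: J2 jM ij.
case: (J1 i i_n) => // [[ox_e out_e]]; split; first by rewrite ox_e e.
by move=> in1; rewrite out_e // jumpsS is_jumpE // e eqxx andbF.
Qed.

End EmitLoop.
End Emit.

(** * Building the next queue *)

Section Visit.
Variable k : nat.
Variables (d : Order.disp_t) (T : orderType d) (w : seq (Equality.sort T)).
Notation n := (@size (Equality.sort T) w).
Notation wp := (wp k w).

Definition items (m : memory) :=
  mkseq (fun i => (A m a_q i, A m a_gs i)) (V m v_m').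

Lemma mkseq_upd (X : Type) (f : nat -> X) K x :
  mkseq (upd f K x) K.+1 = rcons (mkseq f K) x.
Proof.
rewrite /mkseq -addn1 iotaD map_cat cats1 /= upd_same; congr rcons.
by apply/eq_in_map => i; rewrite mem_iota => iK; rewrite upd_diff //; lia.
Qed.

Lemma nx_nth nx pv C L r : cycle (linked nx pv) (C :: L) -> r < size L ->
  nx (nth C L r) = nth C L r.+1.
Proof.
move=> /(pathP C) H rL; have := H r.+1; rewrite size_rcons ltnS => /(_ rL).
by rewrite /= !nth_rcons_default => /andP[/eqP].
Qed.

Lemma nx_head nx pv C L : cycle (linked nx pv) (C :: L) -> nx C = nth C L 0.
Proof.
move=> /(pathP C) H; have := H 0; rewrite size_rcons => /(_ isT).
by rewrite nth_rcons_default => /andP[/eqP].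
Qed.

Hypothesis big : 64 * n.+1 * n.+1 <= wlimit k w.

Lemma enqueue_loop_ok m C :
  is_id n C -> lists n (A m a_nx) (A m a_pv) (A m a_cl) ->
  V m v_y = A m a_nx C -> V m v_m' <= 2 * n ->
  wp enqueue_loop (fun m' t =>
    let L := members n (A m a_cl) C in
    t <= 8 * size L + 1 /\
    items m' = items m ++ [seq (y.-1, V m v_st) | y <- L & 0 < y]) m.
Proof.
move=> idC Hl ey Kn; set L := members n (A m a_cl) C.
have cyc : cycle (linked (A m a_nx) (A m a_pv)) (C :: L) := Hl C idC.
have size_L : size L <= n.+1.
  by rewrite /L /members size_filter (leq_trans (count_size _ _)) ?size_iota.
have L_le r : r < size L -> nth C L r <= n.
  by move=> rL; have := mem_nth C rL; rewrite mem_members => /andP[].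
have C_gt : n < C by case/andP: idC.
pose I s m' t := exists2 r, r <= size L & [/\ s = size L - r, t <= 8 * r,
   V m' v_y = nth C L r, V m' v_m' <= V m v_m' + r &
   items m' = items m ++ [seq (y.-1, V m v_st) | y <- take r L & 0 < y]].
apply: (@wp_while _ _ _ _ _ _ I (size L)).
- exists 0 => //; rewrite take0 cats0 ey (nx_head cyc) subn0; split=> //; lia.
- move=> s m1 t F [r rL [_ _ ey1 _ _]]; compute_mem; split=> //; have := big; lia.
- move=> s m1 t [FV FA _] [r rL [es t_le ey1 K_le it]]; compute_mem; rewrite ey1 => y_le.
  have {}rL : r < size L.
    by rewrite ltnNge; apply/negP=> Lr; move: y_le; rewrite nth_default //; lia.
  have enx : A m1 a_nx = A m a_nx := FA a_nx isT.
  have est : V m1 v_st = V m v_st by rewrite FV.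
  have nxy := nx_nth cyc rL.
  have e_take : take r.+1 L = rcons (take r L) (nth C L r) by rewrite (take_nth C).
  step.
  + move=> y_pos; step. step. step. step.
    exists (size L - r.+1); first by lia.
    exists r.+1 => //; compute_mem.
    rewrite enx ey1 nxy in E0; subst v0; split=> //; first by lia.
      by rewrite E; lia.
    rewrite /items; compute_mem; rewrite E addn1 ey1 est e_take filter_rcons -ey1 y_pos.
    rewrite map_rcons -rcons_cat -it -mkseq_upd ey1 subn1.
    by apply: eq_mkseq => i; rewrite /upd; case: eqP.
  move=> y0; step; step.
  exists (size L - r.+1); first by lia.
  rewrite enx ey1 nxy in E; subst v.
  exists r.+1 => //; rewrite /items; compute_mem; split=> //; try lia.
  by rewrite e_take filter_rcons -ey1 lt0n; case: eqP => [_|]; [exact: it|lia].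
move=> s m1 t F [r rL [_ t_le ey1 _ it]]; compute_mem; rewrite ey1 => y_gt.
have e : r = size L.
  by apply/eqP; rewrite eqn_leq rL leqNgt; apply: contra y_gt => /L_le.
by subst r; rewrite it take_size; split=> //; lia.
Qed.

Section VisitLoop.
Variables (l : nat) (m0 : memory) (c0 qo : nat -> nat).
Let M := V m0 v_m.
Let c1 := A m0 a_cl.
Let base := V m0 v_st.
Hypothesis (R1 : refines w l.+1 m0) (ln : l < n) (el : V m0 v_l = l).
Hypothesis (id0 : forall x, x <= n -> is_id n (c0 x)).
Hypothesis (c0E : forall x y, x <= n -> y <= n -> (c0 x == c0 y) = eqv w l x y).
Hypothesis (Mn : M <= n) (qon : forall j, j < M -> qo j < n).
Hypothesis (ocE : forall j, j < M -> A m0 a_oc j = c0 (qo j)).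
Hypothesis (osE : forall j, j < M -> A m0 a_os (c0 (qo j)) = size (members n c0 (c0 (qo j)))).
Hypothesis (ncE : forall j, j < M -> A m0 a_nc j = c1 (qo j)).
Hypothesis (c1_old : forall x, x <= n -> x \notin mkseq qo M -> c1 x = c0 x).
Hypothesis (c1_new : forall j y, j < M -> y <= n -> c1 (qo j) != c0 y).
Hypothesis (dn0 : forall D, is_id n D -> A m0 a_dn D <= l).
Hypothesis (free0 : free_list w (fun D => (members n c1 D == [::]) && (members n c0 D == [::]))
   (A m0 a_fs) (V m0 v_top)).
Hypothesis (base_le : base <= 2 * l.+1 * n.+1).

Definition visited (m : memory) D := l < A m a_dn D.

Definition queued m y := visited m (c1 y) && small w l y.

(** Position 0 is counted too: it costs a step of the traversal but queues nothing, so [vi_count] is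
    only an inequality. *)
Definition queued_count m := count (queued m) (iota 0 n.+1).

(** Order and grouping of the queue in terms of the classes of the successors; [queue_next]
    translates this into [E_(l+2)]. *)
Definition before (p p' : nat * nat) :=
  [&& p.1 != p'.1, p.2 <= p'.2, (p.2 == p'.2) == (c1 p.1.+1 == c1 p'.1.+1) &
      (p.2 == p'.2) ==> (p.1 < p'.1)].

Record visit_inv (m : memory) : Prop := VisitInv {
  vi_dn : forall D, is_id n D -> A m a_dn D <= l.+1;
  vi_free : free_list w (fun D => (members n c1 D == [::]) &&
     ((members n c0 D == [::]) || visited m D)) (A m a_fs) (V m v_top);
  vi_before : pairwise before (items m);
  vi_item : forall p, p \in items m ->
    [/\ p.1 < n, base < p.2 <= V m v_st & queued m p.1.+1];
  vi_queued : forall y, 0 < y <= n -> queued m y -> y.-1 \in unzip1 (items m);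
  vi_count : V m v_m' <= queued_count m;
  vi_base : base <= V m v_st }.

Lemma queued_count_le m : queued_count m <= n.+1.
Proof. by rewrite /queued_count (leq_trans (count_size _ _)) ?size_iota. Qed.

Lemma visit_inv_ext m m' : A m = A m' -> V m v_top = V m' v_top ->
  V m v_m' = V m' v_m' -> V m v_st = V m' v_st ->
  visit_inv m -> visit_inv m'.
Proof.
move=> eA etop em est [i1 i2 i3 i4 i5 i6 i7].
split; rewrite /items /queued_count /queued /visited -?eA -?etop -?em -?est //.
Qed.

Let members_class_size x : x <= n -> size (members n c1 (c1 x)) = class_size w l.+1 x.
Proof.
move=> xn; rewrite /members size_filter; apply: eq_in_count => y; rewrite mem_iota => yr.
by rewrite eq_sym (clsE R1) //; lia.
Qed.

Let members_class_size0 x : x <= n -> size (members n c0 (c0 x)) = class_size w l x.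
Proof.
move=> xn; rewrite /members size_filter; apply: eq_in_count => y; rewrite mem_iota => yr.
by rewrite eq_sym c0E //; lia.
Qed.

(** The traversal costs 8 per member and is charged to the growth of [queued_count]; the rest of a
    visit fits into the constant 14. *)
Lemma visit_ok j C m : j < M -> C = c0 (qo j) \/ C = c1 (qo j) -> is_id n C ->
  framed (For v_k v_m visit_step) m0 m ->
  V m v_D = c0 (qo j) -> V m v_N = C -> V m v_st <= base + 2 * n ->
  visit_inv m ->
  wp visit (fun m' t => [/\ visit_inv m', visited m' C,
    forall E, visited m E -> visited m' E,
    V m' v_st <= (V m v_st).+1 &
    t + 8 * queued_count m <= 14 + 8 * queued_count m']) m.
Proof.
move=> jM C_or idC [FV FA _] eD eN st_le I.
have C_lt : C < array_size n by case/andP: idC.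
have evl : V m v_l = l by rewrite FV.
have ecl : A m a_cl = c1 := FA a_cl isT.
have eos : A m a_os = A m0 a_os := FA a_os isT.
have esz : A m a_sz C = size (members n c1 C) by rewrite (FA a_sz isT) (size_ok R1).
have enx : A m a_nx = A m0 a_nx := FA a_nx isT.
have epv : A m a_pv = A m0 a_pv := FA a_pv isT.
have st_bound : V m v_st <= 4 * n.+1 * n.+1.
  have : 2 * l.+1 * n.+1 <= 2 * n * n.+1 by rewrite leq_mul2r leq_mul2l ln orbT.
  by have := base_le; lia.
have size_c c D : size (members n c D) <= n.+1.
  by rewrite /members size_filter (leq_trans (count_size _ _)) ?size_iota.
have szC := size_c c1 C.
have D_lt : c0 (qo j) < array_size n by case/andP: (id0 (ltnW (qon jM))).
have qj := qon jM; have qj' := ltnW qj.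
(* All members of [C] come from the old class of [qo j], so the size saved in [a_os] is that of the
   parent of [C]. *)
have C_c0 y : y <= n -> c1 y = C -> c0 y = c0 (qo j).
  move=> yn; case: C_or => -> ey; last first.
    apply/eqP; rewrite c0E //; apply: (@eqv_leq _ _ l l.+1) => //.
    by rewrite -(clsE R1) //; apply/eqP.
  rewrite -c1_old //; apply/negP=> /mem_mkseqP[i iM ei].
  by have := c1_new iM qj'; rewrite -ei ey eqxx.
have small_C y : y <= n -> c1 y = C ->
    small w l y = (2 * size (members n c1 C) <= A m0 a_os (c0 (qo j))).
  move=> yn ey; rewrite /small -members_class_size // ey osE //.
  by rewrite -members_class_size0 // (C_c0 _ yn ey).
have top_lt : V m v_top < array_size n.
  have [uq H] := vi_free I.
  have : size (mkseq (A m a_fs) (V m v_top)) <= size (iota n.+1 (3 * n.+1)).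
    apply: uniq_leq_size => // E; rewrite H mem_iota => /andP[/andP[El Eg] _].
    by rewrite El; rewrite /array_size in Eg; lia.
  by rewrite size_mkseq size_iota /array_size; lia.
have m'_le := vi_count I; have cnt_le := queued_count_le m.
have szN : A m a_sz (V m v_N) <= n.+1 by rewrite eN esz.
rewrite /visit; step.
  rewrite eN evl => fresh.
  have nvC : ~~ visited m C by rewrite /visited -leqNgt.
  have mark m1 : A m1 a_dn = upd (A m a_dn) C l.+1 ->
      (forall E, visited m1 E = (E == C) || visited m E) /\
      (forall D, is_id n D -> A m1 a_dn D <= l.+1).
    move=> e; split=> [E|D idD]; rewrite /visited e /upd.
      by case: eqP => [_|//]; rewrite ltnSn.
    by case: eqP => // _; apply: (vi_dn I).
  have count_C m1 : (forall E, visited m1 E = (E == C) || visited m E) ->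
      queued_count m1 = queued_count m + count (fun y => (c1 y == C) && small w l y) (iota 0 n.+1).
    move=> vis1; rewrite /queued_count -count_predUI.
    rewrite [X in _ = _ + X](eq_count (a2 := pred0)) ?count_pred0 ?addn0.
      by apply: eq_count => y; rewrite /queued /= vis1 orbC andb_orl.
    move=> y; rewrite /queued /=; case: eqP => [->|]; last by rewrite andbF.
    by rewrite (negbTE nvC).
  (* Covers the cases in which marking [C] queues nothing. *)
  have keep m1 : A m1 a_dn = upd (A m a_dn) C l.+1 -> items m1 = items m ->
      V m1 v_st = V m v_st -> V m1 v_m' = V m v_m' ->
      (forall y, y <= n -> queued m1 y = queued m y) ->
      free_list w (fun D => (members n c1 D == [::]) &&
        ((members n c0 D == [::]) || visited m1 D)) (A m1 a_fs) (V m1 v_top) ->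
      visit_inv m1.
    move=> /mark[_ dn1] it est em' qd free1; split=> //; rewrite ?it ?em' ?est.
    - exact: vi_before I.
    - by move=> p /(vi_item I)[p1 p2 p3]; rewrite qd.
    - by move=> y yn; rewrite qd; [apply: (vi_queued I)|case/andP: yn].
    - apply: leq_trans (vi_count I) _; apply: eq_leq; apply: eq_in_count => y.
      by rewrite mem_iota => yr; rewrite qd //; lia.
    exact: vi_base I.
  step; rewrite evl addn1 eN; step.
  - rewrite eN eD eos esz => small_le.
    have C_small y : y <= n -> c1 y = C -> small w l y.
      by move=> yn ey; rewrite small_C.
    have e_count m1 : (forall E, visited m1 E = (E == C) || visited m E) ->
        queued_count m1 = queued_count m + size (members n c1 C).
      move=> /count_C ->; congr addn; rewrite /members size_filter.
      apply: eq_in_count => y; rewrite mem_iota => yr.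
      by case: eqP => //= ey; apply: C_small => //; lia.
    step.
    + rewrite eN esz leqn0 size_eq0 => /eqP C_empty.
      (* A new class contains the position moved into it, so only an old name can be empty here. *)
      have e_C : C = c0 (qo j).
        case: C_or => // e; have : qo j \in members n c1 C.
          by rewrite mem_members e eqxx qj'.
        by rewrite C_empty.
      have C_full : members n c0 C != [::].
        have : qo j \in members n c0 C by rewrite mem_members e_C eqxx qj'.
        by case: members.
      step. step.
      set m1 := setv _ _ _; have [vis1 dn1] := mark m1 (erefl _).
      have not_C y : y <= n -> (c1 y == C) = false.
        move=> yn; apply/negP=> /eqP ey; have : y \in members n c1 C.
          by rewrite mem_members ey eqxx.
        by rewrite C_empty.
      have queued1 y : y <= n -> queued m1 y = queued m y.
        by move=> yn; rewrite /queued vis1 not_C.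
      split; last 1 first.
      * by rewrite (e_count m1) // C_empty addn0; lia.
      * apply: keep => //; have [uq H] := vi_free I.
        have C_new : C \notin mkseq (A m a_fs) (V m v_top).
          by rewrite H (negbTE C_full) (negbTE nvC) !andbF.
        have efs : A m1 a_fs = upd (A m a_fs) (V m v_top) C by rewrite -eN.
        have etop : V m1 v_top = (V m v_top).+1 by rewrite /m1 /= E addn1.
        rewrite efs etop; split=> [|G]; rewrite mkseq_upd ?rcons_uniq ?C_new //.
        rewrite mem_rcons inE H vis1; case: (eqVneq G C) => [->|//].
        by rewrite idC C_empty eqxx orbT.
      * by rewrite vis1 eqxx.
      * by move=> E'; rewrite vis1 => ->; rewrite orbT.
      * by rewrite /m1; compute_mem.
    rewrite eN esz => C_pos.
    step. step. rewrite eN enx in E0; rewrite addn1 in E; subst v0 v.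
    set m1 := setv _ _ _.
    apply: wp_mono (enqueue_loop_ok idC _ _ _) => [m2 t2 [FV2 FA2 _] [t2_le it]|||]; last 3 first.
    + by rewrite /m1; compute_mem; rewrite enx epv ecl; apply: lists_ok R1.
    + by rewrite /m1; compute_mem; rewrite enx.
    + by rewrite /m1; compute_mem; lia.
    have edn : A m2 a_dn = upd (A m a_dn) C l.+1 by rewrite (FA2 a_dn isT).
    have efs : A m2 a_fs = A m a_fs by rewrite (FA2 a_fs isT).
    have etop : V m2 v_top = V m v_top by rewrite FV2.
    have est : V m2 v_st = (V m v_st).+1 by rewrite FV2.
    have ecl1 : A m1 a_cl = c1 by rewrite -ecl.
    have est1 : V m1 v_st = (V m v_st).+1 by [].
    rewrite ecl1 est1 -[items m1]/(items m) in it t2_le.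
    have [vis2 dn2] := mark m2 edn.
    have queued2 y : y <= n -> queued m2 y = queued m y || (c1 y == C).
      move=> yn; rewrite /queued vis2; case: (eqVneq (c1 y) C) => [ey|] /=; last by rewrite orbF.
      by rewrite orbT C_small.
    split.
    + split.
      * exact: dn2.
      * have [uq H] := vi_free I; rewrite efs etop; split=> // E.
        rewrite H vis2; case: (eqVneq E C) => [->|//].
        by rewrite -size_eq0; case: (size _) C_pos.
      * rewrite it pairwise_cat (vi_before I) /= andbC; apply/andP; split.
          rewrite pairwise_map.
          apply: (@sub_in_pairwise _ [pred y | (0 < y) && (c1 y == C)] ltn).
          - move=> y z /andP[y0 /eqP ey] /andP[z0 /eqP ez] /= yz.
            by rewrite /before /= !prednK // ey ez !eqxx leqnn /=; lia.
          - apply/allP => y; rewrite mem_filter mem_members.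
            by move=> /andP[/= -> /andP[->]].
          by apply: pairwise_filter; rewrite -(sorted_pairwise ltn_trans) members_sorted.
        apply/allrelP => p p'; move=> /(vi_item I)[p1 p2 p3] /mapP[y].
        rewrite mem_filter mem_members => /andP[y0 /andP[/eqP ey yn]] -> /=.
        have neq : c1 p.1.+1 != C.
          by case/andP: p3 => p3 _; apply: contraTneq p3 => ->; rewrite nvC.
        have lt : p.2 < (V m v_st).+1 by case/andP: p2.
        rewrite /before /= (prednK y0) ey (negbTE neq) (ltnW lt) (ltn_eqF lt) /= andbT.
        apply: contra neq => /eqP ->; by rewrite prednK // ey.
      * move=> p; rewrite it mem_cat => /orP[/(vi_item I)[p1 p2 p3]|/mapP[y]].
          by rewrite est queued2 // p3; split=> //; lia.
        rewrite mem_filter mem_members => /andP[y0 /andP[/eqP ey yn]] -> /=.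
        rewrite est (prednK y0) queued2 // ey eqxx orbT; split=> //.
        by have := vi_base I; lia.
      * move=> y yr; rewrite queued2; last by case/andP: yr.
        rewrite it /unzip1 map_cat mem_cat => /orP[/(vi_queued I yr) -> //|/eqP ey].
        apply/orP; right; apply/mapP; exists (y.-1, (V m v_st).+1) => //.
        apply: map_f; rewrite mem_filter mem_members ey eqxx; exact: yr.
      * rewrite (e_count m2) //.
        have := congr1 size it; rewrite size_cat /items !size_mkseq size_map => ->.
        have : size [seq y <- members n c1 C | 0 < y] <= size (members n c1 C).
          by rewrite [leqLHS]size_filter count_size.
        by have := vi_count I; lia.
      by rewrite est; have := vi_base I; lia.
    + by rewrite vis2 eqxx.
    + by move=> E; rewrite vis2 => ->; rewrite orbT.
    + by rewrite est.
    by rewrite (e_count m2) //; lia.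
  rewrite eN eD eos esz => big_C; step.
  have C_full : members n c1 C != [::].
    by move: big_C; case: members => //; rewrite muln0.
  set m1 := seta _ _ _ _; have [vis1 dn1] := mark m1 (erefl _).
  have queued1 y : y <= n -> queued m1 y = queued m y.
    move=> yn; rewrite /queued vis1; case: (eqVneq (c1 y) C) => [ey|//] /=.
    by rewrite small_C // (negbTE big_C) andbF.
  split.
  - apply: keep => //; have [uq H] := vi_free I.
    split=> // E; rewrite H vis1; case: (eqVneq E C) => [->|//].
    by rewrite (negbTE C_full).
  - by rewrite vis1 eqxx.
  - by move=> E; rewrite vis1 => ->; rewrite orbT.
  - by rewrite /m1.
  rewrite (_ : queued_count m1 = queued_count m) //; first by lia.
  by apply: eq_in_count => y; rewrite mem_iota => yr; rewrite queued1 //; lia.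
by rewrite eN evl -ltnNge => vis; step; split=> //; lia.
Qed.

Lemma visit_step_ok j m : j < M -> framed (For v_k v_m visit_step) m0 m ->
  V m v_k = j -> V m v_st <= base + 2 * j -> visit_inv m ->
  wp visit_step (fun m' t => [/\ visit_inv m',
    visited m' (c0 (qo j)) /\ visited m' (c1 (qo j)),
    forall E, visited m E -> visited m' E,
    V m' v_st <= base + 2 * j.+1 &
    t + 8 * queued_count m <= 31 + 8 * queued_count m']) m.
Proof.
move=> jM F ek st_le I; have [FV FA _] := F; have Mn' := Mn.
have eoc : A m a_oc = A m0 a_oc := FA a_oc isT.
have enc : A m a_nc = A m0 a_nc := FA a_nc isT.
have idD : is_id n (c0 (qo j)) by apply: id0; apply: ltnW; apply: qon.
have idN : is_id n (c1 (qo j)) by apply: (cls_id R1); apply: ltnW; apply: qon.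
rewrite /visit_step; step. step. subst v0.
rewrite ek eoc ocE // in E; subst v; apply: wp_seq.
set m1 := setv _ _ _.
have F1 : framed (For v_k v_m visit_step) m0 m1 by do 2 apply: framed_setv => //.
have I1 : visit_inv m1 by apply: visit_inv_ext I.
have st1 : V m1 v_st <= base + 2 * n by rewrite -[V m1 _]/(V m v_st); lia.
apply: wp_mono (visit_ok jM (or_introl erefl) idD F1 erefl erefl st1 I1).
move=> m2 t2 F2 [I2 vD2 mono2 st2 t2_le].
have [FV2 FA2 _] := F2.
have ek2 : V m2 v_k = j by rewrite FV2.
have enc2 : A m2 a_nc = A m0 a_nc by rewrite (FA2 a_nc isT).
step.
rewrite enc2 ek2 ncE // in E; subst v.
set m3 := setv _ _ _.
have F3 : framed (For v_k v_m visit_step) m0 m3.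
  apply: framed_setv => //; apply: framed_trans F1 _.
  by apply: framed_sub F2 => //; apply/allP.
have I3 : visit_inv m3 by apply: visit_inv_ext I2.
have st3 : V m3 v_st <= (V m v_st).+1 by [].
have eD3 : V m3 v_D = c0 (qo j) by rewrite -[LHS]/(V m2 v_D) FV2.
have st3' : V m3 v_st <= base + 2 * n by lia.
apply: wp_mono (visit_ok jM (or_intror erefl) idN F3 eD3 erefl st3' I3).
move=> m4 t4 F4 [I4 vD4 mono4 st4 t4_le].
split=> //.
- by split=> //; apply: mono4.
- by move=> E vE; apply: mono4; apply: mono2.
- by rewrite -[V m3 v_st]/(V m2 v_st) in st4; rewrite -[V m1 v_st]/(V m v_st) in st2; lia.
rewrite -[queued_count m1]/(queued_count m) in t2_le.
by rewrite -[queued_count m3]/(queued_count m2) in t4_le; lia.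
Qed.

Lemma visit_inv0 m : A m = A m0 -> V m v_top = V m0 v_top -> V m v_m' = 0 ->
  V m v_st = base -> visit_inv m.
Proof.
move=> eA etop em' est.
have nv D : is_id n D -> visited m D = false.
  by move=> idD; rewrite /visited eA; apply/negbTE; rewrite -leqNgt dn0.
split; rewrite /items ?em' ?est //.
- by move=> D /dn0; rewrite eA => /leqW.
- have [uq H] := free0; rewrite eA etop; split=> // D; rewrite H.
  by case idD: (is_id n D) => //=; rewrite nv // orbF.
move=> y yn; rewrite /queued nv //; apply: (cls_id R1).
by case/andP: yn.
Qed.

Lemma visit_loop_ok : V m0 v_m' = 0 -> wp (For v_k v_m visit_step)
  (fun m t => [/\ visit_inv m, t <= 33 * M + 2 + 8 * queued_count m,
     forall j, j < M -> visited m (c0 (qo j)) /\ visited m (c1 (qo j)) &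
     V m v_st <= base + 2 * M]) m0.
Proof.
move=> em'; have Mn' := Mn; have big' := big.
pose J j t m := [/\ visit_inv m, t <= 33 * j + 8 * queued_count m,
     forall i, i < j -> visited m (c0 (qo i)) /\ visited m (c1 (qo i)) &
     V m v_st <= base + 2 * j].
apply: (@wp_for _ _ _ _ _ _ _ J M) => //.
- by lia.
- by lia.
- by split=> //; [apply: visit_inv0|rewrite addn0].
- by move=> m [FV _ _]; rewrite /= FV.
- move=> j t m F jM ek [I t_le vis st_le].
  apply: wp_mono (visit_step_ok jM F ek st_le I) => m' t' _ [I' vis' mono st' t'_le].
  split=> //.
  + exact: visit_inv_ext I'.
  + by rewrite -[queued_count (setv _ _ _)]/(queued_count m'); lia.
  move=> i; rewrite ltnS leq_eqVlt => /orP[/eqP ->//|ij].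
  by have [v1 v2] := vis i ij; split; apply: mono.
by move=> t m F em [I t_le vis st_le]; split=> //; lia.
Qed.

(** A small class is separated from some member [z] of its parent. If [y] was moved, its new class
    was visited. Otherwise it still has the old name, and [z] must have been moved out of that
    class, which was therefore visited. *)
Lemma visited_small m y :
  (forall j, j < M -> visited m (c0 (qo j)) /\ visited m (c1 (qo j))) ->
  y <= n -> small w l y -> visited m (c1 y).
Proof.
move=> vis yn sm; case: (boolP (y \in mkseq qo M)) => [/mem_mkseqP[j jM ->]|y_old].
  by case: (vis j jM).
have [z [zn e ne]] : exists z, [/\ z <= n, eqv w l y z & ~~ eqv w l.+1 y z].
  have := class_size_gt0 l.+1 yn; move: sm; rewrite /small => sm pos.
  case: (boolP (has (fun z => eqv w l y z && ~~ eqv w l.+1 y z) (iota 0 n.+1))).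
    by move=> /hasP[z]; rewrite mem_iota => zr /andP[e ne]; exists z; split=> //; lia.
  move=> /hasPn H; suff : class_size w l y <= class_size w l.+1 y by lia.
  apply: eq_leq; apply: eq_in_count => z z_in; have := H z z_in.
  rewrite negb_and negbK => ne; apply/idP/idP => [e|]; first by rewrite e in ne.
  exact: eqv_leq.
have ecz : c0 y = c0 z by apply/eqP; rewrite c0E.
rewrite c1_old // ecz; case: (boolP (z \in mkseq qo M)) => [/mem_mkseqP[j jM ->]|z_old].
  by case: (vis j jM).
by case/negP: ne; rewrite -(clsE R1) // -/c1 !c1_old // ecz.
Qed.

(** For positions that agree up to length [l.+1], agreement up to [l.+2] is agreement of the
    successors up to [l.+1], which the stamps record. The last clause combines [small_split] with
    the fact that smallness depends only on the class of the successor. *)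
Lemma queue_next m : visit_inv m ->
  (forall j, j < M -> visited m (c0 (qo j)) /\ visited m (c1 (qo j))) ->
  queue_ok w l.+1 (V m v_m') (A m a_q) (A m a_gs) base (V m v_st).
Proof.
move=> I vis; set K := V m v_m'; set q := A m a_q; set gs := A m a_gs.
have nth_items j : j < K -> nth (0, 0) (items m) j = (q j, gs j).
  by move=> jK; rewrite nth_mkseq.
have size_items : size (items m) = K by rewrite size_mkseq.
have item j : j < K -> [/\ q j < n, base < gs j <= V m v_st & queued m (q j).+1].
  move=> jK; have : (q j, gs j) \in items m by rewrite -nth_items // mem_nth // size_items.
  by move=> /(vi_item I).
have bef i j : i < j < K -> before (q i, gs i) (q j, gs j).
  move=> /andP[ij jK]; have iK := ltn_trans ij jK.
  have /(pairwiseP (0, 0)) H := vi_before I.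
  by have := H i j; rewrite !inE size_items !nth_items //; apply.
have c1S i j : i < K -> j < K ->
    (c1 (q i).+1 == c1 (q j).+1) = eqv w l.+1 (q i).+1 (q j).+1.
  move=> iK jK; rewrite (clsE R1) //; first by case: (item _ iK).
  by case: (item _ jK).
have e_split x y : eqv w l.+1 x y -> eqv w l.+1 x.+1 y.+1 = eqv w l.+2 x y.
  by move=> e; apply/idP/idP; [apply: eqvS|apply: eqv_behead].
have in_q x : x <= n -> (x \in mkseq q K) = (x < n) && small w l x.+1.
  move=> xn; apply/idP/idP => [/mem_mkseqP[j jK ->]|/andP[xn' sm]].
    by have [-> _ /andP[_ ->]] := item j jK.
  have := vi_queued I (y := x.+1); rewrite /queued (visited_small vis) // sm.
  move=> /(_ _ isT) /=; rewrite xn' => /(_ isT).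
  by rewrite /unzip1 /items /mkseq -map_comp.
split.
- by move=> j /item[].
- move=> i j ij; have /and4P[/= neq le e lt] := bef i j ij; case/andP: (ij) => lt_ij jK.
  split=> // e2; have iK := ltn_trans lt_ij jK.
  move: lt; rewrite (eqP e) c1S // (e_split _ _ (eqv_leq (leqnSn _) e2)) e2; exact.
- by move=> j /item[].
- move=> i j iK jK e1; rewrite -e_split // -c1S //.
  case: (ltngtP i j) => [ij|ji|->].
  + by have /and4P[/= _ _ /eqP] := bef i j (introT andP (conj ij jK)).
  + have /and4P[/= _ _ /eqP] := bef j i (introT andP (conj ji iK)).
    by rewrite eq_sym => ->; rewrite eq_sym.
  by rewrite !eqxx.
move=> x y xn yn e; rewrite !in_q // => x_notin.
(* The empty suffix [n] is never queued and is alone in its class, while [small_split] asks for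
   positions inside [w]. *)
case: (ltngtP x n) => [xn'|gt|exn]; last 2 first.
- by move: gt; rewrite ltnNge xn.
- by subst x; have -> := eqv_end yn e; rewrite eqv_refl ltnn.
case: (ltngtP y n) => [yn'|gt|eyn]; last 2 first.
- by move: gt; rewrite ltnNge yn.
- by subst y; rewrite eqv_sym in e; rewrite (eqv_end xn e) ltnn in xn'.
rewrite xn' /= in x_notin; case sy: (small w l y.+1) => /=; last first.
  by apply: small_split => //; apply/negbTE.
apply/negbTE/negP => /eqv_behead e2; move: x_notin sy.
by rewrite /small (eq_class_size e2) (eq_class_size (eqv_leq (leqnSn _) e2)) => /negbTE ->.
Qed.

End VisitLoop.
End Visit.

(** * Rounds *)

Section Rounds.
Variable k : nat.
Variables (d : Order.disp_t) (T : orderType d) (w : seq (Equality.sort T)).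
Notation n := (@size (Equality.sort T) w).
Notation wp := (wp k w).
Hypothesis big : 64 * n.+1 * n.+1 <= wlimit k w.

Lemma refines_ext l m m' : A m' a_nx = A m a_nx -> A m' a_pv = A m a_pv ->
  A m' a_cl = A m a_cl -> A m' a_sz = A m a_sz -> refines w l m -> refines w l m'.
Proof. by move=> e1 e2 e3 e4 []; split; rewrite ?e1 ?e2 ?e3 ?e4. Qed.

(** [79 = 5 + 27 + 14 + 33] adds the costs per queued position of the four loops; their fixed parts
    and two assignments make up the [10]. Building the next queue is paid for through
    [potential_drop]. *)
Lemma round_ok l base m0 : l < n -> V m0 v_l = l -> round_start w l base m0 ->
  wp round (fun m t => [/\ round_start w l.+1 (V m0 v_st) m,
    V m v_m + potential w l.+1 <= potential w l &
    t + 8 * potential w l.+1 <= 79 * V m0 v_m + 10 + 8 * potential w l]) m0.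
Proof.
move=> ln el [R0 free0 ox0 sg0 Q0 dn0 out0 base0 st0].
set M := V m0 v_m in Q0 *; set q := A m0 a_q in Q0 *; set c0 := A m0 a_cl in free0 *.
have Mn := queue_leq Q0.
have qn : forall j, j < M -> q j < n by case: Q0.
have id0 := cls_id R0.
rewrite /round; apply: wp_seq.
apply: wp_mono (save_loop_ok big Mn qn id0) => m1 t1 [FV1 FA1 FO1] [t1_le saved].
have R1 : refines w l m1 by apply: refines_ext R0; apply: FA1.
have ecl1 : A m1 a_cl = c0 by apply: FA1.
have efs1 : A m1 a_fs = A m0 a_fs by apply: FA1.
have etop1 : V m1 v_top = V m0 v_top by apply: FV1.
have em1 : V m1 v_m = M by apply: FV1.
have est1 : V m1 v_st = V m0 v_st by apply: FV1.
have eq1 : A m1 a_q = q by apply: FA1.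
have egs1 : A m1 a_gs = A m0 a_gs by apply: FA1.
have enx1 : A m1 a_nx = A m0 a_nx by apply: FA1.
have eox1 : A m1 a_ox = A m0 a_ox by apply: FA1.
have esg1 : A m1 a_sg = A m0 a_sg by apply: FA1.
have edn1 : A m1 a_dn = A m0 a_dn by apply: FA1.
have Q1 : queue_ok w l (V m1 v_m) (A m1 a_q) (A m1 a_gs) base (V m1 v_st).
  by rewrite em1 eq1 egs1 est1.
apply: wp_seq; apply: wp_mono (move_loop_ok big R1 _ _ Q1 _) => [m2 t2 F2 [t2_le I2]|||];
  last 3 first.
- by rewrite ecl1 efs1 etop1.
- by rewrite esg1.
- by rewrite eox1 enx1.
have [FV2 FA2 FO2] := F2.
have R2 := refines_next R1 Q1 I2.
have em2 : V m2 v_m = M by rewrite FV2.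
have eq2 : A m2 a_q = q by rewrite (FA2 a_q isT).
have eox2 : A m2 a_ox = A m0 a_ox by rewrite (FA2 a_ox isT).
have el2 : V m2 v_l = l by rewrite FV2 // FV1.
have est2 : V m2 v_st = V m0 v_st by rewrite FV2.
rewrite em1 in I2 t2_le.
apply: wp_seq.
apply: wp_mono (@emit_loop_ok k d T w big l m2 R2 ln el2 _ _ _ _ _ _) => [m3 t3 F3 [t3_le em3]||||||];
  last 6 first.
- by move=> i i_n; rewrite eox2 ox0 // (refines_nxt R0).
- by move=> i i_n; rewrite FO2 // FO1 // out0.
- by rewrite em2.
- by rewrite em2 eq2.
- by rewrite em2; apply: mi_pq I2.
- move=> i i_n; have := mi_nx I2 i_n; rewrite em2 eq2 eox2 eox1 eq1.
  by case=> [|[j jM ij]]; [left|right; exists j].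
rewrite em2 in t3_le.
have [FV3 FA3 FO3] := F3.
apply: wp_seq; apply: wp_assign => [|v Ev]; first by have := big; rewrite /=; lia.
have {}Ev : v = 0 by []; subst v.
set m4 := setv _ _ _.
have em4 : V m4 v_m = M by rewrite [LHS]FV3.
have ecl4 : A m4 a_cl = A m2 a_cl by apply: (FA3 a_cl isT).
have est4 : V m4 v_st = V m0 v_st by rewrite -est2; apply: FV3.
have R4 : refines w l.+1 m4.
  apply: refines_ext R2; rewrite -[A m4]/(A m3); by [rewrite (FA3 a_nx isT)|rewrite (FA3 a_pv isT)|rewrite (FA3 a_cl isT)|rewrite (FA3 a_sz isT)].
have el4 : V m4 v_l = l by rewrite -el2; apply: FV3.
have eoc4 : A m4 a_oc = A m1 a_oc.
  by rewrite -[A m4]/(A m3) (FA3 a_oc isT) (FA2 a_oc isT).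
have eos4 : A m4 a_os = A m1 a_os.
  by rewrite -[A m4]/(A m3) (FA3 a_os isT) (FA2 a_os isT).
have enc4 : A m4 a_nc = A m2 a_nc by apply: (FA3 a_nc isT).
have edn4 : A m4 a_dn = A m0 a_dn.
  by rewrite -[A m4]/(A m3) (FA3 a_dn isT) (FA2 a_dn isT).
have efs4 : A m4 a_fs = A m2 a_fs by apply: (FA3 a_fs isT).
have etop4 : V m4 v_top = V m2 v_top by apply: FV3.
have c1_old x : x <= n -> x \notin mkseq q M -> A m2 a_cl x = c0 x.
  by rewrite -ecl1 -eq1; apply: (mi_old I2).
have c1_new j y : j < M -> y <= n -> A m2 a_cl (q j) != c0 y.
  by rewrite -ecl1 -eq1; apply: (mi_new I2).
apply: wp_seq.
have V4 := @visit_loop_ok k d T w big l m4 c0 q R4 ln el4 id0 (clsE R0).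
rewrite em4 ecl4 est4 in V4.
apply: wp_mono (V4 Mn qn _ _ _ c1_old c1_new _ _ st0 (erefl _)) => [m5 t5 F5 [I5 t5_le vis5 st5]|||||];
  last 5 first.
- by move=> j jM; rewrite eoc4; case: (saved j jM).
- by move=> j jM; rewrite eos4; have [_ ->] := saved j jM; rewrite (size_ok R0) //; apply: id0; apply: ltnW; apply: qn.
- by move=> j jM; rewrite enc4 (mi_nc I2) // eq1.
- by rewrite edn4.
- by rewrite efs4 etop4 -ecl1; apply: mi_free I2.
have [FV5 FA5 FO5] := F5.
apply: wp_assign => // v Ev; have {}Ev : v = V m5 v_m' by []; subst v.
set m6 := setv _ _ _.
have count_le : queued_count w l m4 m5 + potential w l.+1 <= potential w l.
  apply: leq_trans (potential_drop w l); rewrite leq_add2r.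
  by apply: sub_count => y /andP[].
split; last 2 first.
- by rewrite -[V m6 v_m]/(V m5 v_m'); have := vi_count I5; lia.
- by rewrite -/M; lia.
have ecl5 : A m5 a_cl = A m2 a_cl by rewrite (FA5 a_cl isT).
have emitted6 i : i <= n -> A m6 a_ox i = A m6 a_nx i /\ (i < n -> OUT m6 i = jumps w l.+1 i).
  move=> /em3[e1 e2]; rewrite -[A m6]/(A m5) -[OUT m6]/(OUT m5).
  rewrite (FA5 a_ox isT) (FA5 a_nx isT) FO5 // -[A m4]/(A m3) -[OUT m4]/(OUT m3).
  by rewrite e1 (FA3 a_nx isT).
split.
- by apply: refines_ext R4; rewrite -[A m6]/(A m5); apply: FA5.
- have [uq H] := vi_free I5; split=> // D; rewrite [LHS]H -[A m6]/(A m5) ecl5.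
  case: (boolP (is_id n D)) => //= idD; rewrite ecl4.
  case: (eqVneq (members n (A m2 a_cl) D) [::]) => //= empty.
  case: (eqVneq (members n c0 D) [::]) => //= full.
  (* An emptied old class had a member [y], which must have been moved; hence that class was visited
     and its name released. *)
  have /mapP[y] := members_neq0 full; rewrite mem_iota => yr ey.
  have yn : y <= n by lia.
  case: (boolP (y \in mkseq q M)) => [/mem_mkseqP[j jM eyj]|y_old].
    by have [vD _] := vis5 j jM; rewrite ey eyj.
  have : y \in members n (A m2 a_cl) D by rewrite mem_members c1_old // ey eqxx yn.
  by rewrite empty.
- by move=> i i_n; case: (emitted6 i i_n).
- move=> D idD; rewrite -[A m6]/(A m5) (FA5 a_sg isT) -[A m4]/(A m3) (FA3 a_sg isT).
  case: (mi_base I2 idD) => [|[j jM [_ ->]]]; first lia.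
  by rewrite egs1; case: Q0 => _ _ H _ _; case/andP: (H j jM).
- have Q5 := @queue_next k d T w big l m4 c0 q R4 ln el4 (clsE R0).
  rewrite em4 ecl4 est4 in Q5; rewrite -[A m6]/(A m5) -[V m6 v_m]/(V m5 v_m').
  by apply: Q5 => //; rewrite -?ecl4.
- by move=> D /(vi_dn I5).
- by move=> i i_n; case: (emitted6 i (ltnW i_n)) => _ ->.
- by have := vi_base I5; rewrite est4.
by rewrite -[V m6 _]/(V m5 v_st); lia.
Qed.

Lemma round_start_ext l base m m' : A m' = A m -> OUT m' = OUT m ->
  V m' v_top = V m v_top -> V m' v_m = V m v_m -> V m' v_st = V m v_st ->
  round_start w l base m -> round_start w l base m'.
Proof.
move=> eA eO e1 e2 e3 [R *]; split; rewrite ?eA ?eO ?e1 ?e2 ?e3 //.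
by apply: refines_ext R; rewrite eA.
Qed.

(** Amortization: a unit of potential pays [8] for queueing a position and [79] for processing it in
    the next round, hence [87]. A round adds [10] of its own and [2] of loop overhead. *)
Lemma rounds_ok base m0 : round_start w 0 base m0 ->
  wp (For v_l Len round) (fun m t => (forall i, i < n -> OUT m i = jumps w n i) /\
    t <= 12 * n + 79 * V m0 v_m + 87 * potential w 0 + 2) m0.
Proof.
move=> RS0; have big' := big.
pose J l t m := (exists base, round_start w l base m) /\
  t + 79 * V m v_m + 87 * potential w l <= 12 * l + 79 * V m0 v_m + 87 * potential w 0.
apply: (@wp_for _ _ _ _ _ _ _ J n) => //.
- by lia.
- by lia.
- split; last by [].
  by exists base; apply: round_start_ext RS0.
- by move=> m _; split=> //; compute_mem; lia.
- move=> l t m F ln el [[base' RS] t_le].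
  apply: wp_mono (round_ok ln el RS) => m' t' _ [RS' M'_le t'_le]; split.
    by exists (V m v_st); apply: round_start_ext RS'.
  by rewrite -[V (setv _ _ _) _]/(V m' v_m); lia.
by move=> t m F em [[base' RS] t_le]; split; [apply: rs_out RS|lia].
Qed.

End Rounds.

(** * Sorting the letters *)

Definition slice (f : nat -> nat) a b := [seq f i | i <- iota a (b - a)].

Lemma slice_nil f a b : b <= a -> slice f a b = [::].
Proof. by rewrite /slice => /eqP ->. Qed.

Lemma slice_cons f a b : a < b -> slice f a b = f a :: slice f a.+1 b.
Proof. by rewrite /slice => ab; rewrite -(prednK (_ : 0 < b - a)) ?subnS //; lia. Qed.

Lemma slice_rcons f a b : a <= b -> slice f a b.+1 = rcons (slice f a b) (f b).
Proof. by rewrite /slice => ab; rewrite subSn // -addn1 iotaD map_cat /= cats1 subnKC. Qed.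

Lemma size_slice f a b : size (slice f a b) = b - a.
Proof. by rewrite size_map size_iota. Qed.

Lemma eq_slice f g a b : (forall i, a <= i < b -> f i = g i) -> slice f a b = slice g a b.
Proof.
by move=> H; apply/eq_in_map => i; rewrite mem_iota => ir; apply: H; lia.
Qed.

Lemma slice_cat a b c : a <= b <= c -> slice id a b ++ slice id b c = slice id a c.
Proof.
by move=> H; rewrite /slice !map_id -[in RHS](subnKC (_ : b - a <= c - a)) ?iotaD; [congr (_ ++ iota _ _); lia|lia].
Qed.

Section Sort.
Variable k : nat.
Variables (d : Order.disp_t) (T : orderType d) (w : seq (Equality.sort T)).
Notation n := (@size (Equality.sort T) w).
Notation wp := (wp k w).

(* Positions outside [w] are made largest, which keeps the relation total. *)
Definition leL x y :=
  if onth w y is Some b then (if onth w x is Some a then (a <= b)%O else false) else true.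

(** Breaking ties by position gives the increasing groups that [queue_ok] demands. *)
Definition lePos x y := leL x y && (leL y x ==> (x <= y)).

Lemma leL_total : total leL.
Proof. by move=> x y; rewrite /leL; case: onth; case: onth => // *; apply: Order.TotalTheory.le_total. Qed.

Lemma leL_trans : transitive leL.
Proof.
move=> y x z; rewrite /leL; case: (onth w z) => // c; case: (onth w y) => // b.
by case: (onth w x) => // a; apply: Order.POrderTheory.le_trans.
Qed.

Lemma lePos_total : total lePos.
Proof. by move=> x y; rewrite /lePos; have := leL_total x y; case: leL; case: leL => //=; lia. Qed.

Lemma lePos_trans : transitive lePos.
Proof.
move=> y x z /andP[xy /implyP yx] /andP[yz /implyP zy].
rewrite /lePos (leL_trans xy yz); apply/implyP => zx.
by apply: leq_trans (yx (leL_trans yz zx)) (zy (leL_trans zx xy)).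
Qed.

Lemma leL_letter x y : x < n -> y < n -> letter_le w x.+1 y.+1 = leL x y.
Proof.
move=> /(letter_def (i := x.+1)) lx /(letter_def (i := y.+1)) ly; move: lx ly.
by rewrite /letter_le /leL /letter; case: onth; case: onth.
Qed.

Lemma eqv1_leL x y : x < n -> y < n -> eqv w 1 x y = leL x y && leL y x.
Proof.
move=> xn yn; have [a0 _] : exists a : T, True by case: (w) xn => // a; exists a.
rewrite (eqv1 a0) // /leL !(onth_lt a0) //.
by rewrite Order.POrderTheory.eq_le.
Qed.

Hypothesis big : 64 * n.+1 * n.+1 <= wlimit k w.

Definition merged h (q tmp : nat -> nat) c :=
  slice tmp (c * h.*2) (minn (c * h.*2 + h.*2) n) =
  merge lePos (slice q (c * h.*2) (minn (c * h.*2 + h) n))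
              (slice q (c * h.*2 + h) (minn (c * h.*2 + h.*2) n)).

(** Each block permutes its own range of positions. So the positions in a left block are smaller
    than those in the right one, and preferring the left on equal letters agrees with [lePos]. *)
Definition block_sorted h (q : nat -> nat) := forall c,
  sorted lePos (slice q (c * h) (minn (c * h + h) n)) /\
  perm_eq (slice q (c * h) (minn (c * h + h) n)) (slice id (c * h) (minn (c * h + h) n)).

Lemma block_sorted_merged h q tmp : block_sorted h q ->
  (forall c, merged h q tmp c) -> block_sorted h.*2 tmp.
Proof.
move=> B Mg c; rewrite Mg; have [s1 p1] := B (2 * c); have [s2 p2] := B (2 * c).+1.
have e1 : 2 * c * h = c * h.*2 by rewrite mulnAC mulnC -mul2n mulnA.
have e2 : (2 * c).+1 * h = c * h.*2 + h by rewrite mulSn e1 addnC.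
have e3 : c * h.*2 + h + h = c * h.*2 + h.*2 by rewrite -addnn addnA.
rewrite e1 in s1 p1; rewrite e2 e3 in s2 p2.
split; first exact: merge_sorted lePos_total _ _ s1 s2.
rewrite perm_merge; apply: (perm_trans (perm_cat p1 p2)).
case: (leqP (c * h.*2 + h) n) => H.
  by rewrite slice_cat //; lia.
rewrite [X in _ ++ X]slice_nil ?cats0; last by lia.
by rewrite (_ : minn (c * h.*2 + h.*2) n = n) //; lia.
Qed.

Section MergePass.
Variables (h : nat) (m0 : memory).
Hypothesis (h_gt0 : 0 < h) (h_lt : h < n) (eh : V m0 v_h = h).
Let q := A m0 a_q.
Hypothesis (q_sorted : block_sorted h q).

Let q_block c i : c * h <= i < minn (c * h + h) n -> c * h <= q i < minn (c * h + h) n.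
Proof.
move=> ir; have [_ /perm_mem p] := q_sorted c.
have := p (q i); rewrite map_f; last by rewrite mem_iota; lia.
by rewrite /slice map_id mem_iota; lia.
Qed.

Let q_lt i : i < n -> q i < n.
Proof.
move=> i_n; have := @q_block (i %/ h) i; have := divn_eq i h; have := ltn_pmod i h_gt0.
by lia.
Qed.

(** [mg_eq] is in residual form: what has been written, followed by the merge of what is left, stays
    the merge of the full blocks. [v_mid] and [v_hi] may exceed [n], hence [minn]. *)
Record merging c (m : memory) : Prop := Merging {
  mg_hi : V m v_hi = c * h.*2 + h.*2;
  mg_mid : V m v_mid = c * h.*2 + h;
  mg_k : c * h.*2 <= V m v_k <= V m v_hi;
  mg_a : c * h.*2 <= V m v_a <= V m v_mid;
  mg_b : V m v_mid <= V m v_b <= V m v_hi;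
  mg_sum : V m v_k + V m v_mid = V m v_a + V m v_b;
  mg_eq : slice (A m a_tmp) (c * h.*2) (V m v_k) ++
    merge lePos (slice q (V m v_a) (minn (V m v_mid) n)) (slice q (V m v_b) (minn (V m v_hi) n)) =
    merge lePos (slice q (c * h.*2) (minn (c * h.*2 + h) n))
              (slice q (c * h.*2 + h) (minn (c * h.*2 + h.*2) n)) }.

(** The first alternative serves for the start, before any pair is opened; a finished pair remains
    in [merging] until the next one opens. *)
Definition pass_inv (m : memory) := exists c,
  (forall c', c' < c -> merged h q (A m a_tmp) c') /\
  ((V m v_hi = c * h.*2 /\ V m v_k = c * h.*2) \/ merging c m).

(** By counting lengths, nothing is left to merge once [v_k] has reached the end of the pair. *)
Lemma merging_done c m : V m v_k <= n ->
  minn (V m v_hi) n <= V m v_k -> merging c m -> merged h q (A m a_tmp) c.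
Proof.
move=> k_le hi_le [hi mid kr ar br sum eq].
rewrite /merged -eq; have e : V m v_k = minn (c * h.*2 + h.*2) n by lia.
have := congr1 size eq; rewrite size_cat !size_merge !size_cat !size_slice => es.
rewrite -e; set s1 := slice q (V m v_a) _ in es *; set s2 := slice q (V m v_b) _ in es *.
have : size (merge lePos s1 s2) = 0 by rewrite size_merge size_cat !size_slice; lia.
by move=> /size0nil ->; rewrite cats0.
Qed.

Lemma merge_step_ok m : framed (For v_k Len merge_step) m0 m -> V m v_k < n ->
  pass_inv m -> wp merge_step (fun m1 t => t <= 10 /\
    pass_inv (setv m1 v_k (V m v_k).+1)) m.
Proof.
move=> [FV FA _] kn [c [fin st]].
have eh1 : V m v_h = h by rewrite FV.
have eq1 : A m a_q = q := FA a_q isT.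
rewrite /merge_step; apply: wp_seq.
have mid_ok : wp (If (Eq v_k v_hi)
     (v_a <~ v_k ;; v_mid <~ v_k +' v_h ;; v_b <~ v_mid ;; v_hi <~ v_mid +' v_h) Skip)
   (fun m1 t => t <= 6 /\ exists c, [/\ forall c', c' < c -> merged h q (A m1 a_tmp) c',
      merging c m1 & V m1 v_k < V m1 v_hi]) m.
  have big' := big.
  have bounds : V m v_hi <= 4 * n.
    by case: st => [[hi kk]|[hi mid kr _ _ _ _]]; lia.
  step.
    move=> e_hi; step; step; step; step; split=> //.
    have ek : V m v_hi = V m v_k by lia.
    have [c1 [ck fin1]] : exists c1, V m v_k = c1 * h.*2 /\
        forall c', c' < c1 -> merged h q (A m a_tmp) c'.
      case: st => [[hi kk]|mg]; first by exists c.
      exists c.+1; rewrite mulSn addnC -(mg_hi mg); split=> // c'.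
      rewrite ltnS leq_eqVlt => /orP[/eqP ->|]; last exact: fin.
      apply: merging_done mg; lia.
    exists c1; split=> //; last by compute_mem; subst; lia.
    split; compute_mem; subst; rewrite ?eh1 ?ck; try lia.
    by rewrite [slice (A m _) _ _]slice_nil // -addnA addnn.
  move=> neq; step; split=> //; exists c; case: st => [[hi kk]|mg]; first by lia.
  by split=> //; have := mg_k mg; lia.
apply: wp_mono mid_ok => m1 t1 [FV1 FA1 _] [t1_le [c1 [fin1 mg k_hi]]].
have ek1 : V m1 v_k = V m v_k by rewrite FV1.
have eq2 : A m1 a_q = q by rewrite (FA1 a_q isT).
have [hi mid kr ar br sum eq] := mg.
set a := V m1 v_a in ar sum eq *; set b := V m1 v_b in br sum eq *.
have big' := big; have lo_le : c1 * h.*2 <= n by lia.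
have tmp_fin v c' : c' < c1 -> merged h q (upd (A m1 a_tmp) (V m1 v_k) v) c'.
  move=> c'c; rewrite /merged -(fin1 _ c'c); apply: eq_slice => i ir.
  have : c'.+1 * h.*2 <= c1 * h.*2 by rewrite leq_mul2r c'c orbT.
  by rewrite mulSn => H; rewrite upd_diff //; lia.
have tmp_k v : slice (upd (A m1 a_tmp) (V m1 v_k) v) (c1 * h.*2) (V m1 v_k).+1 =
    rcons (slice (A m1 a_tmp) (c1 * h.*2) (V m1 v_k)) v.
  rewrite slice_rcons ?upd_same; last by case/andP: kr.
  by congr rcons; apply: eq_slice => i ir; rewrite upd_diff //; lia.
have le1 : c1 * h.*2 = (2 * c1) * h by rewrite -mul2n mulnA [c1 * 2]mulnC.
have qa_bd : a < minn (V m1 v_mid) n -> q a < minn (V m1 v_mid) n.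
  by move=> an; have := @q_block (2 * c1) a; rewrite -le1 -mid; lia.
have qb_bd : b < minn (V m1 v_hi) n -> V m1 v_mid <= q b < n.
  have le2 : c1 * h.*2 + h = (2 * c1).+1 * h by rewrite mulSn -le1 addnC.
  by move=> bn; have := @q_block (2 * c1).+1 b; rewrite -le2 -mid; lia.
have qa_lt : a < n -> q a < n := @q_lt a.
have qb_lt : b < n -> q b < n := @q_lt b.
rewrite /take_right /Lt; step.
- rewrite eq2 -/a -/b; split=> // b_hi; split; first by split=> //; lia.
  move=> b_n; split=> // a_mid; have := @qa_lt; have := @qb_lt => qbl qal.
  have qa' : q a < n by apply: qal; lia.
  have qb' : q b < n by apply: qbl; lia.
  sides.
- rewrite eq2 -/a -/b => /and3P[b_hi b_n pick].
  have bn : b < minn (V m1 v_hi) n by lia.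
  step; rewrite -/b.
    sides.
  step; split; first by lia.
  rewrite eq2 -/b -ek1; exists c1; split; first exact: tmp_fin.
  right; split; compute_mem; rewrite -/a -/b ?E -/b ?eq2; try lia.
  rewrite tmp_k cat_rcons -eq [slice q b _]slice_cons // addn1.
  case: (ltnP a (minn (V m1 v_mid) n)) => an; last first.
    by rewrite [slice q a _]slice_nil.
  rewrite [slice q a _]slice_cons //= /lePos.
  have qan := qa_bd an; have qbn := qb_bd bn.
  move: pick; rewrite !addn1 leL_letter; [|lia|lia].
  have -> : V m1 v_mid <= a = false by lia.
  by rewrite /= => /negbTE ->.
rewrite eq2 -/a -/b => pick.
have an : a < minn (V m1 v_mid) n by lia.
step; rewrite -/a.
  sides.
step; split; first by lia.
rewrite eq2 -/a -ek1; exists c1; split; first exact: tmp_fin.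
right; split; compute_mem; rewrite -/a -/b ?E -/a ?eq2; try lia.
rewrite tmp_k cat_rcons -eq [slice q a _]slice_cons // addn1.
case: (ltnP b (minn (V m1 v_hi) n)) => bn; last first.
  by rewrite [slice q b _]slice_nil //=; case: (slice q a.+1 _).
have qan := qa_bd an; have qbn := qb_bd bn.
rewrite [slice q b _]slice_cons //= /lePos.
have : leL (q a) (q b).
  by rewrite -leL_letter; [move: pick; rewrite !addn1|lia|lia]; lia.
by move=> -> /=; rewrite (_ : q a <= q b) ?implybT //; lia.
Qed.

Lemma pass_inv_end m : V m v_k = n -> pass_inv m -> forall c, merged h q (A m a_tmp) c.
Proof.
move=> ek [c [fin st]] c'; case: (ltngtP c' c) => [|c'c|->]; first exact: fin.
- have H : n <= c' * h.*2.
    have : c.+1 * h.*2 <= c' * h.*2 by rewrite leq_mul2r c'c orbT.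
    by case: st => [[_ kk]|mg]; rewrite mulSn; [lia|have := mg_k mg; have := mg_hi mg; lia].
  by rewrite /merged !slice_nil //; lia.
case: st => [[_ kk]|mg]; first by rewrite /merged !slice_nil //; lia.
by apply: merging_done mg; lia.
Qed.

Lemma merge_pass_ok :
  wp merge_pass (fun m t => block_sorted h.*2 (A m a_q) /\ t <= 15 * n + 5) m0.
Proof.
have big' := big; rewrite /merge_pass; step.
set m1 := setv _ _ _.
have F1 : framed (For v_k Len merge_step) m0 m1.
  by apply: framed_setv => //; apply: framed_refl.
apply: wp_seq.
apply: (@wp_for_const _ _ _ _ 10 _ _ _ (fun j m => V m v_k = j /\ pass_inv m) n) => //.
- by lia.
- by lia.
- split=> //; exists 0; split=> //; left.
  by rewrite -[V _ _]/v -[V _ v_k]/0 E.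
- by move=> m _; split=> //; compute_mem; lia.
- move=> j m F jn ek [_ I].
  apply: wp_mono (merge_step_ok (framed_trans F1 F) _ I); last by rewrite ek.
  by move=> m' t' _ []; rewrite ek.
move=> t m F [ek I] t_le; have all_merged := pass_inv_end ek I.
pose J j m' := forall i, i < j -> A m' a_q i = A m a_tmp i.
apply: (@wp_for_const _ _ _ _ 1 _ _ _ J n) => //.
- by lia.
- by lia.
- by move=> m' _; split=> //; compute_mem; lia.
- move=> j m' [_ FA _] jn ek' Jj; have et : A m' a_tmp = A m a_tmp := FA a_tmp isT.
  step; split=> // i; compute_mem; rewrite et ek' ltnS leq_eqVlt => /orP[/eqP ->|ij].
    by rewrite upd_same.
  by rewrite upd_diff ?Jj // neq_ltn ij.
move=> t' m' _ Jn t'_le; split; last by lia.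
have B := block_sorted_merged q_sorted all_merged.
move=> c; rewrite (eq_slice (g := A m a_tmp)); first exact: B.
by move=> i ir; apply: Jn; lia.
Qed.

End MergePass.

Lemma merge_sort_ok m0 :
  wp merge_sort (fun m t => [/\ sorted lePos (mkseq (A m a_q) n),
    perm_eq (mkseq (A m a_q) n) (iota 0 n) &
    t <= 3 * n + 4 + (trunc_log 2 n).+1 * (15 * n + 7)]) m0.
Proof.
have big' := big; rewrite /merge_sort; apply: wp_seq.
pose J0 j (m : memory) := forall i, i < j -> A m a_q i = i.
apply: (@wp_for_const _ _ _ _ 1 _ _ _ J0 n) => //.
- by lia.
- by lia.
- by move=> m _; split=> //; compute_mem; lia.
- move=> j m _ jn ek Jj; step; split=> // i; compute_mem.
  rewrite ek ltnS leq_eqVlt => /orP[/eqP ->|ij]; first by rewrite upd_same.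
  by rewrite upd_diff ?Jj // neq_ltn ij.
move=> t m1 _ J1 t_le; step.
set m2 := setv _ _ _.
pose I r (m : memory) u := exists p, [/\ block_sorted (2 ^ p) (A m a_q), V m v_h = 2 ^ p,
  r = n - 2 ^ p, u <= p * (15 * n + 7) & p <= (trunc_log 2 n).+1].
apply: (@wp_while _ _ _ _ _ _ I (n - 1)).
- exists 0; split=> // c; rewrite expn0 muln1.
  have -> : slice (A m2 a_q) c (minn (c + 1) n) = slice id c (minn (c + 1) n).
    by apply: eq_slice => i ir; apply: J1; lia.
  split=> //; rewrite /slice map_id.
  case E1: (minn (c + 1) n - c) => [|[|r]] //; lia.
- by move=> r m u _ _; compute_mem; split=> //; lia.
- move=> r m u _ [p [B eh er u_le p_le]]; compute_mem; rewrite eh -ltnNge => h_lt.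
  have h_gt0 : 0 < 2 ^ p by rewrite expn_gt0.
  apply: wp_seq; apply: wp_mono (merge_pass_ok h_gt0 h_lt eh B) => m' t' [FV _ _] [B' t'_le].
  have eh' : V m' v_h = 2 ^ p by rewrite FV.
  have eS : 2 ^ p.+1 = (2 ^ p).*2 by rewrite expnS mul2n.
  step; exists (n - 2 ^ p.+1); first by rewrite er eS; lia.
  exists p.+1; split=> //.
  + by rewrite eS.
  + by rewrite -[V _ _]/v0 E0 eh' eS addnn.
  + by rewrite mulSn; lia.
  by rewrite ltnS trunc_log_max // ltnW.
move=> r m u _ [p [B eh er u_le p_le]]; compute_mem; rewrite eh negbK => h_ge.
have [s0 p0] := B 0; rewrite mul0n add0n (minn_idPr h_ge) /slice subn0 in s0 p0.
split=> //; first by rewrite map_id in p0.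
have : p * (15 * n + 7) <= (trunc_log 2 n).+1 * (15 * n + 7) by rewrite leq_mul2r p_le orbT.
by lia.
Qed.

End Sort.

(** * Initialization *)

Section Init.
Variable k : nat.
Variables (d : Order.disp_t) (T : orderType d) (w : seq (Equality.sort T)).
Notation n := (@size (Equality.sort T) w).
Notation wp := (wp k w).
Hypothesis big : 64 * n.+1 * n.+1 <= wlimit k w.

Lemma init_lists_ok m0 : (forall D, A m0 a_sz D = 0) ->
  wp init_lists (fun m t => [/\ refines w 0 m,
    free_list w (fun D => members n (A m a_cl) D == [::]) (A m a_fs) (V m v_top),
    forall x, x <= n -> A m a_ox x = A m a_nx x & t <= 100 * n.+1]) m0.
Proof.
move=> sz0; have big' := big; rewrite /init_lists; apply: wp_seq.
pose J1 j (m : memory) := forall i, i < j -> A m a_nx i = i /\ A m a_pv i = i.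
apply: (@wp_for_const _ _ _ _ 2 _ _ _ J1 (4 * n.+1)) => //.
- by lia.
- by lia.
- by move=> m _; compute_mem; rewrite addn1; sides.
- move=> j m _ jn ek Jj; step. step. split=> // i; compute_mem.
  rewrite ek ltnS leq_eqVlt => /orP[/eqP ->|ij]; first by rewrite !upd_same.
  by rewrite !upd_diff ?neq_ltn ?ij //; apply: Jj.
move=> t1 m1 F1 J1' t1_le; apply: wp_seq.
pose J2 j (m : memory) := forall i, i < j -> A m a_fs i = i + n + 2.
apply: (@wp_for_const _ _ _ _ 1 _ _ _ J2 (3 * n + 2)) => //.
- by lia.
- by lia.
- by move=> m _; compute_mem; sides.
- move=> j m _ jn ek Jj; step. split=> // i; compute_mem.
  rewrite ek ltnS leq_eqVlt => /orP[/eqP ->|ij]; first by rewrite !upd_same.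
  by rewrite !upd_diff ?neq_ltn ?ij //; apply: Jj.
move=> t2 m2 F2 J2' t2_le; apply: wp_seq.
pose J3 j (m : memory) := [/\
  forall i, i < array_size n -> A m a_nx i = if i < j then i.+1 else i,
  forall i, i.+1 < array_size n -> A m a_pv i.+1 = if i < j then i else i.+1 &
  forall i, i < j -> A m a_cl i = n.+1 /\ A m a_ox i = i.+1].
apply: (@wp_for_const _ _ _ _ 4 _ _ _ J3 n.+1) => //.
- by lia.
- by lia.
- have [_ FA2 _] := F2; have enx2 : A m2 a_nx = A m1 a_nx := FA2 a_nx isT.
  have epv2 : A m2 a_pv = A m1 a_pv := FA2 a_pv isT.
  split=> // i i_lt; compute_mem; rewrite ?enx2 ?epv2.
    by case: (J1' i i_lt).
  by case: (J1' i.+1 i_lt).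
- by move=> m _; compute_mem; rewrite -addn1; sides.
- move=> j m _ jn ek [j1 j2 j3]; step. step. step. step. split=> //; split; compute_mem.
  + move=> i i_lt; rewrite ek addn1 /upd ltnS leq_eqVlt; case: eqP => [->|_] //=; exact: j1.
  + move=> i i_lt; rewrite ek addn1 /upd eqSS ltnS leq_eqVlt; case: eqP => [->|_] //=; exact: j2.
  move=> i; rewrite ek !addn1 ltnS leq_eqVlt => /orP[/eqP ->|ij]; first by rewrite !upd_same.
  by rewrite !upd_diff ?neq_ltn ?ij //; apply: j3.
move=> t3 m3 F3 [j1 j2 j3] t3_le.
have fs3 i : i < 3 * n + 2 -> A m3 a_fs i = i + n + 2.
  by move=> i_lt; have [_ FA3 _] := F3; rewrite (FA3 a_fs isT); apply: J2'.
have sz3 D : A m3 a_sz D = 0.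
  have [_ FA3 _] := F3; have [_ FA2 _] := F2; have [_ FA1 _] := F1.
  by rewrite (FA3 a_sz isT) (FA2 a_sz isT) (FA1 a_sz isT).
step. step. step. step.
set m4 := setv _ _ _.
have enx i : i < array_size n -> A m4 a_nx i = if i <= n then i.+1 else if i == n.+1 then 0 else i.
  move=> i_lt; rewrite /m4; compute_mem; rewrite addn1 /upd; case: eqP => [->|_]; first by rewrite ltnn.
  by rewrite j1.
have epv i : i.+1 < array_size n -> A m4 a_pv i.+1 = if i <= n then i else i.+1.
  by move=> i_lt; rewrite /m4; compute_mem; rewrite /upd /= j2.
have epv0 : A m4 a_pv 0 = n.+1 by rewrite /m4; compute_mem; rewrite addn1 upd_same.
have ecl i : i <= n -> A m4 a_cl i = n.+1.
  by move=> i_n; rewrite /m4; compute_mem; case: (j3 i i_n).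
have esz D : A m4 a_sz D = if D == n.+1 then n.+1 else 0.
  by rewrite /m4; compute_mem; rewrite addn1 /upd sz3.
have eox i : i <= n -> A m4 a_ox i = i.+1.
  by move=> i_n; rewrite /m4; compute_mem; case: (j3 i i_n).
have efs i : i < 3 * n + 2 -> A m4 a_fs i = i + n + 2 by apply: fs3.
have etop : V m4 v_top = 3 * n + 2 by rewrite -E.
suff H : [/\ refines w 0 m4,
    free_list w (fun D => members n (A m4 a_cl) D == [::]) (A m4 a_fs) (V m4 v_top) &
    forall x, x <= n -> A m4 a_ox x = A m4 a_nx x].
  by case: H => H1 H2 H3; split=> //; lia.
clearbody m4.
have mem0 D : members n (A m4 a_cl) D = if D == n.+1 then iota 0 n.+1 else [::].
  rewrite /members; case: (eqVneq D n.+1) => [->|Dn].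
    apply/all_filterP/allP => y; rewrite mem_iota => yr; rewrite ecl //; lia.
  rewrite -(filter_pred0 (iota 0 n.+1)); apply: eq_in_filter => y; rewrite mem_iota => yr.
  by rewrite ecl 1?eq_sym ?(negbTE Dn) //; lia.
split.
- split.
  + by move=> x xn; rewrite ecl // /is_id /array_size; lia.
  + by move=> x y xn yn; rewrite !ecl // eqxx eqv0.
  + move=> D idD; rewrite mem0; case: (eqVneq D n.+1) => [->|Dn]; last first.
      case/andP: idD => D_gt D_lt; case: D D_gt D_lt Dn => // D D_gt D_lt Dn.
      have D_gt' : n < D by move: Dn; rewrite eqSS; lia.
      by rewrite /= /linked enx // epv // leqNgt D_gt /= (negbTE Dn) leqNgt D_gt' !eqxx.
    (* Closing the cycle at the sentinel [n.+1] makes the sequence of link targets [iota 0 n.+2]. *)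
    apply/(pathP 0) => i; rewrite -[rcons _ _](_ : iota 0 n.+2 = _); last first.
      by rewrite -[n.+2]addn1 iotaD cats1.
    rewrite size_iota => i_lt; rewrite nth_iota // add0n.
    case: i i_lt => [|i] i_lt; rewrite /linked.
      have enx0 : A m4 a_nx n.+1 = 0 by rewrite enx ?ltnn ?eqxx // /array_size; lia.
      by rewrite /nth enx0 epv0 !eqxx.
    have -> : nth 0 (n.+1 :: iota 0 n.+2) i.+1 = i.
      by rewrite -[LHS]/(nth 0 (iota 0 n.+2) i) nth_iota //; lia.
    have i_n : i <= n by lia.
    by rewrite enx ?epv ?i_n ?eqxx // /array_size; lia.
  by move=> D idD; rewrite mem0 esz; case: eqP => // _; rewrite size_iota.
- have e_fs : mkseq (A m4 a_fs) (V m4 v_top) = iota n.+2 (3 * n + 2).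
    rewrite etop -[in RHS](addn0 n.+2) iotaDl; apply/eq_in_map => i; rewrite mem_iota => ir.
    by rewrite efs; lia.
  split=> [|D]; rewrite e_fs ?iota_uniq // mem_iota mem0 /is_id /array_size.
  case: (eqVneq D n.+1) => [->|Dn]; last by rewrite eqxx andbT; lia.
  by have -> : (iota 0 n.+1 == [::]) = false by []; lia.
by move=> x xn; rewrite eox ?enx ?xn // /array_size; lia.
Qed.

Definition grouped (q gs : nat -> nat) j st := [/\ 0 < st <= j.+1,
  forall i, i < j -> 0 < gs i <= st,
  forall i i', i < i' < j -> gs i <= gs i' /\ (gs i == gs i') = leL w (q i') (q i) &
  0 < j -> gs j.-1 = st].

(** Round 0 splits the single class of [E_0] by letters and moves every position but [n], which is
    alone in [E_1] by [eqv_end]. *)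
Lemma queue_ok0 q gs st : sorted (lePos w) (mkseq q n) ->
  perm_eq (mkseq q n) (iota 0 n) -> grouped q gs n st -> queue_ok w 0 n q gs 0 st.
Proof.
move=> srt prm [_ gs_pos gs_mono _].
have in_q x : (x \in mkseq q n) = (x < n) by rewrite (perm_mem prm) mem_iota.
have q_lt i : i < n -> q i < n by move=> i_n; rewrite -in_q map_f // mem_iota.
have uq : uniq (mkseq q n) by rewrite (perm_uniq prm) iota_uniq.
have q_neq i i' : i < i' < n -> q i != q i'.
  move=> /andP[ii' i'n]; have := nth_uniq 0 _ _ uq (i := i) (j := i').
  rewrite size_mkseq !nth_mkseq ?(ltn_trans ii' i'n) // => -> //.
  by rewrite neq_ltn ii'.
have q_le i i' : i < i' < n -> lePos w (q i) (q i').
  move=> /andP[ii' i'n]; move: srt; rewrite (sorted_pairwise (@lePos_trans _ _ w)).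
  move=> /(pairwiseP 0) H; have := H i i'; rewrite !inE size_mkseq !nth_mkseq //.
    by apply=> //; apply: ltn_trans ii' i'n.
  exact: ltn_trans ii' i'n.
have eqv_q i i' : i < i' < n -> eqv w 1 (q i) (q i') = leL w (q i') (q i).
  move=> ii'; have /andP[le _] := q_le _ _ ii'; have /andP[i_i' i'n] := ii'.
  by rewrite eqv1_leL ?le ?q_lt // (ltn_trans i_i').
split=> //.
- move=> i i' ii'; have [le _] := gs_mono i i' ii'; split=> //; first exact: q_neq.
  rewrite eqv_q // => e; have /andP[_ /implyP/(_ e)] := q_le _ _ ii'.
  by rewrite leq_eqVlt (negbTE (q_neq _ _ ii')).
- move=> i i' i_n i'_n _; case: (ltngtP i i') => [lt|lt|->].
  + have ii' : i < i' < n by rewrite lt.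
    by have [_ ->] := gs_mono i i' ii'; rewrite eqv_q.
  + have ii' : i' < i < n by rewrite lt.
    by rewrite eq_sym eqv_sym eqv_q //; have [_ ->] := gs_mono i' i ii'.
  by rewrite eqxx eqv_refl.
move=> x y xn yn _; rewrite !in_q -leqNgt => x_ge.
have -> : x = n by lia.
rewrite -leqNgt; apply/idP/idP => [/(eqv_end yn) -> //|y_ge].
by rewrite (_ : y = n) ?eqv_refl //; lia.
Qed.

Lemma leL_refl x : leL w x x.
Proof. by have := leL_total w x x; rewrite orbb. Qed.

Lemma init_groups_ok m0 : sorted (lePos w) (mkseq (A m0 a_q) n) ->
  perm_eq (mkseq (A m0 a_q) n) (iota 0 n) ->
  wp init_groups (fun m t => [/\ queue_ok w 0 n (A m a_q) (A m a_gs) 0 (V m v_st),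
    V m v_st <= n.+1, V m v_m = n & t <= 9 * n.+1]) m0.
Proof.
move=> srt prm; have big' := big; rewrite /init_groups; step; subst v.
set q := A m0 a_q in srt prm *; set m1 := setv _ _ _.
have q_lt i : i < n -> q i < n.
  by move=> i_n; have := perm_mem prm (q i); rewrite mem_iota map_f // mem_iota.
apply: wp_seq.
apply: (@wp_for_const _ _ _ _ 5 _ _ _ (fun j m => grouped q (A m a_gs) j (V m v_st)) n) => //.
- by lia.
- by lia.
- by split=> // i i' /andP[].
- by move=> m _; compute_mem; split=> //; lia.
- move=> j m [FV FA _] jn ek [st_bd g1 g2 g3].
  have eq : A m a_q = q := FA a_q isT.
  have qj := q_lt j jn; have qj1 := q_lt j.-1; rewrite /group_step.
  have le_prev i : i < j -> leL w (q i) (q j.-1).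
    rewrite -ltnS => ij; case: (ltngtP i j.-1) => [lt|lt|->]; [|lia|exact: leL_refl].
    move: srt; rewrite (sorted_pairwise (@lePos_trans _ _ w)) => /(pairwiseP 0) H.
    have := H i j.-1; rewrite !inE size_mkseq !nth_mkseq; [|lia|lia].
    by move=> /(_ _ _ lt) /andP[]; lia.
  have le_j : 0 < j -> leL w (q j.-1) (q j).
    move=> j0; move: srt; rewrite (sorted_pairwise (@lePos_trans _ _ w)) => /(pairwiseP 0) H.
    have := H j.-1 j; rewrite !inE size_mkseq !nth_mkseq; [|lia|lia].
    by move=> H'; have /andP[] : lePos w (q j.-1) (q j) by apply: H'; lia.
  step.
  + rewrite eq ek subn1; split; first by sides.
    move=> j0; have := qj1 => qj2; have : q j.-1 < n by apply: qj2; lia.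
    by move=> qj3; sides.
  + rewrite eq ek subn1 !addn1 => /andP[j0]; rewrite leL_letter //; last by apply: q_lt; lia.
    move=> nle; step; step; split=> //; split; compute_mem; rewrite ?E0 ?ek ?addn1.
    * by lia.
    * move=> i; rewrite ltnS leq_eqVlt => /orP[/eqP ->|ij]; first by rewrite upd_same; lia.
      by rewrite upd_diff ?neq_ltn ?ij //; have := g1 i ij; lia.
    * move=> i i' /andP[ii']; rewrite ltnS leq_eqVlt => /orP[/eqP ei'|i'j]; last first.
        by rewrite !upd_diff ?neq_ltn ?i'j ?(ltn_trans ii' i'j) //; apply: g2; rewrite ii'.
      subst i'; rewrite upd_same upd_diff ?neq_ltn ?ii' //; have := g1 i ii'; split; first by lia.
      have -> : leL w (q j) (q i) = false; last by lia.
      by apply/negP=> le; case/negP: nle; apply: leL_trans le (le_prev i ii').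
    by rewrite upd_same.
  rewrite eq ek subn1 !addn1 => keep; step; step; split=> //; split; compute_mem; rewrite ?ek.
  + by lia.
  + move=> i; rewrite ltnS leq_eqVlt => /orP[/eqP ->|ij]; first by rewrite upd_same; lia.
    by rewrite upd_diff ?neq_ltn ?ij //; apply: g1.
  + move=> i i' /andP[ii']; rewrite ltnS leq_eqVlt => /orP[/eqP ei'|i'j]; last first.
      by rewrite !upd_diff ?neq_ltn ?i'j ?(ltn_trans ii' i'j) //; apply: g2; rewrite ii'.
    subst i'; have j0 : 0 < j by lia.
    have le : leL w (q j) (q j.-1).
      rewrite -leL_letter //; last by apply: q_lt; lia.
      by move: keep; rewrite j0 /= negbK.
    rewrite upd_same upd_diff ?neq_ltn ?ii' // -(g3 j0).
    (* Position [j] in the queue shares letter and stamp with its neighbour [j.-1], so comparisons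
       with earlier entries carry over from there. *)
    case: (ltngtP i j.-1) => [lt|lt|ei]; [|lia|by rewrite ei eqxx le].
    have [le1 ->] := g2 i j.-1 (introT andP (conj lt (ltac:(lia) : j.-1 < j))).
    split=> //; apply/idP/idP => [le2|le2]; first exact: leL_trans le le2.
    exact: leL_trans (le_j j0) le2.
  by rewrite upd_same.
move=> t m F G t_le; have [FV FA _] := F; have eq : A m a_q = q := FA a_q isT.
step; split=> //.
- by rewrite eq; apply: queue_ok0.
- by case: G => /andP[].
by lia.
Qed.

End Init.

(** * Total cost *)

(** [91 = 12 + 79], because the first queue holds all [n] positions; the factor of [87] is the bound
    of [potential_leq]. *)
Definition main_time n :=
  3 * n + 4 + (trunc_log 2 n).+1 * (15 * n + 7) + 100 * n.+1 + 9 * n.+1 +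
  91 * n + 87 * (n.+1 * trunc_log 2 n.+1) + 2.

Definition total_time n :=
  number_of_arrays * (array_size n + 2) + 1 + main_time n.

Section Main.
Variables (d : Order.disp_t) (T : orderType d) (w : seq (Equality.sort T)).
Notation n := (@size (Equality.sort T) w).

Lemma n_lt_pow : n.+1 <= 2 ^ (trunc_log 2 n).+1.
Proof. exact: trunc_log_ltn. Qed.

(** Origin of [k = 8]: with [B = 2 ^ (trunc_log 2 n).+1], two factors [B] bound [n.+1 * n.+1] and
    the other six bound [64 = 2 ^ 6]. *)
Lemma wlimit_big : 64 * n.+1 * n.+1 <= wlimit 8 w.
Proof.
rewrite /wlimit [8 * _]mulnC expnM; have := n_lt_pow; set B := 2 ^ _ => nB.
have B2 : 2 <= B by rewrite /B -{1}[2]expn1 leq_exp2l.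
rewrite (_ : B ^ 8 = B ^ 6 * B * B); last by rewrite -!expnSr.
by rewrite !leq_mul //; apply: (@leq_trans (2 ^ 6)); rewrite ?leq_exp2r.
Qed.

Definition memory0 := Memory (fun=> 0) (fun _ _ => 0) (fun=> [::]).

Lemma mrc_main_ok : wp 8 w mrc_main
  (fun m t => (forall i, i < n -> OUT m i = jumps w n i) /\ t <= main_time n) memory0.
Proof.
have big := wlimit_big; rewrite /mrc_main; apply: wp_seq.
apply: wp_mono (merge_sort_ok big memory0) => m1 t1 [FV1 FA1 FO1] [srt prm t1_le].
have sz1 D : A m1 a_sz D = 0 by rewrite (FA1 a_sz isT).
apply: wp_seq.
apply: wp_mono (init_lists_ok big sz1) => m2 t2 [FV2 FA2 FO2] [R2 free2 ox2 t2_le].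
have eq2 : A m2 a_q = A m1 a_q := FA2 a_q isT.
rewrite -eq2 in srt prm; apply: wp_seq.
apply: wp_mono (init_groups_ok big srt prm) => m3 t3 [FV3 FA3 FO3] [Q3 st3 em3 t3_le].
have RS3 : round_start w 0 0 m3.
  split.
  - by apply: refines_ext R2; apply: FA3.
  - have e1 : A m3 a_cl = A m2 a_cl := FA3 a_cl isT.
    have e2 : A m3 a_fs = A m2 a_fs := FA3 a_fs isT.
    have e3 : V m3 v_top = V m2 v_top := FV3 v_top isT.
    by rewrite e1 e2 e3.
  - move=> x xn; have e1 : A m3 a_ox = A m2 a_ox := FA3 a_ox isT.
    have e2 : A m3 a_nx = A m2 a_nx := FA3 a_nx isT.
    by rewrite e1 e2 ox2.
  - by move=> D _; rewrite (FA3 a_sg isT) (FA2 a_sg isT) (FA1 a_sg isT).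
  - by rewrite em3.
  - by move=> D _; rewrite (FA3 a_dn isT) (FA2 a_dn isT) (FA1 a_dn isT).
  - by move=> i _; rewrite FO3 // FO2 // FO1.
  - by [].
  by rewrite muln1; lia.
apply: wp_mono (rounds_ok big RS3) => m4 t4 _ [out4 t4_le]; split=> //.
rewrite em3 in t4_le; have := potential_leq w 0; rewrite /main_time.
by lia.
Qed.

Lemma alloc_arrays_ok a : exists s t,
  [/\ exec 8 w (alloc_arrays a) (init_state n) s t,
      t <= a * (array_size n + 2) + 1, space s = a * array_size n,
      var s =1 (fun=> 0) /\ out s = nseq n [::] &
      forall b, arr s b = if b < a then nseq (array_size n) 0 else [::]].
Proof.
elim: a => [|a [s [t [E t_le sp [vs os] As]]]].
  by exists (init_state n), 1; split=> //; apply: ExecSkip.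
have big := wlimit_big.
exists (alloc s a (array_size n)), (t + (array_size n).+1); split.
- apply: ExecSeq E _; apply: ExecAlloc; last by rewrite As ltnn.
  have lt c : c <= 4 * n.+1 -> word 8 w c = Some c.
    by move=> c_le; rewrite /word -/(wlimit 8 w); have -> : c < wlimit 8 w by lia.
  by rewrite /= !lt ?addn1 //=; rewrite ?lt ?addn1 //; lia.
- by rewrite mulSn; lia.
- by rewrite /= sp mulSn addnC.
- by [].
move=> b; rewrite /= ltnS leq_eqVlt; case: eqP => //= _; exact: As.
Qed.

Lemma mrc_program_ok : exists s t,
  [/\ exec 8 w mrc_program (init_state n) s t, out s = MRC w,
      t <= total_time n & space s = number_of_arrays * array_size n].
Proof.
have [s0 [t0 [E0 t0_le sp0 [vs0 os0] As0]]] := alloc_arrays_ok number_of_arrays.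
have R0 : represents w (number_of_arrays * array_size n) s0 memory0.
  split=> //.
  - by move=> a a_lt; rewrite As0 a_lt size_nseq.
  - by move=> a i a_lt _; rewrite As0 a_lt nth_nseq if_same.
  by rewrite os0 size_nseq; split=> // i _; rewrite nth_nseq if_same.
have [m [t [E [outm t_le]]]] := mrc_main_ok.
have [s E' [_ _ _ [size_out outE] sp']] := aexec_exec E R0.
exists s, (t0 + t); split=> //; first exact: ExecSeq E0 E'.
  apply: (@eq_from_nth _ [::]) => [|i]; first by rewrite size_out size_map size_iota.
  rewrite size_out => i_n; rewrite outE // outm // (nth_map 0) ?size_iota //.
  by rewrite nth_iota // add1n MRC_entryE.
by rewrite /total_time; lia.
Qed.

End Main.

Lemma total_time_bound n : 2 <= n -> total_time n <= 1000 * (n * trunc_log 2 n).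
Proof.
move=> n2; set L := trunc_log 2 n; have L1 : 0 < L by rewrite trunc_log_gt0.
have LS : trunc_log 2 n.+1 <= L.+1.
  rewrite -trunc_log2_double; last by lia.
  by apply: leq_trunc_log; lia.
have nX : n <= n * L by rewrite leq_pmulr.
have LX : L <= n * L by rewrite leq_pmull //; lia.
have H : n.+1 * trunc_log 2 n.+1 <= n.+1 * L.+1 by rewrite leq_mul.
by rewrite /total_time /main_time /number_of_arrays /array_size -/L; lia.
Qed.

Lemma total_space_bound n (space := number_of_arrays * array_size n) : 1 <= n ->
  n <= 1 * space /\ space <= 128 * n.
Proof. by rewrite /space /number_of_arrays /array_size; lia. Qed.

Theorem theorem3 :
  exists (p : com) (k : nat),
    (* total correctness on every string *)
    (forall (d : Order.disp_t) (T : orderType d) (w : seq T),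
       exists (s : state) (t : nat),
         exec k w p (init_state (size w)) s t /\ out s = MRC w)
    (* running time O(n log n) *)
    /\ (exists C n0 : nat,
          forall (d : Order.disp_t) (T : orderType d) (w : seq T)
                 (s : state) (t : nat),
            n0 <= size w -> exec k w p (init_state (size w)) s t ->
            t <= C * (size w * trunc_log 2 (size w)))
    (* auxiliary space Theta(n) *)
    /\ (exists C1 C2 n0 : nat,
          forall (d : Order.disp_t) (T : orderType d) (w : seq T)
                 (s : state) (t : nat),
            n0 <= size w -> exec k w p (init_state (size w)) s t ->
            size w <= C1 * space s /\ space s <= C2 * size w).
Proof.
exists mrc_program, 8; split; last split.
- move=> d T w; have [s [t [E outE _ _]]] := mrc_program_ok w.
  by exists s, t.
(* The bound concerns every run; determinism identifies it with the constructed one. *)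
- exists 1000, 2 => d T w s t n2 E; have [s' [t' [E' _ t'_le _]]] := mrc_program_ok w.
  have [_ ->] := exec_det E E'.
  exact: leq_trans t'_le (total_time_bound n2).
exists 1, 128, 1 => d T w s t n1 E; have [s' [t' [E' _ _ sp']]] := mrc_program_ok w.
have [-> _] := exec_det E E'; rewrite sp'; exact: total_space_bound n1.
Qed.
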